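(* Let $\nu\in\mathcal P_2(\mathbb R)$ and $L>0$. For $\mu_0\in\mathcal P_2(\mathbb R)$, let $g$ be the strong solution of the Cauchy problem $\partial_t g(t)\in-\partial F_\nu(g(t))$, $t\in(0,\infty)$, $g(0)=g_0=Q_{\mu_0}$, and $\gamma_t:=(g(t))_\#\Lambda_{(0,1)}$. i) Assume $Q_\nu\in D_L^-$. Then the solution starting in $g_0\in D_L^-$ fulfills $g(t)\in D_L^-$ for all $t\ge0$. More precisely, for all $t>0$, $$L_{\rm low}(g(t)) \ge L_{\rm low}(g_0)\cdot e^{-\frac{2t}{L_{\rm low}(Q_\nu)}} + L_{\rm low}(Q_\nu)\cdot\Big(1-e^{-\frac{2t}{L_{\rm low}(Q_\nu)}}\Big)>0.$$ Moreover, $J_\varepsilon^{\partial F_\nu}$ maps $D_L^-$ into itself for all $\varepsilon>0$. In particular, if the initial measure $\mu_0$ has an $L_0$-Lipschitz continuous CDF $R_{\mu_0}$, then the CDF $R_{\gamma_t}$ remains Lipschitz (and thus absolutely) continuous with constant $\le\max\{L_0,L^{-1}\}$ for all $t\ge0$. ii) Assume $\operatorname{supp}\nu=[a,b]$ and $Q_\nu\in D_L^+$. Then the solution starting in $g_0\in D_{[a,b]}\cap D_L^+$ fulfills $g(t)\in D_{[a,b]}\cap D_L^+$ for all $t\ge0$. More precisely, for all $t>0$, $$\mathrm{Lip}(g(t)) \le \mathrm{Lip}(g_0)\cdot e^{-\frac{2t}{\mathrm{Lip}(Q_\nu)}}+\mathrm{Lip}(Q_\nu)\cdot\Big(1-e^{-\frac{2t}{\mathrm{Lip}(Q_\nu)}}\Big)<\infty.$$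 Moreover, $J_\varepsilon^{\partial F_\nu}$ maps $D_{[a,b]}\cap D_L^+$ into itself for all $\varepsilon>0$. In particular, if the initial measure $\mu_0$ has convex support $\operatorname{supp}\mu_0\subseteq[a,b]$ and $Q_{\mu_0}\in D_L^+$, then $\gamma_t$ has convex support for all $t\ge0$ (no gaps of empty mass can form).
   Context: $\mathcal P_2(\mathbb R)$ is the set of Borel probability measures on $\mathbb R$ with finite second moment; $\Lambda_{(0,1)}$ is Lebesgue measure on $(0,1)$ and $T_\#\mu=\mu\circ T^{-1}$. For a probability measure $\mu$ on $\mathbb R$: $R_\mu^+(x) := \mu((-\infty,x])$ is its CDF (written $R_\mu$ if continuous) and $Q_\mu(s) := \min\{x \in \mathbb R : R_\mu^+(x) \ge s\}$, $s\in(0,1)$. $\mathcal C(0,1) := \{ f \in L_2(0,1) : f \text{ is non-decreasing (a.e.)}\}$ is the set of (classes of) quantile functions of measures in $\mathcal P_2(\mathbb R)$; each element is identified with its unique left-continuous non-decreasing representative. With difference quotients taken over $s_1\neq s_2$: - $D_{[a,b]} := \{Q_\mu\in\mathcal C(0,1) : \operatorname{supp}\mu\subseteq[a,b]\}$; - $D_L^- := \{Q_\mu\in\mathcal C(0,1) : L\le\frac{Q_\mu(s_1)-Q_\mu(s_2)}{s_1-s_2} \text{ for all } s_1,s_2\in(0,1)\}$; - $D_L^+ := \{Q_\mu\in\mathcal C(0,1) : \frac{Q_\mu(s_1)-Q_\mu(s_2)}{s_1-s_2}\le L \text{ for all } s_1,s_2\in(0,1)\}$; - $L_{\rm low}(Q_\mu)$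 is the largest $L'\ge0$ with $\frac{Q_\mu(s_1)-Q_\mu(s_2)}{s_1-s_2}\ge L'$ for all $s_1,s_2$; $\mathrm{Lip}(Q_\mu)\in[0,\infty]$ is the smallest $L'\geq 0$ with $\frac{Q_\mu(s_1)-Q_\mu(s_2)}{s_1-s_2}\le L'$ for all $s_1,s_2$. In the degenerate case $\mathrm{Lip}(Q_\nu)=0$ one reads $e^{-2t/0}=0$. $F_\nu\colon L_2(0,1)\to\mathbb R$, $F_\nu(u) = \int_0^1 \big( (1-2s)\,u(s) + \int_0^1 |u(s)-Q_\nu(t)|\,dt \big) ds$, with subdifferential $\partial F(u) := \{ v \in L_2(0,1) : F(w) \ge F(u) + \langle v, w-u\rangle + o(\|w-u\|) \text{ for all } w \}$ (for convex $F$ the $o$-term can be omitted); $J_\varepsilon^{\partial F_\nu}:=(I+\varepsilon\,\partial F_\nu)^{-1}\colon L_2(0,1)\to L_2(0,1)$ is the (single-valued) resolvent. A strong solution of the Cauchy problem is a function $g \in W^1_1((0,T];L_2(0,1)) \cap C([0,\infty);L_2(0,1))$ for every $T>0$, satisfying the initial condition and, for a.e. $t>0$, the inclusion, with $\partial_t g(t)$ the strong derivative; it exists, is unique, and takes values in $\mathcal C(0,1)$. *)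

(* Defs.v *)
From HB Require Import structures.
From mathcomp Require Import all_boot all_order all_algebra.
From mathcomp Require Import all_classical all_reals all_analysis.

Set Implicit Arguments.
Unset Strict Implicit.
Unset Printing Implicit Defensive.

Import Order.TTheory GRing.Theory Num.Theory.
Import numFieldNormedType.Exports.

Local Open Scope classical_set_scope.
Local Open Scope ring_scope.

(* The value is [x0] when [A] has no least (resp. greatest) element. *)
Definition least {d} {T : porderType d} (x0 : T) (A : set T) : T :=
  xget x0 (A `&` lbound A).
Definition greatest {d} {T : porderType d} (x0 : T) (A : set T) : T :=
  xget x0 (A `&` ubound A).

Section measures_on_the_line.
Context {R : realType}.
Implicit Types mu : set (measurableTypeR R) -> \bar R.

Definition cdfR mu (x : R) : R := fine (mu `]-oo, x]%classic).

Definition quantile mu (s : R) : R := least 0 [set x | s <= cdfR mu x].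

Definition supp mu : set R :=
  [set x | forall U : set R, open U -> U x -> (0 < mu U)%E].

Definition P2 (mu : probability (measurableTypeR R) R) : Prop :=
  (\int[mu]_x (x ^+ 2)%:E < +oo)%E.

Definition absolutely_continuous (f : R -> R) : Prop :=
  forall e : R, 0 < e -> exists2 d : R, 0 < d &
    forall (n : nat) (a b : 'I_n -> R), (forall i, a i <= b i) ->
      trivIset setT (fun i => `]a i, b i[%classic) ->
      \sum_(i < n) (b i - a i) < d -> \sum_(i < n) `|f (b i) - f (a i)| < e.

End measures_on_the_line.

Definition Lambda01 (R : realType) :
    {measure set (measurableTypeR R) -> \bar R} :=
  mrestr (@lebesgue_measure R) (measurable_itv `]0 : R, 1[).
Arguments Lambda01 {R}.

(* Elements are square-integrable functions, not classes: classes are equal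
   when representatives are equal [%[ae Lambda01]], and every notion below is
   invariant under that equality. The values outside ]0, 1[ are irrelevant. *)
Definition L2 (R : realType) := LfunType (@Lambda01 R) (lee1n 2).

Section L2_space.
Context {R : realType}.
Implicit Types u v w : L2 R.

Definition inner u v : R := \int[Lambda01]_s (u s * v s).

Definition L2norm u : R := fine ('N[Lambda01]_2%:E[EFin \o u]).

Implicit Type F : L2 R -> R.

Definition subdiff F u : set (L2 R) :=
  [set v | forall e : R, 0 < e -> exists2 d : R, 0 < d &
    forall w, L2norm (w - u) < d ->
      F u + inner v (w - u) - e * L2norm (w - u) <= F w].

(* The set of values of (I + eps * subdiff F)^-1 at u. *)
Definition resolvent F (eps : R) u : set (L2 R) :=
  [set w | exists2 v, subdiff F w v & u = w + eps *: v %[ae Lambda01]].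

(* A set-valued map with at most one value up to a.e. equality is a map of D
   into itself when it has a value at every point of D, and all lie in D. *)
Definition maps_into_itself (J : L2 R -> set (L2 R)) (D : set (R -> R)) :=
  forall u, D u -> J u !=set0 /\ forall w, J u w -> D w.

Definition Fnu (nu : probability (measurableTypeR R) R) u : R :=
  \int[Lambda01]_s ((1 - 2 * s) * u s +
                    \int[Lambda01]_t `|u s - quantile nu t|).

End L2_space.

Section L2_valued_functions.
Context {R : realType}.
Implicit Types (D : set (measurableTypeR R)) (g h : R -> L2 R).

Definition simple_function (f : measurableTypeR R -> L2 R) : Prop :=
  finite_set (range f) /\ forall x, measurable (f @^-1` [set x]).

Definition simple_integral D (f : measurableTypeR R -> L2 R) : L2 R :=
  \sum_(x \in range f) fine (lebesgue_measure (D `&` f @^-1` [set x])) *: x.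

Definition strongly_measurable D h : Prop :=
  exists2 f : nat -> R -> L2 R, (forall n, simple_function (f n)) &
    {ae lebesgue_measure, forall t, D t ->
      L2norm (f n t - h t) @[n --> \oo] --> (0 : R)}.

(* The norm of a strongly measurable function is a.e. equal to a Borel function,
   which is enough for the integral of a nonnegative function (a supremum over
   simple functions below it) to have its usual value. *)
Definition bochner_integrable D h : Prop :=
  strongly_measurable D h /\
  (\int[lebesgue_measure]_(t in D) (L2norm (h t))%:E < +oo)%E.

(* [y] is a value of the Bochner integral over [D], a set of finite measure,
   of a Bochner integrable function [h]. *)
Definition is_bochner_integral D h (y : L2 R) : Prop :=
  exists f : nat -> R -> L2 R, [/\ forall n, simple_function (f n),
    (\int[lebesgue_measure]_(t in D) (L2norm (f n t - h t))%:E)%E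
      @[n --> \oo] --> 0%E &
    L2norm (simple_integral D (f n) - y) @[n --> \oo] --> (0 : R)].

(* Membership in W^1_1((0, T]; L2), for the representative that is a primitive
   of the weak derivative [h]. *)
Definition W11 (T : R) g : Prop :=
  bochner_integrable `]0, T] g /\
  exists2 h, bochner_integrable `]0, T] h &
    forall s t : R, 0 < s -> s <= t -> t <= T ->
      is_bochner_integral `]s, t] h (g t - g s).

Definition continuous_from_0 g : Prop :=
  forall t : R, 0 <= t ->
    L2norm (g r - g t) @[r --> within [set r | 0 <= r] (nbhs t)] --> (0 : R).

Definition strong_derivative g (t : R) (v : L2 R) : Prop :=
  L2norm (r^-1 *: (g (t + r) - g t) - v) @[r --> 0^'] --> (0 : R).

Definition strong_solution (F : L2 R -> R) (g0 : R -> R) g : Prop :=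
  [/\ forall T : R, 0 < T -> W11 T g,
      continuous_from_0 g,
      g 0 = g0 %[ae Lambda01] &
      {ae lebesgue_measure, forall t : R, 0 < t ->
        exists2 v, strong_derivative g t v & subdiff F (g t) (- v)}].

End L2_valued_functions.

Section quantile_classes.
Context {R : realType}.
Implicit Types (u q : R -> R) (L a b : R).

Definition difference_quotients q : set R :=
  [set x | exists s1 s2 : R, [/\ 0 < s1 < 1, 0 < s2 < 1, s1 != s2 &
    x = (q s1 - q s2) / (s1 - s2)]].

(* Sets of classes, given as sets of functions closed under a.e. equality. *)
Definition Dab a b : set (R -> R) :=
  [set u | exists mu : probability (measurableTypeR R) R,
    [/\ P2 mu, u = quantile mu %[ae Lambda01] & supp mu `<=` `[a, b]]].

Definition Dminus L : set (R -> R) :=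
  [set u | exists mu : probability (measurableTypeR R) R,
    [/\ P2 mu, u = quantile mu %[ae Lambda01] &
        forall x, difference_quotients (quantile mu) x -> L <= x]].

Definition Dplus L : set (R -> R) :=
  [set u | exists mu : probability (measurableTypeR R) R,
    [/\ P2 mu, u = quantile mu %[ae Lambda01] &
        forall x, difference_quotients (quantile mu) x -> x <= L]].

Definition left_continuous_nondecreasing q : Prop :=
  {in `]0, 1[ &, {homo q : x y / x <= y}} /\
  (forall s, 0 < s < 1 -> q x @[x --> s^'-] --> q s).

(* The left-continuous nondecreasing representative of the class of [u]; it is
   determined on ]0, 1[, which is all that [Llow] and [Lip] depend on. *)
Definition lcrep u : R -> R :=
  xget u [set q | left_continuous_nondecreasing q /\
                  u = q %[ae (@Lambda01 R)]].

Definition Llow u : R :=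
  greatest 0 [set L | 0 <= L /\
    forall x, difference_quotients (lcrep u) x -> L <= x].

Definition Lip u : \bar R :=
  least +oo%E [set L | (0 <= L)%E /\
    forall x, difference_quotients (lcrep u) x -> (x%:E <= L)%E].

(* e^(-2t/l), with value 0 at l = 0. *)
Definition decay (t l : R) : R := if l == 0 then 0 else expR (- (2 * t / l)).

End quantile_classes.

(* Main.v *)
Require Import Defs.
From HB Require Import structures.
From mathcomp Require Import all_boot all_order all_algebra.
From mathcomp Require Import all_classical all_reals all_analysis.
From mathcomp Require Import measurable_realfun ring lra.
Set Implicit Arguments.
Unset Strict Implicit.
Unset Printing Implicit Defensive.
Import Order.TTheory GRing.Theory Num.Theory.
Import numFieldNormedType.Exports.
Local Open Scope classical_set_scope.
Local Open Scope ring_scope.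

(** For almost every time [t], minus the velocity of a solution [g] lies in the
    subdifferential of [Fnu nu] at [g t].  This subdifferential is computed
    pointwise ([subdiff_qgraph]): [v] belongs to it at [u] when, for almost every
    [s], [v s = 2 (r s - s)] for some [r s] between the left limit and the value
    at [u s] of the distribution function of [nu], that is, when [(u s, r s)] lies
    on the completed graph [qgraph] of that function.  The flow is thus a family
    of scalar inclusions, one for each [s], with velocity [2 (s - r)].

    If the difference quotients of the quantile function of [nu] are at least
    [l > 0], the completed graph has slope at most [1 / l].  For [s < s'] the gap
    [d = g t s' - g t s] then satisfies [d' >= 2 (s' - s) - 2 d / l], so
    [d / (s' - s)] stays above the solution [m] of [m' = (2 / l) (l - m)], which is
    the bound of the theorem ([relax]).  If the quotients are at most [l], all
    inequalities are reversed between [a] and [b], the only place where the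
    completed graph is steep; the solution stays there because the velocity
    points inwards outside of [[a, b]].

    Solutions are curves of classes, without values at a given [s], so this
    argument is integrated over ordered pairs.  The squared norm of the positive
    part of [m t (s' - s) - (g t s' - g t s)] over the pairs [s < s'], the [defect],
    vanishes at time 0.  Its increments are dominated by the integral of a
    function ([W11_bound]) and almost everywhere its right derivative is
    nonpositive, by the scalar computation ([defect_right_derivative]); such a
    function is nonincreasing ([ac_nonincreasing]).  Hence the defect is zero at all
    times ([flow_sign]), and the scalar inequality holds for almost every pair.
    A class whose difference quotients are bounded in this sense is the quantile
    function of its own law, with the same bounds everywhere
    ([ordered_pairs_ae], [monotone_class]).

    The resolvent equation reads [u s + 2 eps s = w s + 2 eps (r s)] with
    [(w s, r s)] on the completed graph.  It is solved explicitly
    ([resolvent_neq0]), and subtracting it at two parameters gives the bounds on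
    the slopes of [w].

    Statements on distribution functions and supports follow from the Galois
    connection between a distribution function and its quantile function
    ([quantile_galois]). *)

(** * Lebesgue measure on the unit interval and square-integrable classes *)

(** [Lambda01] as a plain function, to which the structure of a probability is
    attached below. *)
Definition Lam {R : realType} : set (measurableTypeR R) -> \bar R := Lambda01.

HB.instance Definition _ (R : realType) :=
  Measure.copy (@Lam R) (Measure.sort (@Lambda01 R)).

Lemma Lam_setT (R : realType) : @Lam R setT = 1%E.
Proof.
by rewrite /Lam /Lambda01 /= /mrestr setTI lebesgue_measure_itv /= lte_fin ltr01
  oppr0 adde0.
Qed.

HB.instance Definition _ (R : realType) :=
  Measure_isProbability.Build _ _ _ (@Lam R) (@Lam_setT R).

Section Lam_theory.
Context {R : realType}.

Lemma Lam_lebesgue (A : set R) : @Lam R A = lebesgue_measure (A `&` `]0, 1[).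
Proof. by []. Qed.

Lemma Lam_itvNy (x : R) : 0 <= x <= 1 -> @Lam R `]-oo, x] = x%:E.
Proof.
move=> /andP[x0 x1]; rewrite Lam_lebesgue.
have [xe|xn] := eqVneq x 1.
  rewrite (_ : _ `&` _ = `]0, 1[%classic); last first.
    apply/seteqP; split => [y []//|y]; rewrite /= !in_itv /= => /andP[a b].
    by rewrite a b xe ltW.
  by rewrite lebesgue_measure_itv /= lte_fin ltr01 oppr0 adde0 xe.
rewrite (_ : _ `&` _ = `]0, x]%classic); last first.
  have x1' : x < 1 by rewrite lt_neqAle xn.
  apply/seteqP; split => y /=; rewrite !in_itv /=.
    by move=> [a /andP[b c]]; rewrite a b.
  by move=> /andP[a b]; rewrite b a (le_lt_trans b).
rewrite lebesgue_measure_itv /= lte_fin; case: ltP => [_|];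
  first by rewrite oppr0 adde0.
by move=> x0'; congr EFin; apply/eqP; rewrite eq_le x0.
Qed.

Lemma Lam_ae01 : {ae @Lam R, forall s, 0 < s < 1}.
Proof.
exists (~` `]0, 1[%classic); split.
- exact: measurableC.
- by rewrite Lam_lebesgue setICl measure0.
- by move=> s /= h; rewrite in_itv.
Qed.

Lemma Lam_aeI (P Q : R -> Prop) : {ae @Lam R, forall s, P s} ->
  {ae @Lam R, forall s, Q s} -> {ae @Lam R, forall s, P s /\ Q s}.
Proof. exact: (@filterI _ _ (ae_filter_ringOfSetsType _)). Qed.

(** Almost every parameter lies in ]0, 1[, so a.e. reasoning may assume it. *)
Lemma Lam_aeS (P Q : R -> Prop) : {ae @Lam R, forall s, P s} ->
  (forall s, 0 < s < 1 -> P s -> Q s) -> {ae @Lam R, forall s, Q s}.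
Proof.
move=> HP H; apply: (@filterS _ _ (ae_filter_ringOfSetsType _) _ _ _ (Lam_aeI
  Lam_ae01 HP)).
by move=> s [h1 h2]; exact: H.
Qed.

(** A nonempty open subinterval of ]0, 1[ has positive measure, so a conull
    set meets it. *)
Lemma Lam_dense (E : set R) (a b : R) : {ae @Lam R, forall s, E s} ->
  0 <= a -> a < b -> b <= 1 -> exists2 s, a < s < b & E s.
Proof.
move=> [N [mN N0 EN]] a0 ab b1; apply: contrapT => H.
have sub : `]a, b[ `<=` N `&` `]0, 1[.
  move=> s /=; rewrite in_itv /= => sab; split.
    by apply: EN => /= Es; apply: H; exists s.
  by case/andP: sab => h1 h2; rewrite in_itv/= (le_lt_trans a0 h1) (lt_le_trans h2).
have : (lebesgue_measure `]a, b[%classic <= 0 :> \bar R)%E.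
  rewrite -N0 Lam_lebesgue; apply: le_measure; rewrite ?inE//.
  exact: measurableI.
by rewrite lebesgue_measure_itv /= lte_fin ab -EFinB lee_fin leNgt subr_gt0 ab.
Qed.

Lemma Lam_countable (A : set R) : countable A -> {ae @Lam R, forall s, ~ A s}.
Proof.
move=> cA; exists A; split.
- exact: countable_measurable.
- have mA : measurable A by exact: countable_measurable.
  rewrite Lam_lebesgue; apply: (@subset_measure0 _ _ _ lebesgue_measure _ A) => //.
  + exact: measurableI.
  + exact: countable_lebesgue_measure0.
- by move=> x /= /contrapT.
Qed.

End Lam_theory.

Section L2basics.
Context {R : realType}.
Implicit Types u v w : L2 R.

Lemma measurable_L2 u : measurable_fun setT u.
Proof. by []. Qed.

Lemma L2sqE u : ((L2norm u ^+ 2)%:E = \int[Lam]_s (u s ^+ 2)%:E)%E.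
Proof.
have h : (((L2norm u) `^ 2)%R%:E = 'N[Lambda01]_2%:E[EFin \o u] `^ 2)%E.
  by rewrite -poweR_EFin /L2norm finite_norm_fine.
rewrite -powR_mulrn; last by rewrite fine_ge0 // Lnorm_ge0.
rewrite h powR_Lnorm //; apply: eq_integral => s _ /=.
by rewrite powR_mulrn // real_normK // num_real.
Qed.

Lemma L2norm_ge0 u : 0 <= L2norm u.
Proof. by rewrite fine_ge0 // Lnorm_ge0. Qed.

Lemma L2_sq_lty u : (\int[Lam]_s (u s ^+ 2)%:E < +oo)%E.
Proof. by rewrite -L2sqE ltry. Qed.

Lemma L2subE u v s : (u - v) s = u s - v s. Proof. by []. Qed.
Lemma L2addE u v s : (u + v) s = u s + v s. Proof. by []. Qed.
Lemma L2oppE u s : (- u) s = - u s. Proof. by []. Qed.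
Lemma L2scaleE (c : R) u s : (c *: u) s = c * u s. Proof. by []. Qed.

Lemma ex_L2 (f : R -> R) : measurable_fun setT f ->
  (\int[@Lam R]_s (f s ^+ 2)%:E < +oo)%E -> exists u : L2 R, u = f :> (R -> R).
Proof.
move=> mf lf.
have Pf : f \in Lfun (@Lambda01 R) 2%:E.
  apply/andP; split; rewrite inE//=.
  rewrite /finite_norm (@lty_poweRy _ _ 2) // powR_Lnorm //.
  apply: le_lt_trans lf; rewrite le_eqVlt; apply/orP; left; apply/eqP.
  apply: eq_integral => s _ /=.
  by rewrite powR_mulrn // real_normK // num_real.
by exists (Lfun_Sub (lee1n 2) Pf).
Qed.

Lemma L2normD u v : L2norm (u + v) <= L2norm u + L2norm v.
Proof. exact: ler_LnormD. Qed.

Lemma L2normN u : L2norm (- u) = L2norm u.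
Proof. exact: (@LnormrN _ _ _ Lambda01 _ (lee1n 2) u). Qed.

Lemma L2normB u v : L2norm (u - v) <= L2norm u + L2norm v.
Proof. by rewrite -[L2norm v]L2normN L2normD. Qed.

Lemma L2norm_distC u v : L2norm (u - v) = L2norm (v - u).
Proof. by rewrite -L2normN opprB. Qed.

Lemma L2normZ (c : R) u : L2norm (c *: u) = `|c| * L2norm u.
Proof.
apply: EFin_inj; rewrite EFinM /L2norm !finite_norm_fine.
by rewrite -(@LnormZ _ _ _ _ _ (lee1n 2) u c).
Qed.

Lemma L2norm0 : L2norm (0 : L2 R) = 0.
Proof. by rewrite -(scale0r (0 : L2 R)) L2normZ normr0 mul0r. Qed.

Lemma integrable_L2M u v : Lam.-integrable setT (fun s => (u s * v s)%:E).
Proof.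
have := @Lfun2_mul_Lfun1 _ _ R (@Lambda01 R) u v (LfunP u) (LfunP v).
by move/Lfun1_integrable.
Qed.

Lemma ex_L2_bounded (f : R -> R) (M : R) : measurable_fun setT f ->
  (forall s, `|f s| <= M) -> exists u : L2 R, u = f :> (R -> R).
Proof.
move=> mf fM; apply: ex_L2 => //.
apply: (@le_lt_trans _ _ (\int[@Lam R]_s (M ^+ 2)%:E)%E).
  apply: ge0_le_integral => //.
  - by move=> s _; rewrite lee_fin sqr_ge0.
  - by apply/measurable_EFinP; exact: measurable_funX.
  - move=> s _; rewrite lee_fin -[f s ^+ 2]ger0_norm ?sqr_ge0 // normrX.
    by rewrite lerXn2r ?nnegrE // (le_trans _ (fM s)).
by rewrite integral_cst //= Lam_setT mule1 ltry.
Qed.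

Lemma integrable_L2 u : Lam.-integrable setT (EFin \o u).
Proof.
have [u1 u1E] : exists u1 : L2 R, u1 = cst 1 :> (R -> R).
  by apply: (@ex_L2_bounded _ 1) => // s; rewrite normr1.
have := integrable_L2M u u1; apply: eq_integrable => // s _.
by rewrite u1E /= mulr1.
Qed.

End L2basics.

(** * Quantile functions *)

Section quantile_theory.
Context {R : realType} (mu : probability (measurableTypeR R) R).
Local Notation F := (cdfR mu).
Local Notation q := (quantile mu).

Let idTR : measurableTypeR R -> R := idfun.
#[local] HB.instance Definition _ :=
  @isMeasurableFun.Build _ _ _ _ idTR (@measurable_id _ _ setT).

Lemma cdfRE x : (F x)%:E = cdf (idTR : {RV mu >-> R}) x.
Proof. by rewrite /cdfR fineK ?fin_num_measure. Qed.

Lemma cdfR_mu x : (F x)%:E = mu `]-oo, x]%classic.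
Proof. by rewrite /cdfR fineK ?fin_num_measure. Qed.

Lemma cdfR_nd x y : x <= y -> F x <= F y.
Proof. by move=> xy; rewrite -lee_fin !cdfRE; exact: cdf_nondecreasing. Qed.

Lemma cdfR_ge0 x : 0 <= F x.
Proof. by rewrite -lee_fin cdfRE cdf_ge0. Qed.

Lemma cdfR_le1 x : F x <= 1.
Proof. by rewrite -lee_fin cdfRE cdf_le1. Qed.

Lemma cdfR_rc s x : (forall y, x < y -> s <= F y) -> s <= F x.
Proof.
move=> H.
have h : F y @[y --> x^'+] --> F x.
  apply: fine_cvg; rewrite cdfR_mu.
  exact: (@cdf_right_continuous _ _ _ _ (idTR : {RV mu >-> R}) x).
rewrite -(cvg_lim _ h) //; apply: limr_ge; first by apply/cvg_ex; exists (F x).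
by near=> y; apply: H.
Unshelve. all: by end_near. Qed.

Lemma cdfR_lim1 s : s < 1 -> exists x, s <= F x.
Proof.
move=> s1.
have h : F y @[y --> +oo] --> (1 : R).
  apply: fine_cvg.
  exact: (@cvg_cdfy1 _ _ _ _ (idTR : {RV mu >-> R})).
have : \forall y \near +oo, s < F y by apply: cvgr_gt h _ s1.
by move=> [M [_ /(_ (M+1))]]; rewrite ltrDl => /(_ ltr01) /ltW; exists (M+1).
Unshelve. all: by end_near. Qed.

Lemma cdfR_lim0 s : 0 < s -> exists x, F x < s.
Proof.
move=> s0.
have h : F y @[y --> -oo] --> (0 : R).
  apply: fine_cvg.
  exact: (@cvg_cdfNy0 _ _ _ _ (idTR : {RV mu >-> R})).
have : \forall y \near -oo, F y < s by apply: cvgr_lt h _ s0.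
by move=> [M [_ /(_ (M-1))]]; rewrite ltrBlDr ltrDl => /(_ ltr01); exists (M-1).
Unshelve. all: by end_near. Qed.

(** The set defining the quantile is nonempty since the distribution function
    tends to 1, bounded below since it tends to 0, and contains its infimum by
    right continuity; so it is the half-line starting at the quantile. *)
Lemma quantile_galois s x : 0 < s < 1 -> (q s <= x) = (s <= F x).
Proof.
move=> /andP[s0 s1]; pose A := [set x | s <= F x].
have [x1 Ax1] := cdfR_lim1 s1.
have [x0 Fx0] := cdfR_lim0 s0.
have lbA : lbound A x0.
  move=> y; rewrite /A /= leNgt; apply: contraNle => /ltW /cdfR_nd yx.
  exact: le_lt_trans yx Fx0.
have hA : has_inf A by split; [exists x1 | exists x0].
have AI : A (inf A).
  apply: cdfR_rc => y iy.
  have [z Az zy] := inf_lt hA.1 iy.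
  by apply: (le_trans Az); exact/cdfR_nd/ltW.
have [Aq lq] : (A `&` lbound A) (q s).
  rewrite /quantile /least; apply: xgetPex; exists (inf A); split => //.
  by move=> y Ay; apply: ge_inf => //; exists x0.
apply/idP/idP => [qx|sx]; first exact: le_trans Aq (cdfR_nd qx).
exact: lq.
Qed.

Lemma quantile_nd s t : 0 < s < 1 -> 0 < t < 1 -> s <= t -> q s <= q t.
Proof.
by move=> s01 t01 st; rewrite quantile_galois // (le_trans st) // -quantile_galois.
Qed.

(** If [x < q s] then [F x < s], and all levels between [F x] and [s] have
    quantiles above [x]. *)
Lemma quantile_lc s : 0 < s < 1 -> q x @[x --> s^'-] --> q s.
Proof.
move=> s01; apply/cvgrPdist_lt => e e0.
have Fs : F (q s - e) < s.
  by rewrite ltNge -quantile_galois // -ltNge ltrBlDr ltrDl.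
have F0 := cdfR_ge0 (q s - e).
near=> x.
have xs : x < s by near: x; exact: nbhs_left_lt.
have Fx : F (q s - e) < x by near: x; exact: nbhs_left_gt.
have x01 : 0 < x < 1.
  by rewrite (le_lt_trans F0 Fx) (lt_trans xs) //; case/andP: s01.
rewrite ger0_norm; last by rewrite subr_ge0 quantile_nd // ltW.
by rewrite ltrBlDl -ltrBlDr ltNge quantile_galois // -ltNge.
Unshelve. all: by end_near. Qed.

Lemma quantile_lcnd : left_continuous_nondecreasing q.
Proof.
split; last exact: quantile_lc.
by move=> s t /=; rewrite !in_itv /=; exact: quantile_nd.
Qed.

Lemma quantile_out s : s <= 0 \/ 1 < s -> q s = 0.
Proof.
move=> h; rewrite /quantile /least xgetPN // => x [/= sx lb].
case: h => [s0|s1].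
  have /lb : [set x | s <= F x] (x - 1) by rewrite /= (le_trans s0) // cdfR_ge0.
  by rewrite lerBrDr gerDl ler10.
by have := lt_le_trans s1 sx; rewrite ltNge cdfR_le1.
Qed.

(** The function is monotone on ]0, 1[ and equal to 0 outside of ]0, 1], where
    the defining sets are everything or empty. *)
Lemma quantile_measurable : measurable_fun setT q.
Proof.
rewrite (_ : setT = (`]-oo, (0:R)] `|` `](1:R), +oo[) `|` (`](0:R),
  1[ `|` [set (1:R)])); last first.
  apply/seteqP; split => // x _ /=; rewrite !in_itv /= andbT.
  have [x0|x0] := leP x 0; first by left; left.
  have [x1|x1] := ltP 1 x; first by left; right.
  right; have [->|xn1] := eqVneq x 1; first by right.
  by left; rewrite lt_neqAle xn1.
apply/measurable_funU => //; try exact: measurableU.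
split.
  apply: (eq_measurable_fun (cst (0:R))) => // s; rewrite inE /= !in_itv /= andbT.
  by move=> h; rewrite quantile_out.
apply/measurable_funU => //; split; last exact: measurable_fun_set1.
apply: (measurability (@RGenCInfty.G R)); first exact: RGenCInfty.measurableE.
move=> _ [_ [x ->] <-].
apply: is_interval_measurable => s t [s01 qs] [t01 qt] r /andP[sr rt].
move: s01 t01 qs qt; rewrite /= !in_itv /= !andbT =>
  /andP[s0' s1'] /andP[t0 t1] qs qt.
have r01 : 0 < r < 1 by rewrite (lt_le_trans s0') // (le_lt_trans rt).
by split => //; apply: (le_trans qs); apply: quantile_nd; rewrite ?s0'.
Qed.

(** By the Galois connection, both sides agree on the half-lines of points at
    most [x]. *)
Lemma Lam_quantile_le x : Lam (q @^-1` `]-oo, x]%classic) = mu `]-oo, x]%classic.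
Proof.
rewrite -cdfR_mu -Lam_itvNy ?cdfR_ge0 ?cdfR_le1 // !Lam_lebesgue;
  congr lebesgue_measure.
apply/seteqP; split => s [] /=; rewrite !in_itv /= => h s01; split => //.
  by rewrite -quantile_galois.
by rewrite quantile_galois.
Qed.

End quantile_theory.

Section law.
Context {R : realType}.

Lemma law_exists (f : R -> R) : measurable_fun setT f ->
  exists mu : probability (measurableTypeR R) R,
    forall A, mu A = Lam (f @^-1` A).
Proof.
move=> mf.
pose f' : measurableTypeR R -> measurableTypeR R := f.
pose i := @isMeasurableFun.Build _ _ _ _ f' mf.
pose F : {mfun (measurableTypeR R) >-> (measurableTypeR R)} := HB.pack f' i.
by exists (distribution (@Lam R) F).
Qed.

(** The complementary rays generate the Borel sets and are stable under
    intersection. *)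
Lemma law_unique (m1 m2 : probability (measurableTypeR R) R) :
  (forall x, m1 `]-oo, x]%classic = m2 `]-oo, x]%classic) ->
    forall A, measurable A -> m1 A = m2 A.
Proof.
move=> H A mA.
have ray (m : probability (measurableTypeR R) R) x :
  m `]x, +oo[%classic = (1 - m `]-oo, x]%classic)%E.
  rewrite -[X in m X]setCK setCitvr -(probability_setC m) //.
apply: (@measure_unique _ R (measurableTypeR R) (@RGenOInfty.G R)
  (fun n => `](- n%:R : R), +oo[%classic) _ _ _ _ m1 m2) => //.
- exact: RGenOInfty.measurableE.
- move=> _ _ [x ->] [y ->]; exists (Num.max x y).
  apply/seteqP; split => z /=; rewrite !in_itv /= !andbT gt_max => /andP //.
- by move=> n; exists (- n%:R).
- rewrite -subTset => x _; exists (Num.bound x) => //=.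
  by rewrite in_itv /= andbT ltrNl unstable.ltrNbound.
- by move=> _ [x ->]; apply: (etrans (ray m1 x)); rewrite H -(ray m2 x).
- move=> n; apply: (@le_lt_trans _ _ 1%E); last exact: ltry.
  exact: (@probability_le1 _ _ _ m1).
Qed.

Lemma Lam_quantile (mu : probability (measurableTypeR R) R) (A : set R) :
  measurable A -> Lam (quantile mu @^-1` A) = mu A.
Proof.
move=> mA.
have [m mE] := law_exists (quantile_measurable mu).
by rewrite -mE; apply: law_unique => // x; rewrite mE Lam_quantile_le.
Qed.

Lemma quantile_sq (mu : probability (measurableTypeR R) R) :
  (\int[Lam]_s (quantile mu s ^+ 2)%:E = \int[mu]_x (x ^+ 2)%:E)%E.
Proof.
pose q : measurableTypeR R -> measurableTypeR R := quantile mu.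
have mq : measurable_fun setT q by exact: quantile_measurable.
rewrite (@eq_measure_integral _ _ _ setT (pushforward Lam q) mu); last first.
  move=> A mA _; exact: (esym (Lam_quantile mu mA)).
rewrite ge0_integral_pushforward //=.
- by apply/measurable_EFinP; exact: measurable_funX.
- by move=> x _; rewrite lee_fin sqr_ge0.
Qed.

End law.

(** * Functions that are monotone off a null set *)

Section slopes.
Context {R : realType}.
Implicit Types (E : set R) (u q : R -> R) (mu : probability (measurableTypeR R) R).

(** A lower bound on the difference quotients between points of [E], cleared
    of denominators. *)
Definition slope_ge E m u := forall s t, 0 < s -> s < t -> t < 1 -> E s -> E t ->
  m * (t - s) <= u t - u s.

Definition slope_le E m u := forall s t, 0 < s -> s < t -> t < 1 -> E s -> E t ->
  u t - u s <= m * (t - s).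

Lemma slope_geP L q : slope_ge setT L q <->
  forall x, difference_quotients q x -> L <= x.
Proof.
split=> [H x [s [t [/andP[s0 s1] /andP[t0 t1] st ->]]]|H s t s0 st t1 _ _].
  have [lt_st|lt_ts|e] := ltgtP s t; last by rewrite e eqxx in st.
    have := H s t s0 lt_st t1 I I.
    rewrite -(mulrNN (q s - q t)) -invrN !opprB ler_pdivlMr ?subr_gt0 //.
  have := H t s t0 lt_ts s1 I I.
  by rewrite ler_pdivlMr ?subr_gt0.
rewrite -ler_pdivlMr ?subr_gt0 //; apply: H; exists t, s; split=> //.
- by rewrite t1 (lt_trans s0).
- by rewrite s0 (lt_trans st).
- by rewrite gt_eqF.
Qed.

Lemma slope_leP L q : slope_le setT L q <->
  forall x, difference_quotients q x -> x <= L.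
Proof.
split=> [H x [s [t [/andP[s0 s1] /andP[t0 t1] st ->]]]|H s t s0 st t1 _ _].
  have [lt_st|lt_ts|e] := ltgtP s t; last by rewrite e eqxx in st.
    have := H s t s0 lt_st t1 I I.
    rewrite -(mulrNN (q s - q t)) -invrN !opprB ler_pdivrMr ?subr_gt0 //.
  have := H t s t0 lt_ts s1 I I.
  by rewrite ler_pdivrMr ?subr_gt0.
rewrite -ler_pdivrMr ?subr_gt0 //; apply: H; exists t, s; split=> //.
- by rewrite t1 (lt_trans s0).
- by rewrite s0 (lt_trans st).
- by rewrite gt_eqF.
Qed.

Lemma ae_le_Lam (A B : set R) : measurable A -> measurable B ->
  {ae @Lam R, forall s, A s -> B s} -> (Lam A <= Lam B)%E.
Proof.
move=> mA mB [N [mN N0 sub]].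
rewrite (@le_trans _ _ (Lam (B `|` N))) //.
  apply: le_measure; rewrite ?inE//; first exact: measurableU.
  move=> s As; have [Bs|nBs] := pselect (B s); first by left.
  by right; apply: sub => /= h; apply: nBs; apply: h.
rewrite measureU0 //.
Qed.

End slopes.

Section representative.
Context {R : realType} (u : R ->
  R) (E : set R) (mu : probability (measurableTypeR R) R).
Hypothesis mu_law : forall A, mu A = Lam (u @^-1` A).
Hypothesis mu_meas : measurable_fun setT u.
Hypothesis Eae : {ae @Lam R, forall s, E s}.
Hypothesis Emono : slope_ge E 0 u.
Local Notation q := (quantile mu).

(** Up to a null set, all parameters below [s] have values at most [u s], so
    the distribution function of the law is at least [s] at [u s]. *)
Lemma repr_le s : 0 < s < 1 -> E s -> q s <= u s.
Proof.
move=> s01 Es; rewrite quantile_galois // -lee_fin cdfR_mu mu_law.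
case/andP: (s01) => s0 s1.
rewrite -(@Lam_itvNy _ s); last by rewrite !ltW.
apply: ae_le_Lam => //.
  by rewrite -[X in measurable X]setTI; exact: mu_meas.
apply: (Lam_aeS Eae) => t /andP[t0 t1] Et /=.
rewrite !in_itv /= le_eqVlt => /predU1P[->//|ts].
by rewrite -subr_ge0; apply: le_trans (Emono t0 ts s1 Et Es); rewrite mul0r.
Qed.

(** If [q s < u r], then up to a null set only parameters below [r] have
    values at most [q s], and the distribution function at [q s] would be at
    most [r < s]. *)
Lemma repr_ge r s : 0 < r -> r < s -> s < 1 -> E r -> u r <= q s.
Proof.
move=> r0 rs s1 Er; rewrite leNgt; apply/negP => qu.
have s01 : 0 < s < 1 by rewrite (lt_trans r0).
have := lexx (q s); rewrite quantile_galois // leNgt => /negP; apply.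
apply: (le_lt_trans _ rs); rewrite -lee_fin cdfR_mu mu_law -(@Lam_itvNy _ r);
  last first.
  by rewrite !ltW // (lt_trans rs).
apply: ae_le_Lam => //.
  by rewrite -[X in measurable X]setTI; exact: mu_meas.
apply: (Lam_aeS Eae) => t /andP[t0 t1] Et /=.
rewrite !in_itv /= => ut; rewrite leNgt; apply/negP => rt.
have := Emono r0 rt t1 Er Et; rewrite mul0r subr_ge0 leNgt => /negP; apply.
exact: le_lt_trans ut qu.
Qed.

(** On [E], [q s <= u s <= q t] for [s < t], so the intervals ]q s, u s[ are
    disjoint and at most countably many of them are nonempty. *)
Lemma repr_ae : u = q %[ae @Lam R].
Proof.
pose B := [set s | [/\ 0 < s < 1, E s & q s < u s]].
suff cB : countable B.
  apply: (Lam_aeS (Lam_aeI Eae (Lam_countable cB))) => s s01 [Es nB] _.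
  apply/eqP; rewrite eq_le repr_le // andbT leNgt; apply/negP => qu.
  by apply: nB.
have [f fP] : exists f : R -> rat, forall s, B s -> q s < ratr (f s) < u s.
  suff: forall s, exists r : rat, B s -> q s < ratr r < u s.
    by move=> /choice[f fP]; exists f.
  move=> s.
  have [Bs|] := pselect (B s); last by exists 0.
  case: (Bs) => _ _ /rat_in_itvoo[r]; rewrite in_itv /= => h.
  by exists r.
have injf : {in B &, injective f}.
  move=> s t /set_mem Bs /set_mem Bt ft.
  wlog st : s t Bs Bt ft / s < t => [H|].
    have [|lt_ts|//] := ltgtP s t; first exact: H.
    by apply/esym/H.
  case: (Bs) (Bt) => [/andP[s0 s1] Es _] [/andP[t0 t1] Et _].
  have /andP[_ h1] := fP _ Bs; have /andP[h2 _] := fP _ Bt.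
  have := repr_ge s0 st t1 Es.
  by rewrite leNgt (lt_trans h2) // -ft.
apply/countable_injP; exists (pickle \o f) => s t Bs Bt /= /(pcan_inj pickleK).
exact: injf.
Qed.

(** Values of [u] at points of [E] just inside of ]s, t[ lie between [q s] and
    [q t]. *)
Lemma repr_slope_ge m : 0 <= m -> slope_ge E m u -> slope_ge setT m q.
Proof.
move=> m0 Em s t s0 st t1 _ _; apply/ler_addgt0Pr => e e0.
pose d := Num.min ((t - s) / 2) (e / (2 * m + 1)).
have M0 : 0 < 2 * m + 1 by lra.
have d0 : 0 < d by rewrite lt_min !divr_gt0 ?subr_gt0 //.
have d1 : d <= (t - s) / 2 by rewrite ge_min lexx.
have d2 : d * (2 * m + 1) <= e by rewrite -ler_pdivlMr // ge_min lexx orbT.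
have [r /andP[r1 r2] Er] : exists2 r, s < r < s + d & E r.
  by apply: Lam_dense => //; [exact: ltW|rewrite ltrDl|lra].
have [r' /andP[r1' r2'] Er'] : exists2 r', t - d < r' < t & E r'.
  by apply: Lam_dense => //; [lra|rewrite ltrBlDr ltrDl|exact: ltW].
have r0 : 0 < r by lra.
have rr : r < r' by lra.
have r'1 : r' < 1 by lra.
have h1 := repr_ge (lt_trans r0 rr) r2' t1 Er'.
have r01 : 0 < r < 1 by rewrite r0 (lt_trans rr).
have h2 : q s <= q r by apply: quantile_nd => //; [lra|exact: ltW].
have h3 := repr_le r01 Er.
have h4 := Em _ _ r0 rr r'1 Er Er'.
have h5 : m * (t - s - 2 * d) <= m * (r' - r) by rewrite ler_wpM2l //; lra.
nra.
Qed.

(** Values of [u] at points of [E] just outside of [[s, t]] enclose [q s] and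
    [q t]. *)
Lemma repr_slope_le m : 0 <= m -> slope_le E m u -> slope_le setT m q.
Proof.
move=> m0 Em s t s0 st t1 _ _; apply/ler_addgt0Pr => e e0.
pose d := Num.min (Num.min s (1 - t)) (e / (2 * m + 1)).
have M0 : 0 < 2 * m + 1 by lra.
have d0 : 0 < d by rewrite !lt_min s0 subr_gt0 t1 /= divr_gt0.
have d1 : d <= s by rewrite !ge_min lexx.
have d3 : d <= 1 - t by rewrite !ge_min lexx orbT.
have d2 : d * (2 * m + 1) <= e by rewrite -ler_pdivlMr // ge_min lexx orbT.
have [r /andP[r1 r2] Er] : exists2 r, s - d < r < s & E r.
  by apply: Lam_dense => //; lra.
have [r' /andP[r1' r2'] Er'] : exists2 r', t < r' < t + d & E r'.
  by apply: Lam_dense => //; lra.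
have r0 : 0 < r by lra.
have rr : r < r' by lra.
have r'1 : r' < 1 by lra.
have h1 : u r <= q s by apply: repr_ge => //; lra.
have h2 : q t <= q r' by apply: quantile_nd => //; lra.
have h3 : q r' <= u r' by apply: repr_le => //; lra.
have h4 := Em _ _ r0 rr r'1 Er Er'.
have h5 : m * (r' - r) <= m * (t - s + 2 * d) by rewrite ler_wpM2l //; lra.
nra.
Qed.

End representative.

(** * Classes of quantile functions, best slopes and supports *)

Section classes.
Context {R : realType}.
Implicit Types (u q : R -> R) (E : set R) (mu : probability (measurableTypeR R) R).

(** Left continuity determines the value at [s] by the values just below [s],
    among which a conull set is dense. *)
Lemma lcnd_ae_le (q1 q2 : R -> R) : left_continuous_nondecreasing q1 ->
  left_continuous_nondecreasing q2 -> q1 = q2 %[ae @Lam R] ->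
  forall s, 0 < s < 1 -> q2 s <= q1 s.
Proof.
move=> [nd1 _] [_ lc2] q12 s s01; rewrite leNgt; apply/negP => q1s.
have /andP[s0 s1] := s01.
have [d d0 dP] : exists2 d, 0 < d & forall r, s - d < r < s -> q1 s < q2 r.
  have : \forall r \near s^'-, q1 s < q2 r by apply: cvgr_gt (lc2 s s01) _ q1s.
  move=> [d /= d0 dP]; exists d => // r /andP[r1 r2]; apply: dP => //=.
  by rewrite gtr0_norm ?subr_gt0 // ltrBlDr -ltrBlDl.
pose m := Num.max 0 (s - d).
have [] := @Lam_dense R (fun r => q1 r = q2 r) m s.
- by apply: (Lam_aeS q12) => r _; apply.
- by rewrite le_max lexx.
- by rewrite gt_max s0 /= ltrBlDr ltrDl.
- exact: ltW.
move=> r /andP[]; rewrite gt_max => /andP[r0 rd] rs e.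
have := dP r; rewrite rd rs => /(_ isT); rewrite -e ltNge => /negP; apply.
by apply: nd1; rewrite ?in_itv /= ?r0 ?(lt_trans rs) // ltW.
Qed.

Lemma lcnd_ae_eq (q1 q2 : R -> R) : left_continuous_nondecreasing q1 ->
  left_continuous_nondecreasing q2 -> q1 = q2 %[ae @Lam R] ->
  forall s, 0 < s < 1 -> q1 s = q2 s.
Proof.
move=> h1 h2 e s s01; apply/eqP; rewrite eq_le !lcnd_ae_le //.
by apply: (Lam_aeS e) => r _ h ?; rewrite h.
Qed.

(** The representative is chosen arbitrarily, but left continuity makes it
    unique on ]0, 1[. *)
Lemma lcrep_quantile u mu : u = quantile mu %[ae @Lam R] ->
  forall s, 0 < s < 1 -> lcrep u s = quantile mu s.
Proof.
move=> e.
have [lq uq] : left_continuous_nondecreasing (lcrep u) /\ u = lcrep u %[ae @Lam R].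
  rewrite /lcrep; apply: (@xgetPex _ u [set q | left_continuous_nondecreasing q /\
    u = q %[ae @Lambda01 R]]).
  by exists (quantile mu); split => //; exact: quantile_lcnd.
apply: lcnd_ae_eq => //; first exact: quantile_lcnd.
by apply: (Lam_aeS (Lam_aeI e uq)) => s _ [h1 h2] _; rewrite -h1 // -h2.
Qed.

Lemma eq_slope_ge m q1 q2 : (forall s, 0 < s < 1 -> q1 s = q2 s) ->
  slope_ge setT m q1 <-> slope_ge setT m q2.
Proof.
move=> e; split=> H s t s0 st t1 _ _; have := H s t s0 st t1 I I;
  by rewrite !e // ?s0 ?t1 ?(lt_trans st) ?(lt_trans s0).
Qed.

Lemma eq_slope_le m q1 q2 : (forall s, 0 < s < 1 -> q1 s = q2 s) ->
  slope_le setT m q1 <-> slope_le setT m q2.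
Proof.
move=> e; split=> H s t s0 st t1 _ _; have := H s t s0 st t1 I I;
  by rewrite !e // ?s0 ?t1 ?(lt_trans st) ?(lt_trans s0).
Qed.

Lemma slope_ge_le m m' E q : m' <= m -> slope_ge E m q -> slope_ge E m' q.
Proof.
move=> mm H s t s0 st t1 Es Et; apply: le_trans (H s t s0 st t1 Es Et).
by rewrite ler_wpM2r // subr_ge0 ltW.
Qed.

Lemma slope_le_le m m' E q : m <= m' -> slope_le E m q -> slope_le E m' q.
Proof.
move=> mm H s t s0 st t1 Es Et; apply: (le_trans (H s t s0 st t1 Es Et)).
by rewrite ler_wpM2r // subr_ge0 ltW.
Qed.

Lemma quantile_slope0 mu : slope_ge setT 0 (quantile mu).
Proof.
move=> s t s0 st t1 _ _; rewrite mul0r subr_ge0 quantile_nd ?s0 ?t1 ?ltW //.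
  by rewrite (lt_trans st).
by rewrite (lt_trans s0).
Qed.

Section Llow_Lip.
Variables (u : R -> R) (mu : probability (measurableTypeR R) R).
Hypothesis umu : u = quantile mu %[ae @Lam R].

Let slope_lcrep m : slope_ge setT m (lcrep u) <-> slope_ge setT m (quantile mu).
Proof. by apply: eq_slope_ge; exact: lcrep_quantile. Qed.

Let slope_lcrep_le m : slope_le setT m (lcrep u) <-> slope_le setT m (quantile mu).
Proof. by apply: eq_slope_le; exact: lcrep_quantile. Qed.

(** The admissible lower bounds contain 0, are bounded by any one difference
    quotient and are closed under suprema, so a greatest one exists. *)
Lemma LlowP : [/\ 0 <= Llow u, slope_ge setT (Llow u) (quantile mu) &
  forall m, 0 <= m -> slope_ge setT m (quantile mu) -> m <= Llow u].
Proof.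
pose A := [set L : R | 0 <= L /\ forall x, difference_quotients (lcrep u) x ->
  L <= x].
have AP m : A m <-> 0 <= m /\ slope_ge setT m (quantile mu).
  by split=> -[m0 h]; split => //;
    [apply/slope_lcrep/slope_geP|apply/slope_geP/slope_lcrep].
have A0 : A 0 by apply/AP; split => //; exact: quantile_slope0.
have third : 0 < (1/3 : R) /\ 1/3 < (2/3 : R) /\ 2/3 < (1 : R) by lra.
have uA : ubound A ((quantile mu (2/3) - quantile mu (1/3)) / (2/3-1/3)).
  move=> m /AP[m0 h]; have := h (1/3) (2/3) third.1 third.2.1 third.2.2 I I.
  by rewrite ler_pdivlMr // subr_gt0; case: third => _ [].
have sA : has_sup A by split;
  [exists 0|exists ((quantile mu (2/3) - quantile mu (1/3)) / (2/3-1/3))].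
have As : A (sup A).
  apply/AP; split; first by apply: ub_le_sup; [case: sA|].
  move=> s t s0 st t1 _ _; rewrite -ler_pdivlMr ?subr_gt0 //.
  apply: ge_sup; first by case: sA.
  by move=> m /AP[m0 h]; rewrite ler_pdivlMr ?subr_gt0 //; exact: h.
have [/AP[g0 gs] ub] : (A `&` ubound A) (Llow u).
  rewrite /Llow /greatest; apply: xgetPex; exists (sup A); split => //.
  by move=> m Am; apply: ub_le_sup => //; case: sA.
by split => // m m0 hm; apply: ub; apply/AP.
Qed.

(** The supremum of 0 and of the difference quotients is the least admissible
    upper bound; here it is finite. *)
Lemma LipP (M : R) : 0 <= M -> slope_le setT M (quantile mu) ->
  [/\ (0 <= Lip u <= M%:E)%E & slope_le setT (fine (Lip u)) (quantile mu)].
Proof.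
move=> M0 HM.
pose A := [set L : \bar R | (0 <= L)%E /\
  forall x, difference_quotients (lcrep u) x -> (x%:E <= L)%E].
have AP m : A m%:E <-> 0 <= m /\ slope_le setT m (quantile mu).
  rewrite /A /= lee_fin; split=> -[m0 h]; split => //.
    by apply/slope_lcrep_le/slope_leP => x /h; rewrite lee_fin.
  by move=> x dx; rewrite lee_fin; move: x dx; apply/slope_leP/slope_lcrep_le.
have AM : A M%:E by apply/AP.
pose m := ereal_sup (0%E |` (EFin @` difference_quotients (lcrep u))).
have Am : A m.
  split; first by apply: ereal_sup_ubound; left.
  by move=> x dx; apply: ereal_sup_ubound; right; exists x.
have [[l0 lq] lb] : (A `&` lbound A) (Lip u).
  rewrite /Lip /least; apply: xgetPex; exists m; split => //.
  move=> l [l0 lx]; apply: ge_ereal_sup => y [->//|[x dx <-]]; exact: lx.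
have lM := lb _ AM.
split; first by rewrite l0.
have fL : Lip u \is a fin_num by rewrite ge0_fin_numE // (le_lt_trans lM) ?ltry.
suff /AP[] : A (fine (Lip u))%:E by [].
by rewrite fineK.
Qed.

End Llow_Lip.

(** Each point outside of the support lies in a null interval with rational
    ends, and there are countably many of these. *)
Lemma supp_null mu : mu.-negligible (~` supp mu).
Proof.
pose I2 (n : nat) : set R := if (unpickle n : option (rat * rat)) is Some p then
  (if mu `](ratr p.1 : R), (ratr p.2 : R)[%classic == 0%E then
   `](ratr p.1 : R), (ratr p.2 : R)[%classic else set0) else set0.
have nI n : mu.-negligible (I2 n).
  rewrite /I2; case: unpickle => [p|]; last exact: negligible_set0.
  by case: eqP => [h|_]; [apply/negligibleP|exact: negligible_set0].
have := @negligible_bigcup _ _ _ mu I2 nI; apply: negligibleS.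
move=> x /= /existsNP[U /not_implyP[oU /not_implyP[Ux /negP]]].
rewrite -leNgt measure_le0 => /eqP U0.
have [e /= e0 eU] : exists2 e, 0 < e & forall y, `|x - y| < e -> U y.
  by have [e e0 eU] := open_nbhs_nbhs (conj oU Ux); exists e.
have /rat_in_itvoo[p] : x - e < x by rewrite ltrBlDr ltrDl.
rewrite in_itv /= => /andP[p1 p2].
have /rat_in_itvoo[p'] : x < x + e by rewrite ltrDl.
rewrite in_itv /= => /andP[p1' p2'].
exists (pickle (p, p')); first exact: I.
rewrite /I2 pickleK; case: eqP => [_|]; first by rewrite /= in_itv /= p2 p1'.
case; apply: (subset_measure0 _ _ _ U0) => //; first exact: open_measurable.
move=> y; rewrite /= in_itv /= => /andP[y1 y2]; apply: eU.
rewrite ltr_distl; lra.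
Qed.

(** There is no mass outside of [[a, b]], so the distribution function
    vanishes to the left of [a] and equals 1 from [b] on. *)
Lemma supp_quantile mu a b : supp mu `<=` `[a, b] ->
  forall s, 0 < s < 1 -> a <= quantile mu s <= b.
Proof.
move=> sub s s01; have /andP[s0 s1] := s01.
have N0 : mu (~` `[a, b]%classic) = 0%E.
  apply/negligibleP; first exact: measurableC.
  by apply: negligibleS (supp_null mu); apply: subsetC.
apply/andP; split.
  rewrite leNgt; apply/negP => qa.
  have := lexx (quantile mu s); rewrite quantile_galois // leNgt => /negP; apply.
  apply: le_lt_trans s0; rewrite -lee_fin cdfR_mu.
  apply: (@le_trans _ _ (mu (~` `[a, b]%classic))); last by rewrite N0.
  apply: le_measure; rewrite ?inE //; first exact: measurableC.
  move=> x; rewrite /= !in_itv /= => xq; apply/negP; rewrite negb_and -!ltNge.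
  by rewrite (le_lt_trans xq).
rewrite quantile_galois // (le_trans (ltW s1)) // -lee_fin cdfR_mu.
rewrite -(@probability_setT _ _ _ mu) -(setUv `]-oo, b]%classic).
rewrite measureU0 //; first exact: measurableC.
apply: (subset_measure0 _ _ _ N0); [exact: measurableC|exact: measurableC|].
apply: subsetC => x; rewrite /= !in_itv /= => /andP[]//.
Qed.

Lemma law_supp u mu a b : (forall A, mu A = Lam (u @^-1` A)) ->
  measurable_fun setT u ->
  {ae @Lam R, forall s, a <= u s <= b} -> supp mu `<=` `[a, b].
Proof.
move=> muE mu_ Hab x sx; apply: contrapT => nx.
have oC : open (~` `[a, b]%classic) by apply: closed_openC; exact: itv_closed.
have := sx _ oC nx; rewrite muE ltNge => /negP; apply.
rewrite measure_le0; apply/eqP/negligibleP.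
  rewrite -[X in measurable X]setTI; apply: mu_ => //; exact: measurableC.
apply: negligibleS Hab => s /= h; apply/negP; move: h; rewrite in_itv /=.
by move=> h; apply/negP.
Qed.

Lemma law_P2 (u : L2 R) mu : (forall A, mu A = Lam (u @^-1` A)) -> P2 mu.
Proof.
move=> muE.
pose f : measurableTypeR R -> measurableTypeR R := u.
have mf : measurable_fun setT f by exact: measurable_L2.
rewrite /P2 (@eq_measure_integral _ _ _ setT (pushforward Lam f) mu); last first.
  by move=> A mA _; exact: muE.
rewrite ge0_integral_pushforward //=.
- exact: L2_sq_lty.
- by apply/measurable_EFinP; exact: measurable_funX.
- by move=> x _; rewrite lee_fin sqr_ge0.
Qed.

(** The measure is the law of [u]. Through this lemma, inequalities proved
    almost everywhere along the flow or the resolvent become membership in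
    classes of quantile functions. *)
Lemma monotone_class (u : L2 R) E : {ae @Lam R, forall s, E s} -> slope_ge E 0 u ->
  exists mu, [/\ P2 mu, u = quantile mu %[ae @Lam R],
    (forall m, 0 <= m -> slope_ge E m u -> slope_ge setT m (quantile mu)),
    (forall m, 0 <= m -> slope_le E m u -> slope_le setT m (quantile mu)) &
    forall a b, {ae @Lam R, forall s, a <= u s <= b} -> supp mu `<=` `[a, b]].
Proof.
move=> Eae Em; have mu_ := measurable_L2 u.
have [mu muE] := law_exists mu_.
exists mu; split.
- exact: law_P2 muE.
- exact: (repr_ae muE mu_ Eae Em).
- exact: (repr_slope_ge muE mu_ Eae Em).
- exact: (repr_slope_le muE mu_ Eae Em).
- by move=> a b; exact: law_supp.
Qed.

Lemma DminusE L u : Dminus L u <-> exists mu,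
  [/\ P2 mu, u = quantile mu %[ae @Lam R] & slope_ge setT L (quantile mu)].
Proof.
by split=> -[mu [h1 h2 h3]]; exists mu; split => //; apply/slope_geP.
Qed.

Lemma DplusE L u : Dplus L u <-> exists mu,
  [/\ P2 mu, u = quantile mu %[ae @Lam R] & slope_le setT L (quantile mu)].
Proof.
by split=> -[mu [h1 h2 h3]]; exists mu; split => //; apply/slope_leP.
Qed.

Lemma quantile_ae_unique mu1 mu2 u : u = quantile mu1 %[ae @Lam R] ->
  u = quantile mu2 %[ae @Lam R] -> forall s, 0 < s < 1 ->
    quantile mu1 s = quantile mu2 s.
Proof.
move=> h1 h2; apply: lcnd_ae_eq; try exact: quantile_lcnd.
by apply: (Lam_aeS (Lam_aeI h1 h2)) => s _ [e1 e2] _; rewrite -e1 // e2.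
Qed.

End classes.

(** * Absolutely continuous functions with nonpositive right derivative *)

Section absolute_continuity_of_integral.
Context {R : realType} (k : measurableTypeR R -> R) (D : set (measurableTypeR R)).
Implicit Types A B : set (measurableTypeR R).
Hypothesis mk : measurable_fun setT k.
Hypothesis k0 : forall x, 0 <= k x.
Hypothesis mD : measurable D.
Local Notation lam := (@lebesgue_measure R).
Hypothesis kD : (\int[lam]_(x in D) (k x)%:E < +oo)%E.

Definition integral_on (A : set (measurableTypeR R)) : R :=
  fine (\int[lam]_(x in A `&` D) (k x)%:E)%E.

Let mkE A : measurable_fun A (EFin \o k).
Proof. by apply/measurable_EFinP; apply: measurable_funTS. Qed.

Let integral_onE A : measurable A ->
  ((integral_on A)%:E = \int[lam]_(x in A `&` D) (k x)%:E)%E.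
Proof.
move=> mA; rewrite /integral_on fineK // ge0_fin_numE; last first.
  by apply: integral_ge0 => x _; rewrite lee_fin.
apply: le_lt_trans kD; apply: ge0_subset_integral => //.
- exact: measurableI.
- by move=> x _; rewrite lee_fin.
Qed.

Lemma integral_on_ge0 A : 0 <= integral_on A.
Proof. by rewrite fine_ge0 // integral_ge0 // => x _; rewrite lee_fin. Qed.

Lemma integral_on_mono A B : measurable A -> measurable B -> A `<=` B ->
  integral_on A <= integral_on B.
Proof.
move=> mA mB AB; rewrite -lee_fin !integral_onE //; apply: ge0_subset_integral => //.
- exact: measurableI.
- exact: measurableI.
- by move=> x _; rewrite lee_fin.
- by move=> x [/AB ? ?].
Qed.

Lemma integral_onU A B : measurable A -> measurable B -> A `&` B = set0 ->
  integral_on (A `|` B) = integral_on A + integral_on B.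
Proof.
move=> mA mB AB; apply: EFin_inj; rewrite EFinD !integral_onE //;
  last exact: measurableU.
rewrite setIUl ge0_integral_setU //.
- exact: measurableI.
- exact: measurableI.
- by move=> x _; rewrite lee_fin.
- rewrite disj_set2E; apply/eqP.
  by rewrite setIACA AB set0I.
Qed.

(** The part of [k] above a large height [n] has small integral, and the part
    below contributes at most [n] times the measure of the set. *)
Lemma integral_on_ac e : 0 < e -> exists2 d : R, 0 < d &
  forall A, measurable A -> (lam A < d%:E)%E -> integral_on A < e.
Proof.
move=> e0.
pose fr (n : nat) (x : measurableTypeR R) : R := Num.max 0 (k x - n%:R).
have mfr n : measurable_fun setT (fr n).
  by apply: measurable_maxr => //; exact: measurable_funB.
pose f_ n x := (fr n x)%:E.
have mf n : measurable_fun D (f_ n) by apply/measurable_EFinP/measurable_funTS.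
have fcvg x : D x -> f_ ^~ x @ \oo --> (0%E : \bar R).
  move=> _; apply: cvg_near_cst; near=> n; rewrite /f_ /fr max_l // subr_le0.
  by near: n; exact: nbhs_infty_ger.
have ik : lam.-integrable D (EFin \o k).
  apply/integrableP; split; first exact: mkE.
  by under eq_integral do rewrite /= ger0_norm //.
have fle n x : D x -> (`|f_ n x| <= (EFin \o k) x)%E.
  move=> _; rewrite /= lee_fin ger0_norm ?le_max ?lexx // ge_max k0 /=.
  by rewrite gerBl ler0n.
have := @dominated_cvg _ _ _ lam D mD f_ (cst 0%E) (EFin \o k) mf fcvg (fun x _ =>
  erefl) ik fle.
rewrite integral0 => /fine_cvgP[fin /cvgrPdist_lt /(_ (e / 2))].
rewrite divr_gt0 // => /(_ isT) near_e.
have [n [finn nP]] : exists n, (\int[lam]_(x in D) f_ n x)%E \is a fin_num /\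
    `|0 - (fine \o (fun n => \int[lam]_(x in D) f_ n x)%E) n| < e / 2.
  have := filterI fin near_e.
  by move=> [N _ /(_ N (leqnn N))]; exists N.
exists (e / (2 * (n%:R + 1))); first by rewrite divr_gt0 // mulr_gt0 // ltr_wpDl.
move=> A mA lA.
rewrite -lte_fin integral_onE //.
have finA : lam A \is a fin_num by rewrite ge0_fin_numE // (lt_trans lA) // ltry.
apply: (@le_lt_trans _ _ (\int[lam]_(x in A `&` D) (f_ n x + n%:R%:E))%E).
  apply: ge0_le_integral => //; try exact: measurableI; try exact: mkE.
  - by move=> x _; rewrite lee_fin.
  - by apply/measurable_EFinP/measurable_funTS; apply: measurable_funD.
  - by move=> x _; rewrite -EFinD lee_fin -lerBlDr le_max lexx orbT.
have -> : (\int[lam]_(x in A `&` D) (f_ n x + n%:R%:E) =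
  \int[lam]_(x in A `&` D) f_ n x + \int[lam]_(x in A `&` D) n%:R%:E)%E.
  apply: ge0_integralD => //; try exact: measurableI.
  - by move=> x _; rewrite lee_fin le_max lexx.
  - by apply/measurable_EFinP/measurable_funTS.
rewrite integral_cst; last exact: measurableI.
have h1 : (\int[lam]_(x in A `&` D) f_ n x <= \int[lam]_(x in D) f_ n x)%E.
  apply: ge0_subset_integral => //; first exact: measurableI.
  by move=> x _; rewrite lee_fin le_max lexx.
have h2 : (lam (A `&` D) <= lam A)%E.
  by apply: le_measure; rewrite ?inE //; exact: measurableI.
have h3 : (\int[lam]_(x in D) f_ n x < (e / 2)%:E)%E.
  rewrite -(fineK finn) lte_fin; move: nP; rewrite sub0r normrN /= ger0_norm //.
  by rewrite fine_ge0 // integral_ge0 // => x _; rewrite lee_fin le_max lexx.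
rewrite [e in ltRHS]splitr EFinD; apply: lte_leD => //.
- rewrite fin_numM // ge0_fin_numE //; apply: le_lt_trans h2 _.
  by rewrite (lt_trans lA) // ltry.
- exact: le_lt_trans h1 h3.
apply: (@le_trans _ _ (n%:R%:E * lam A)%E); first by apply: lee_pmul.
rewrite -(fineK finA) -EFinM lee_fin.
move: lA; rewrite -(fineK finA) lte_fin => lA.
apply: (@le_trans _ _ (n%:R * (e / (2 * (n%:R + 1))))).
  by rewrite ler_wpM2l // ltW.
have n1 : (n%:R + 1 : R) != 0 by rewrite gt_eqF // ltr_wpDl.
rewrite [leRHS](_ : e / 2 = (n%:R + 1) * (e / (2 * (n%:R + 1)))); last by field.
apply: ler_wpM2r; last by rewrite lerDl.
by rewrite divr_ge0 ?(ltW e0) // mulr_ge0 // addr_ge0.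
Unshelve. all: by end_near. Qed.

(** The exceptional null set is covered by an open set [U] of small [k]-mass.
    Consider the times up to which [phi] has grown by at most [e (t - s)] plus
    the [k]-mass of [U] between [s] and [t]. By absolute continuity they
    contain their supremum; they extend beyond it, inside [U] because
    increments are dominated by the [k]-mass, and elsewhere because of the
    right derivative. *)
Lemma ac_nonincreasing (phi : R -> R) (s T : R) : s <= T ->
  (forall x y, s <= x -> x <= y -> y <= T ->
    phi y - phi x <= integral_on `]x, y]%classic) ->
  {ae lam, forall x, s < x < T -> forall e, 0 < e -> exists2 d, 0 < d &
     forall y, x < y < x + d -> phi y <= phi x + e * (y - x)} ->
  phi T <= phi s.
Proof.
move=> sT Hac [M [mM M0 MP]].
suff H e : 0 < e -> phi T <= phi s + e * (T - s + 1).
  apply/ler_addgt0Pr => e e0.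
  have p : 0 < T - s + 1 by lra.
  have := H (e / (T - s + 1)); rewrite divr_gt0 // divfK ?gt_eqF //; exact.
move=> e0.
have [d d0 dP] := integral_on_ac e0.
pose M' := M `|` [set s].
have mM' : measurable M' by exact: measurableU.
have M'0 : lam M' = 0%E.
  rewrite measureU0 ?M0 //; exact: lebesgue_measure_set1.
have [U [oU MU Ud]] : exists U : set (measurableTypeR R), [/\ open (U :
  set R), M' `<=` U & (lam (U `\` M') < d%:E)%E].
  apply: lebesgue_regularity_outer => //.
  by apply: (@le_lt_trans _ _ 0%E); [rewrite le_eqVlt; apply/orP; left; apply/eqP;
    exact: M'0|exact: ltry].
have mU : measurable U by exact: open_measurable.
have KU : integral_on U < e.
  apply: dP => //; apply: le_lt_trans Ud.
  rewrite -[in leLHS](setDUK MU) setUC measureU0 //; exact: measurableD.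
pose UI (t : R) : set (measurableTypeR R) := U `&` `]s, t]%classic.
have mUI t : measurable (UI t) by exact: measurableI.
have UI_mono t t' : t <= t' -> integral_on (UI t) <= integral_on (UI t').
  move=> tt; apply: integral_on_mono => // x [Ux];
    rewrite /= !in_itv /= => /andP[sx xt].
  by split => //; rewrite /= in_itv /= sx (le_trans xt).
pose A := [set t | s <= t <= T /\ phi t <= phi s + e * (t - s) + integral_on (UI t)].
have As : A s by split; rewrite ?lexx ?sT // subrr mulr0 addr0 lerDl integral_on_ge0.
have hA : has_sup A by split; [exists s | exists T => t [/andP[]]].
have ubA := sup_upper_bound hA.
pose c := sup A.
have sc : s <= c by apply: ubA.
have cT : c <= T by apply: ge_sup; [exists s|move=> t [/andP[]]].
have Ac : A c.
  split; first by rewrite sc.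
  apply/ler_addgt0Pr => eps eps0.
  have [d' d'0 d'P] := integral_on_ac eps0.
  have [t At tc] := sup_adherent d'0 hA.
  have tc' : t <= c by exact: ubA.
  case: At => /andP[st tT] At.
  have h1 := Hac _ _ st tc' cT.
  have h2 : integral_on `]t, c]%classic < eps.
    apply: d'P => //; rewrite lebesgue_measure_itv /= lte_fin.
    case: ifP => _; last by change (0%:E < d'%:E)%E; rewrite lte_fin.
    by rewrite -EFinB lte_fin; rewrite -/c in tc; lra.
  have h3 := UI_mono _ _ tc'.
  have h4 : e * (t - s) <= e * (c - s) by rewrite ler_wpM2l ?(ltW e0) // lerD2r.
  lra.
have cTe : c = T.
  apply/eqP; rewrite eq_le cT leNgt; apply/negP => ltcT.
  case: Ac => _ Ac.
  have [Mc|nMc] := pselect (M' c).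
    have [r /= r0 rU] : exists2 r, 0 < r & forall y, `|c - y| < r -> U y.
      by have [r r0 rU] := open_nbhs_nbhs (conj oU (MU _ Mc)); exists r.
    pose y := Num.min (c + r / 2) T.
    have cy : c < y by rewrite lt_min ltcT andbT ltrDl divr_gt0.
    have yT : y <= T by rewrite ge_min lexx orbT.
    have yr : y <= c + r / 2 by rewrite ge_min lexx.
    suff /ubA : A y by rewrite leNgt cy.
    split; first by rewrite yT (le_trans sc) // ltW.
    have UIy : UI y = UI c `|` `]c, y]%classic.
      apply/seteqP; split => x; rewrite /UI /=.
        move=> [Ux]; rewrite !in_itv /= => /andP[sx xy].
        have [xc|xc] := leP x c; [left|right => //].
        by split; rewrite // ?sx.
      rewrite !in_itv /= => -[[Ux /andP[sx xc]]|/andP[cx xy]].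
        by split => //; rewrite sx (le_trans xc) // ltW.
      split; last by rewrite xy (le_lt_trans sc).
      by apply: rU; rewrite ltr0_norm ?subr_lt0 // opprB; lra.
    rewrite UIy integral_onU //; last first.
      apply/seteqP; split => // x [[_]];
        rewrite /= !in_itv /= => /andP[_ xc] /andP[cx _].
      by move: (lt_le_trans cx xc); rewrite ltxx.
    have h1 := Hac _ _ sc (ltW cy) yT.
    have h4 : e * (c - s) <= e * (y - s) by rewrite ler_wpM2l ?(ltW e0) // lerD2r ltW.
    lra.
  have [nMc1 nMc2] : ~ M c /\ c <> s.
    by split => h; apply: nMc; [left|right].
  have sc' : s < c by rewrite lt_neqAle sc andbT; apply/eqP => h; exact: nMc2.
  have good := contrapT (contra_not (@MP c) nMc1).
  have [|r r0 rP] := good _ e e0; first by rewrite sc'.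
  pose y := Num.min (c + r / 2) T.
  have cy : c < y by rewrite lt_min ltcT andbT ltrDl divr_gt0.
  have yT : y <= T by rewrite ge_min lexx orbT.
  have yr : y <= c + r / 2 by rewrite ge_min lexx.
  suff /ubA : A y by rewrite leNgt cy.
  split; first by rewrite yT (le_trans sc) // ltW.
  have h1 : phi y <= phi c + e * (y - c) by apply: rP; rewrite cy /=; lra.
  have h2 := UI_mono _ _ (ltW cy).
  have h3 : e * (y - s) = e * (c - s) + e * (y - c) by rewrite -mulrDr;
    congr (_ * _); lra.
  lra.
case: Ac => _; rewrite cTe => h.
have h1 : integral_on (UI T) <= integral_on U by apply: integral_on_mono => // x [].
by rewrite mulrDr mulr1; lra.
Qed.

End absolute_continuity_of_integral.

(** * Increments of primitives of Bochner integrable functions *)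

Section lower_integral.
Context d (T : measurableType d) (R : realType) (mu : {measure set T -> \bar R}).
Import HBNNSimple.

(** The integral of a nonnegative function is a supremum over the simple
    functions below it. *)
Lemma ge0_le_integral_nomeas (D : set T) (f g : T -> \bar R) :
  (forall x, D x -> (0 <= f x)%E) -> (forall x, D x -> (f x <= g x)%E) ->
  (\int[mu]_(x in D) f x <= \int[mu]_(x in D) g x)%E.
Proof.
move=> f0 fg; have g0 x : D x -> (0 <= g x)%E by move=> Dx;
  exact: le_trans (f0 _ Dx) (fg _ Dx).
rewrite !ge0_integralE //; apply: ereal_sup_le => _ [h hf <-].
exists h => // x.
apply: (le_trans (hf x)); rewrite /patch; case: ifPn => // /set_mem; exact: fg.
Qed.

(** The exceptional null set is removed from the domain of the smaller,
    measurable function; the two integrals are then compared pointwise. *)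
Lemma ae_le_integral_nomeas (D : set T) (f g : T -> \bar R) : measurable D ->
  measurable_fun D f -> (forall x, D x -> (0 <= f x)%E) ->
  (forall x, D x -> (0 <= g x)%E) ->
  {ae mu, forall x, D x -> (f x <= g x)%E} ->
  (\int[mu]_(x in D) f x <= \int[mu]_(x in D) g x)%E.
Proof.
move=> mD mf f0 g0 [N [mN N0 NP]].
rewrite (ge0_negligible_integral mN) //.
rewrite integral_mkcond [leRHS]integral_mkcond; apply: ge0_le_integral_nomeas.
  by move=> x _; rewrite patchE; case: ifPn => // /set_mem [Dx _]; exact: f0.
move=> x _; rewrite !patchE; case: ifPn => [/set_mem [Dx nN]|_].
  rewrite mem_set //; apply: contrapT => h; apply: nN; apply: NP => /=.
  by move=> /(_ Dx).
by case: ifPn => // /set_mem; exact: g0.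
Qed.
End lower_integral.

Section simple_functions.
Context {R : realType}.
Local Notation lam := (@lebesgue_measure R).
Local Notation RR := (measurableTypeR R).
Implicit Types f : RR -> L2 R.

(** A pair of simple functions has finitely many values, each taken on a
    measurable set. *)
Lemma simple_comp_measurable (f1 f2 : RR -> L2 R) (F : L2 R -> L2 R -> R) :
  simple_function f1 -> simple_function f2 ->
  measurable_fun setT (fun t => F (f1 t) (f2 t)).
Proof.
move=> [fin1 m1] [fin2 m2] _ B mB; rewrite setTI.
rewrite (_ : _ @^-1` B = \bigcup_(p in [set p | range f1 p.1 /\ range f2 p.2 /\ B
  (F p.1 p.2)])
  (f1 @^-1` [set p.1] `&` f2 @^-1` [set p.2])).
  apply: fin_bigcup_measurable => [|p _]; last exact: measurableI.
  apply: (@sub_finite_set _ _ (range f1 `*` range f2)); first by move=> p [? []].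
  exact: finite_setX.
apply/seteqP; split => t /=.
  by move=> Bt; exists (f1 t, f2 t) => //=; split; [exists t|split => //; exists t].
by move=> [p [_ [_ Bp]] [-> ->]].
Qed.

Lemma cst_simple (x : L2 R) : simple_function (cst x).
Proof.
split; first by apply: (@sub_finite_set _ _ [set x]) => // y [t _ <-].
move=> y; have [xy|nxy] := pselect (x = y).
  rewrite (_ : _ @^-1` _ = setT); first exact: measurableT.
  by apply/seteqP; split.
rewrite (_ : _ @^-1` _ = set0); first exact: measurable0.
by apply/seteqP; split => t.
Qed.

Lemma simple_integral_le f (D : set RR) : measurable D -> (lam D < +oo)%E ->
  simple_function f ->
  ((L2norm (simple_integral D f))%:E <= \int[lam]_(t in D) (L2norm (f t))%:E)%E.
Proof.
move=> mD lD [fin mf]; rewrite /simple_integral fsbig_finite //.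
pose S := fset_set (range f); pose s : seq (L2 R) := finmap.enum_fset S.
rewrite -/S -/s.
pose P x := D `&` f @^-1` [set x].
have mP x : measurable (P x) by exact: measurableI.
have DE : D = \big[setU/set0]_(x <- s) P x.
  rewrite /s -bigcup_fset; apply/seteqP; split => t; last by move=> [x _ []].
  by move=> Dt; exists (f t) => //=; rewrite /S in_fset_set // inE; exists t.
have finP x : lam (P x) \is a fin_num.
  rewrite ge0_fin_numE //; apply: le_lt_trans lD; apply: le_measure; rewrite ?inE //.
  by move=> t [].
have -> : (\int[lam]_(t in D) (L2norm (f t))%:E =
    \sum_(x <- s) (fine (lam (P x)) * L2norm x)%:E)%E.
  rewrite {1}DE ge0_integral_bigsetU //.
  - apply: eq_bigr => x _.
    rewrite (@eq_integral _ _ _ _ _ (cst (L2norm x)%:E)); last first.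
      by move=> t /set_mem [_ /= ->].
    by rewrite integral_cst // EFinM (fineK (finP x)) muleC.
  - exact: finmap.fset_uniq.
  - move=> x y _ _ [t [[_ /= <-] [_ /= <-]]] //.
  - apply/measurable_EFinP/measurable_funTS.
    exact: (@simple_comp_measurable f f (fun x _ => L2norm x)).
  - by move=> t _; rewrite lee_fin L2norm_ge0.
rewrite sumEFin lee_fin.
elim/big_ind2: _ => [|x a y b xa yb|x _].
- by rewrite L2norm0.
- by apply: (le_trans (L2normD _ _)); exact: lerD.
- by rewrite L2normZ ger0_norm // fine_ge0.
Qed.

(** The norm is a.e. the limit of the norms of differences of simple
    functions, whose upper limit is a Borel function. *)
Lemma ae_norm_measurable (h : RR -> L2 R) (D : set RR) f : strongly_measurable D h ->
  simple_function f ->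
  exists d : RR -> R, [/\ measurable_fun setT d, forall t, 0 <= d t &
    {ae lam, forall t, D t -> d t = L2norm (f t - h t)}].
Proof.
move=> [F sF cF] sf.
pose D_ n t := (L2norm (f t - F n t))%:E.
have mD_ n : measurable_fun setT (D_ n).
  apply/measurable_EFinP.
  exact: (@simple_comp_measurable f (F n) (fun x y => L2norm (x - y))).
pose l t := limn_esup (fun n => D_ n t).
have ml : measurable_fun setT l by exact: measurable_fun_limn_esup.
exists (fun t => fine (Order.max 0%E (l t))); split.
- by apply: measurableT_comp => //; exact: measurable_maxe.
- by move=> t; rewrite fine_ge0 // le_max lexx.
case: cF => N [mN N0 NP]; exists N; split => // t /= nt; apply: NP => /= H;
  apply: nt => Dt.
have c0 := H Dt.
have cn : L2norm (f t - F n t) @[n --> \oo] --> L2norm (f t - h t).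
  apply/cvgrPdist_le => e e0.
  move/cvgrPdist_le : c0 => /(_ e e0); apply: filterS => n.
  rewrite sub0r normrN ger0_norm ?L2norm_ge0 // => le_e.
  rewrite ler_distl; apply/andP; split.
    rewrite lerBlDr (le_trans _ (lerD (lexx _) le_e)) //.
    rewrite (L2norm_distC (F n t)).
    by apply: (le_trans _ (L2normD _ _)); rewrite addrA subrK.
  apply: le_trans (lerD (lexx _) le_e).
  by apply: (le_trans _ (L2normD _ _)); rewrite addrA subrK.
have clim : D_ ^~ t @ \oo --> (L2norm (f t - h t))%:E.
  by apply/fine_cvgP; split; [exact: nearW|exact: cn].
have -> : l t = (L2norm (f t - h t))%:E.
  rewrite /l is_cvg_limn_esupE; first exact: cvg_lim clim.
  by apply/cvg_ex; exists (L2norm (f t - h t))%:E.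
by rewrite max_r // lee_fin L2norm_ge0.
Qed.

(** The increment [g t - g s] is the limit of integrals of simple functions [f
    n] with [f n - h] tending to 0 in mean, and the norm of the integral of [f
    n] is at most the integral of [k] plus that of the norm of [f n - h]. *)
Lemma W11_bound (T : R) (g : R -> L2 R) : W11 T g ->
  exists k : RR -> R, [/\ measurable_fun setT k, forall t, 0 <= k t,
    (\int[lam]_(t in `]0%R, T]%classic) (k t)%:E < +oo)%E &
    forall s t, 0 < s -> s <= t -> t <= T ->
      L2norm (g t - g s) <= integral_on k `]0, T]%classic `]s, t]%classic].
Proof.
move=> [_ [h [smh ih] hP]].
have [k [mk k0 kh]] := ae_norm_measurable smh (cst_simple 0).
have ih0 : (\int[lam]_(t in `]0%R, T]%classic) (k t)%:E < +oo)%E.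
  apply: le_lt_trans ih; apply: ae_le_integral_nomeas => //.
  - by apply/measurable_EFinP/measurable_funTS.
  - by move=> t _; rewrite lee_fin.
  - by move=> t _; rewrite lee_fin L2norm_ge0.
  - case: kh => N [mN N0 NP]; exists N; split => // t /= nt; apply: NP => /= H.
    by apply: nt => Dt; rewrite lee_fin (H Dt) sub0r L2normN.
exists k; split => //.
move=> s t s0 st tT; have [f [sf cf cs]] := hP s t s0 st tT.
set D := `]s, t]%classic; set D0 := `]0, T]%classic.
have DD0 : D `<=` D0.
  by move=> x; rewrite /D /D0 /= !in_itv /= => /andP[a b];
    rewrite (lt_trans s0 a) (le_trans b).
have mD : measurable (D : set RR) by exact: measurable_itv.
have lD : (lam D < +oo)%E by rewrite /D lebesgue_measure_itv /=; case: ifP => _;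
  rewrite ?ltry // -EFinB ltry.
have smD : strongly_measurable D h.
  case: smh => F sF cF; exists F => //.
  by case: cF => N [mN N0 NP]; exists N; split => // x /= nx; apply: NP => /= H;
    apply: nx => /DD0.
have KE : (integral_on k D0 D)%:E = (\int[lam]_(x in D) (k x)%:E)%E.
  rewrite /integral_on setIidl // fineK // ge0_fin_numE; last first.
    by apply: integral_ge0 => x _; rewrite lee_fin.
  apply: le_lt_trans ih0; apply: ge0_subset_integral => //.
  - by apply/measurable_EFinP/measurable_funTS.
  - by move=> x _; rewrite lee_fin.
rewrite -lee_fin KE.
apply/lee_addgt0Pr => e e0.
have e2 : 0 < e / 2 by rewrite divr_gt0.
have [n [cfn csn]] : exists n,
    (\int[lam]_(x in D) (L2norm (f n x - h x))%:E < (e / 2)%:E)%E /\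
    L2norm (simple_integral D (f n) - (g t - g s)) < e / 2.
  have A1 : \forall n \near \oo,
    (\int[lam]_(x in D) (L2norm (f n x - h x))%:E < (e / 2)%:E)%E.
    have /fine_cvgP[fin cf'] := cf.
    have near2 : \forall n \near \oo,
        fine (\int[lam]_(x in D) (L2norm (f n x - h x))%:E)%E < e / 2.
      exact: (cvgr_lt _ cf' _ e2).
    near=> n; rewrite -[X in (X < _)%E]fineK; last by near: n.
    by rewrite lte_fin; near: n.
  have A2 : \forall n \near \oo,
    L2norm (simple_integral D (f n) - (g t - g s)) < e / 2.
    exact: (cvgr_lt _ cs _ e2).
  by have [N _ /(_ N (leqnn N)) ?] := filterI A1 A2; exists N.
have [dn [mdn dn0 dnh]] := ae_norm_measurable smD (sf n).
have h1 : (\int[lam]_(x in D) (dn x)%:E < (e / 2)%:E)%E.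
  apply: le_lt_trans cfn; apply: ae_le_integral_nomeas => //.
  - by apply/measurable_EFinP/measurable_funTS.
  - by move=> x _; rewrite lee_fin.
  - by move=> x _; rewrite lee_fin L2norm_ge0.
  - case: dnh => N [mN N0 NP]; exists N; split => // x /= nx; apply: NP => /= H.
    by apply: nx => Dx; rewrite lee_fin (H Dx).
have h2 : (\int[lam]_(x in D) (L2norm (f n x))%:E <=
    \int[lam]_(x in D) ((k x)%:E + (dn x)%:E))%E.
  have [N1 [mN1 N10 NP1]] := kh; have [N2 [mN2 N20 NP2]] := dnh.
  apply: ae_le_integral_nomeas => //.
  - apply/measurable_EFinP/measurable_funTS.
    exact: (@simple_comp_measurable (f n) (f n) (fun x _ => L2norm x)).
  - by move=> x _; rewrite lee_fin L2norm_ge0.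
  - by move=> x _; rewrite adde_ge0 // lee_fin.
  - exists (N1 `|` N2); split; first exact: measurableU.
      by rewrite measureU0.
    move=> x /= nx; apply: contrapT => /not_orP[n1 n2]; apply: nx => Dx.
    have -> : k x = L2norm (cst 0 x - h x).
      by apply: contrapT => hh; apply: n1; apply: NP1 => /= H; apply: hh; apply: H;
        exact: DD0.
    have -> : dn x = L2norm (f n x - h x).
      by apply: contrapT => hh; apply: n2; apply: NP2 => /= H; apply: hh; exact: H.
    rewrite lee_fin /= sub0r L2normN addrC.
    by apply: (le_trans _ (L2normD _ _)); rewrite subrK.
have h3 := simple_integral_le mD lD (sf n).
have h4 : (\int[lam]_(x in D) ((k x)%:E + (dn x)%:E) =
    \int[lam]_(x in D) (k x)%:E + \int[lam]_(x in D) (dn x)%:E)%E.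
  apply: ge0_integralD => //.
  - by move=> x _; rewrite lee_fin.
  - by apply/measurable_EFinP/measurable_funTS.
  - by move=> x _; rewrite lee_fin.
  - by apply/measurable_EFinP/measurable_funTS.
have h5 : ((L2norm (g t - g s))%:E <=
    (L2norm (simple_integral D (f n)))%:E + (e / 2)%:E)%E.
  rewrite -EFinD lee_fin.
  rewrite -[leLHS]L2normN.
  apply: (@le_trans _ _ (L2norm ((simple_integral D (f n) - (g t - g s)) -
    simple_integral D (f n)))).
    by rewrite addrAC subrr add0r.
  by apply: (le_trans (L2normB _ _)); rewrite addrC lerD2l ltW.
apply: (le_trans h5).
rewrite [e in leRHS]splitr EFinD addeA; apply: leeD => //.
apply: (le_trans h3); apply: (le_trans h2); rewrite h4; apply: leeD => //.
exact: ltW.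
Unshelve. all: by end_near. Qed.

End simple_functions.

(** * Square-integrable functions of ordered pairs of parameters *)

Section product.
Context {R : realType}.
Local Notation RR := (measurableTypeR R).

Definition Lam2 : {measure set (RR * RR) -> \bar R} := (@Lam R \x @Lam R)%E.

Lemma ge0_int_fst (f : RR -> \bar R) : measurable_fun setT f ->
  (forall x, (0 <= f x)%E) ->
  (\int[Lam2]_p f p.1 = \int[Lam]_x f x)%E.
Proof.
move=> mf f0; rewrite /Lam2 fubini_tonelli1 //=; last first.
  by apply: (measurableT_comp mf); exact: measurable_fst.
apply: eq_integral => x _; rewrite /fubini_F /=.
by rewrite integral_cst //= [X in (_ * X)%E]Lam_setT mule1.
Qed.

Lemma ge0_int_snd (f : RR -> \bar R) : measurable_fun setT f ->
  (forall x, (0 <= f x)%E) ->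
  (\int[Lam2]_p f p.2 = \int[Lam]_x f x)%E.
Proof.
move=> mf f0; rewrite /Lam2 fubini_tonelli2 //=; last first.
  by apply: (measurableT_comp mf); exact: measurable_snd.
apply: eq_integral => x _; rewrite /fubini_G /=.
by rewrite integral_cst //= [X in (_ * X)%E]Lam_setT mule1.
Qed.

Lemma Lam2_setT : Lam2 setT = 1%E.
Proof.
rewrite /Lam2 /= -setXTT product_measure1E // [X in (X * _)%E]Lam_setT mul1e.
exact: Lam_setT.
Qed.

Lemma ae_prod (E : R -> Prop) : {ae @Lam R, forall s, E s} ->
  {ae Lam2, forall p, E p.1 /\ E p.2}.
Proof.
move=> [N [mN N0 NE]].
exists ((N `*` setT) `|` (setT `*` N)); split.
- by apply: measurableU; exact: measurableX.
- rewrite measureU0 //; try exact: measurableX.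
    by rewrite /Lam2 /= product_measure1E // [X in (X * _)%E]N0 mul0e.
  by rewrite /Lam2 /= product_measure1E // [X in (_ * X)%E]N0 mule0.
- move=> [x y] /= /not_andP[h|h]; [left|right]; split => //; exact: NE.
Qed.

Lemma prod_ae1 (P : R * R -> Prop) : {ae Lam2, forall p, P p} ->
  {ae @Lam R, forall x, {ae @Lam R, forall y, P (x, y)}}.
Proof.
move=> [N [mN N0 NP]].
have h : (\int[@Lam R]_x (Lam (xsection N x)) = 0)%E by exact: N0.
have mx : measurable_fun setT (fun x : RR => Lam (xsection N x)).
  exact: (measurable_fun_xsection (@Lam R) mN).
have h2 : (\int[@Lam R]_x `|Lam (xsection N x)| = 0)%E.
  by rewrite -[RHS]h; apply: eq_integral => x _; rewrite gee0_abs.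
have /(ae_eq_integral_abs _ measurableT mx) h3 := h2.
apply: (Lam_aeS h3) => x _ /(_ I) hx.
exists (xsection N x); split => //; first exact: measurable_xsection.
by move=> y /= nP; rewrite /xsection /= inE; apply: NP.
Qed.

Lemma prod_ae2 (P : R * R -> Prop) : {ae Lam2, forall p, P p} ->
  {ae @Lam R, forall y, {ae @Lam R, forall x, P (x, y)}}.
Proof.
move=> [N [mN N0 NP]].
have h : (\int[@Lam R]_y (Lam (ysection N y)) = 0)%E.
  have e1 : (Lam2 N = \int[Lam2]_p (\1_N p)%:E)%E by rewrite integral_indic // setIT.
  rewrite -N0 e1 /Lam2 fubini_tonelli2 //=.
  - apply: eq_integral => y _; rewrite /fubini_G.
    have mN' := measurable_ysection y mN.
    rewrite -[LHS](_ : \int[Lam]_x (\1_(ysection N y) x)%:E = _)%E; last first.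
      by rewrite integral_indic // setIT.
    by apply: eq_integral => x _; rewrite !indicE mem_ysection.
  - by apply/measurable_EFinP; exact: measurable_indic.
have mx : measurable_fun setT (fun y : RR => Lam (ysection N y)).
  exact: (measurable_fun_ysection (@Lam R) mN).
have h2 : (\int[@Lam R]_y `|Lam (ysection N y)| = 0)%E.
  by rewrite -[RHS]h; apply: eq_integral => x _; rewrite gee0_abs.
have /(ae_eq_integral_abs _ measurableT mx) h3 := h2.
apply: (Lam_aeS h3) => y _ /(_ I) hy.
exists (ysection N y); split => //; first exact: measurable_ysection.
by move=> x /= nP; rewrite /ysection /= inE; apply: NP.
Qed.

Definition ordered_pairs : set (RR * RR) :=
  [set p | [/\ 0 < p.1, p.1 < p.2 & p.2 < 1]].

Lemma measurable_ordered_pairs : measurable ordered_pairs.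
Proof.
have m1 : measurable_fun setT (fun p : RR * RR => p.1 : R) by exact: measurable_fst.
have m2 : measurable_fun setT (fun p : RR * RR => p.2 : R) by exact: measurable_snd.
have h (f : RR * RR -> R) : measurable_fun setT f -> measurable [set p | 0 < f p].
  move=> mf; rewrite (_ : [set _ | _] = f @^-1` `]0, +oo[%classic).
    by rewrite -[X in measurable X]setTI; apply: mf.
  by apply/seteqP; split => p /=; rewrite in_itv /= andbT.
rewrite (_ : ordered_pairs = [set p | 0 < p.1] `&` [set p | 0 < p.2 - p.1] `&` [set
  p | 0 < 1 - p.2]).
  apply: measurableI; [apply: measurableI|]; apply: h => //.
  - exact: measurable_funB.
  - exact: measurable_funB.
apply/seteqP; split => p /=; rewrite !subr_gt0; first by move=> [].
by move=> [[]].
Qed.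

(** For almost every [s], [P] holds with almost every partner on either side.
    Two such parameters have a common partner in between, through which
    transitivity applies. *)
Lemma ordered_pairs_ae (P : R -> R -> Prop) :
  (forall x y z, x < y -> y < z -> P x y -> P y z -> P x z) ->
  {ae Lam2, forall p, ordered_pairs p -> P p.1 p.2} ->
  exists E : set R, {ae @Lam R, forall s, E s} /\
    forall s t, 0 < s -> s < t -> t < 1 -> E s -> E t -> P s t.
Proof.
move=> Ptr H.
have h1 := prod_ae1 H; have h2 := prod_ae2 H.
exists [set s | {ae @Lam R, forall y, ordered_pairs (s, y) -> P s y} /\
   {ae @Lam R, forall x, ordered_pairs (x, s) -> P x s}]; split.
  exact: (Lam_aeI h1 h2).
move=> s t s0 st t1 [Es _] [_ Et].
have [r /andP[sr rt] [r1 r2]] := Lam_dense (Lam_aeI Es Et) (ltW s0) st (ltW t1).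
apply: (Ptr _ _ _ sr rt).
  by apply: r1; split => //=; exact: lt_trans rt t1.
by apply: r2; split => //=; exact: lt_trans s0 sr.
Qed.

Definition pairs_norm2 (f : RR * RR ->
  R) : \bar R := (\int[Lam2]_(p in ordered_pairs) (f p ^+ 2)%:E)%E.

Definition pospart (f : RR * RR -> R) p := Num.max 0 (f p).

Lemma pairs_norm2_ge0 f : (0 <= pairs_norm2 f)%E.
Proof. by apply: integral_ge0 => p _; rewrite lee_fin sqr_ge0. Qed.

Lemma measurable_sq (f : RR * RR -> R) (D : set (RR * RR)) : measurable_fun setT f ->
  measurable_fun D (fun p => (f p ^+ 2)%:E).
Proof. by move=> mf; apply/measurable_EFinP/measurable_funTS;
  exact: measurable_funX. Qed.

Lemma measurable_pospart (f : RR * RR -> R) : measurable_fun setT f ->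
  measurable_fun setT (pospart f).
Proof. by move=> mf; exact: measurable_maxr. Qed.

Lemma pairs_norm2_eq0 (f : RR * RR -> R) : measurable_fun setT f ->
  pairs_norm2 f = 0%E ->
  {ae Lam2, forall p, ordered_pairs p -> f p = 0}.
Proof.
move=> mf; rewrite /pairs_norm2 => h.
have h2 : (\int[Lam2]_(p in ordered_pairs) `|(f p ^+ 2)%:E| = 0)%E.
  by rewrite -[RHS]h; apply: eq_integral => x _; rewrite gee0_abs // lee_fin sqr_ge0.
have /(ae_eq_integral_abs _ measurable_ordered_pairs (measurable_sq (D :=
  ordered_pairs) mf)) [N [mN N0 NP]] := h2.
exists N; split => // p /= np; apply: NP => /= h3; apply: np => tp.
by have [/eqP] := h3 tp; rewrite sqrf_eq0 => /eqP.
Qed.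

Lemma le_pairs_norm2 (W1 W2 Zf Rf : RR * RR -> R) (a b c : R) :
  measurable_fun setT W1 -> measurable_fun setT W2 ->
  measurable_fun setT Zf -> measurable_fun setT Rf -> 0 <= a -> 0 <= b -> 0 <= c ->
  {ae Lam2, forall p, ordered_pairs p ->
    W2 p ^+ 2 <= a * W1 p ^+ 2 + b * Zf p ^+ 2 + c * Rf p ^+ 2} ->
  (pairs_norm2 W2 <= a%:E * pairs_norm2 W1 + b%:E * pairs_norm2 Zf + c%:E *
    pairs_norm2 Rf)%E.
Proof.
move=> m1 m2 mz mr a0 b0 c0 H.
have hm := measurable_ordered_pairs.
have mm (x : R) (f : RR * RR -> R) : measurable_fun setT f ->
  measurable_fun ordered_pairs (fun p : RR * RR => (x * f p ^+ 2)%:E).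
  by move=> mf; apply/measurable_EFinP/measurable_funTS/measurable_funM => //;
    exact: measurable_funX.
have e (f : RR * RR -> R) x : 0 <= x -> measurable_fun setT f ->
    (x%:E * pairs_norm2 f = \int[Lam2]_(p in ordered_pairs) (x * f p ^+ 2)%:E)%E.
  move=> x0 mf; rewrite /pairs_norm2 -ge0_integralZl //.
  - exact: measurable_sq.
  - by move=> p _; rewrite lee_fin sqr_ge0.
rewrite !e //.
have g0 x (f : RR * RR -> R) (p : RR * RR) : 0 <= x ->
  (0 <= (x * f p ^+ 2)%:E :> \bar R)%E.
  by move=> x0; rewrite lee_fin mulr_ge0 // sqr_ge0.
rewrite -ge0_integralD //; try by [exact: mm | move=> p _; exact: g0].
rewrite -ge0_integralD //; try by [exact: mm | move=> p _; exact: g0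
   | move=> p _; rewrite adde_ge0 //; exact: g0 | apply: emeasurable_funD; exact: mm].
apply: ae_le_integral_nomeas => //.
- exact: measurable_sq.
- by move=> p _; rewrite lee_fin sqr_ge0.
- by move=> p _; rewrite !adde_ge0 //; exact: g0.
Qed.

(** The quantities that are kept nonpositive along the flow have this form: a
    comparison of slopes has [be = - ga] and [c = 0], a one-sided bound has [a
    = be = 0]. *)
Definition pair_affine (be ga a : R) (u : L2 R) (c : R) (p : RR * RR) : R :=
  a * (p.2 - p.1) + be * u p.2 + ga * u p.1 + c.

Lemma measurable_pair_affine be ga a u c :
  measurable_fun setT (pair_affine be ga a u c).
Proof.
have m1 : measurable_fun setT (fun p : RR * RR => p.1 : R) by exact: measurable_fst.
have m2 : measurable_fun setT (fun p : RR * RR => p.2 : R) by exact: measurable_snd.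
have mu1 : measurable_fun setT (fun p : RR * RR => u p.1).
  by apply: (measurableT_comp (measurable_L2 u)); exact: measurable_fst.
have mu2 : measurable_fun setT (fun p : RR * RR => u p.2).
  by apply: (measurableT_comp (measurable_L2 u)); exact: measurable_snd.
apply: measurable_funD => //; apply: measurable_funD; last exact: measurable_funM.
apply: measurable_funD; last exact: measurable_funM.
by apply: measurable_funM => //; exact: measurable_funB.
Qed.

Definition pair_affine_bound (be ga a : R) (u : L2 R) (c : R) : R :=
  4 * (a ^+ 2 + be ^+ 2 * L2norm u ^+ 2 + ga ^+ 2 * L2norm u ^+ 2 + c ^+ 2).

(** Expand the square of a sum of four terms; on ordered pairs [p.2 - p.1] is
    at most 1, and both marginals of the product are the measure on ]0, 1[. *)
Lemma pairs_norm2_affine_le be ga a u c :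
  (pairs_norm2 (pair_affine be ga a u c) <= (pair_affine_bound be ga a u c)%:E)%E.
Proof.
have mu1 : measurable_fun setT (fun x : RR => (u x ^+ 2)%:E : \bar R).
  by apply/measurable_EFinP; exact: measurable_funX.
have mp1 : measurable_fun setT (fun p : RR * RR => (u p.1 ^+ 2)%:E : \bar R).
  by apply: (measurableT_comp mu1); exact: measurable_fst.
have mp2 : measurable_fun setT (fun p : RR * RR => (u p.2 ^+ 2)%:E : \bar R).
  by apply: (measurableT_comp mu1); exact: measurable_snd.
have n1 : (\int[Lam2]_p (u p.1 ^+ 2)%:E = (L2norm u ^+ 2)%:E)%E.
  rewrite (ge0_int_fst mu1) ?L2sqE // => x; by rewrite lee_fin sqr_ge0.
have n2 : (\int[Lam2]_p (u p.2 ^+ 2)%:E = (L2norm u ^+ 2)%:E)%E.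
  rewrite (ge0_int_snd mu1) ?L2sqE // => x; by rewrite lee_fin sqr_ge0.
pose f (p : RR * RR) : \bar R := ((4 * be ^+ 2)%:E * (u p.2 ^+ 2)%:E +
   (4 * ga ^+ 2)%:E * (u p.1 ^+ 2)%:E + (4 * (a ^+ 2 + c ^+ 2))%:E)%E.
have b0 : 0 <= 4 * be ^+ 2 by rewrite mulr_ge0 // sqr_ge0.
have g0 : 0 <= 4 * ga ^+ 2 by rewrite mulr_ge0 // sqr_ge0.
have c0 : 0 <= 4 * (a ^+ 2 + c ^+ 2) by rewrite mulr_ge0 // addr_ge0 // sqr_ge0.
have q0 x : (0 <= (u x ^+ 2)%:E :> \bar R)%E by rewrite lee_fin sqr_ge0.
have mf2 : measurable_fun setT (fun p : RR * RR =>
  ((4 * be ^+ 2)%:E * (u p.2 ^+ 2)%:E)%E).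
  exact: emeasurable_funM.
have mf1 : measurable_fun setT (fun p : RR * RR =>
  ((4 * ga ^+ 2)%:E * (u p.1 ^+ 2)%:E)%E).
  exact: emeasurable_funM.
have mff : measurable_fun setT f by do ?apply: emeasurable_funD.
have f0 p : (0 <= f p)%E.
  by rewrite /f !adde_ge0 // ?mule_ge0 // ?lee_fin.
have -> : (pair_affine_bound be ga a u c)%:E = (\int[Lam2]_p f p)%E.
  rewrite /f ge0_integralD //; last 2 first.
  - by move=> p _; rewrite !adde_ge0 // ?mule_ge0 // ?lee_fin.
  - exact: emeasurable_funD.
  rewrite ge0_integralD //; last 2 first.
  - by move=> p _; rewrite mule_ge0 // lee_fin.
  - by move=> p _; rewrite mule_ge0 // lee_fin.
  rewrite !ge0_integralZl //; try by rewrite lee_fin.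
  rewrite n1 n2 integral_cst // Lam2_setT mule1 -!EFinM -!EFinD; congr EFin.
  rewrite /pair_affine_bound; ring.
apply: (@le_trans _ _ (\int[Lam2]_(p in ordered_pairs) f p)%E); last first.
  by apply: ge0_subset_integral => //; exact: measurable_ordered_pairs.
apply: ge0_le_integral => //.
- exact: measurable_ordered_pairs.
- by move=> p _; rewrite lee_fin sqr_ge0.
- by apply: measurable_sq; exact: measurable_pair_affine.
- exact: measurable_funTS.
move=> [x y] [/= x0 xy y1]; rewrite /f /pair_affine /= -!EFinM -!EFinD lee_fin.
have h1 : (a * (y - x)) ^+ 2 <= a ^+ 2.
  rewrite exprMn ler_piMr ?sqr_ge0 //.
  by rewrite -[leRHS](expr1n _ 2) ler_pXn2r ?nnegrE //; lra.
set X := a * (y - x) in h1 *; set Y := be * u y; set Z := ga * u x.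
have -> : 4 * be ^+ 2 * u y ^+ 2 = 4 * Y ^+ 2 by rewrite /Y; ring.
have -> : 4 * ga ^+ 2 * u x ^+ 2 = 4 * Z ^+ 2 by rewrite /Z; ring.
have s1 := sqr_ge0 (X - Y); have s2 := sqr_ge0 (X - Z); have s3 := sqr_ge0 (X - c).
have s4 := sqr_ge0 (Y - Z); have s5 := sqr_ge0 (Y - c); have s6 := sqr_ge0 (Z - c).
nra.
Qed.

End product.

(** * The defect of a sign condition *)

Section scalar.
Context {R : realType}.

(** When [w > 0] the displacement [r * z] does not increase the positive part,
    and otherwise it adds at most [r * `|z|]. The remainder is split off by
    Young's inequality with weight [k]. *)
Lemma pos_step (w z rho r k : R) : 0 <= r -> 0 < k -> (0 < w -> z <= 0) ->
  Num.max 0 (w + r * z + rho) ^+ 2 <=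
  (1 + k) * Num.max 0 w ^+ 2 + ((1 + k) * r ^+ 2) * z ^+ 2 + (1 + k^-1) * rho ^+ 2.
Proof.
move=> r0 k0 wz.
set m := Num.max 0 (w + r * z).
have m0 : 0 <= m by rewrite le_max lexx.
have h1 : Num.max 0 (w + r * z + rho) <= m + `|rho|.
  rewrite ge_max addr_ge0 //=.
  by apply: lerD; [rewrite le_max lexx orbT|exact: ler_norm].
have h2 : m ^+ 2 <= Num.max 0 w ^+ 2 + r ^+ 2 * z ^+ 2.
  have [w0|w0] := ltP 0 w.
    have z0 := wz w0.
    have mw : m <= w by rewrite ge_max (ltW w0) /= gerDl mulr_ge0_le0.
    apply: (@le_trans _ _ (w ^+ 2)); first by rewrite ler_pXn2r ?nnegrE // ltW.
    by rewrite lerDl mulr_ge0 // sqr_ge0.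
  rewrite expr0n /= add0r -exprMn.
  have mw : m <= `|r * z|
    by rewrite ge_max normr_ge0 /= (le_trans _ (ler_norm _)) // gerDr.
  by rewrite -[leRHS]real_normK ?num_real // ler_pXn2r ?nnegrE.
apply: (@le_trans _ _ ((m + `|rho|) ^+ 2)).
  by rewrite ler_pXn2r ?nnegrE ?addr_ge0 // le_max lexx.
have kV : 0 < k^-1 by rewrite invr_gt0.
have h3 : (m + `|rho|) ^+ 2 <= (1 + k) * m ^+ 2 + (1 + k^-1) * `|rho| ^+ 2.
  rewrite -subr_ge0.
  rewrite (_ : _ - _ = k^-1 * (k * m - `|rho|) ^+ 2); last by field; exact: lt0r_neq0.
  by rewrite mulr_ge0 ?sqr_ge0 // ltW.
apply: (le_trans h3); rewrite real_normK ?num_real // lerD2r -mulrA -mulrDr.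
by rewrite ler_wpM2l // addr_ge0 // ltW.
Qed.

(** Taking [k] proportional to [r] makes the loss from [1 + k] at most a small
    multiple of [r], while the error term divided by [k] is of order [zeta *
    r]. *)
Lemma right_upper (phi0 Z : R) (f : R -> R) : 0 <= phi0 -> 0 <= Z ->
  (forall zeta, 0 < zeta -> exists2 d, 0 < d & forall r, 0 < r < d ->
    forall k, 0 < k ->
    f r <= (1 + k) * phi0 + (1 + k) * r ^+ 2 * Z + (1 + k^-1) * (zeta * r ^+ 2)) ->
  forall e, 0 < e -> exists2 d, 0 < d & forall r, 0 < r < d -> f r <= phi0 + e * r.
Proof.
move=> p0 Z0 H e e0.
pose k := e / (4 * (phi0 + 1)).
have p1 : 0 < phi0 + 1 by lra.
have k0 : 0 < k by rewrite divr_gt0 // mulr_gt0.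
pose zeta := Num.min (e / 4) (k * (e / 4)).
have e4 : 0 < e / 4 by rewrite divr_gt0.
have z0 : 0 < zeta by rewrite lt_min e4 mulr_gt0.
have [d d0 dP] := H _ z0.
pose d' := Num.min (Num.min d 1) (Num.min k^-1 (e / (8 * (Z + 1)))).
have Z1 : 0 < Z + 1 by lra.
have d'0 : 0 < d' by rewrite !lt_min d0 ltr01 invr_gt0 k0 divr_gt0 // mulr_gt0.
exists d' => // r /andP[r0 rd'].
move: (rd'); rewrite !lt_min => /andP[/andP[rd r1] /andP[rk rZ]].
have kr : 0 < k * r by rewrite mulr_gt0.
have := dP r; rewrite r0 rd => /(_ isT _ kr) h; apply: (le_trans h).
have a1 : k * phi0 <= e / 4.
  have ke : k * (4 * (phi0 + 1)) = e by rewrite /k divfK // lt0r_neq0 // mulr_gt0.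
  nra.
have a2 : k * r < 1 by rewrite mulrC -ltr_pdivlMr // div1r.
have a3 : r * Z <= e / 8.
  have : r * (8 * (Z + 1)) < e by rewrite -ltr_pdivlMr // mulr_gt0.
  nra.
have a4 : zeta <= e / 4 by rewrite ge_min lexx.
have a5 : k^-1 * zeta <= e / 4.
  by rewrite mulrC ler_pdivrMr // mulrC ge_min lexx orbT.
have b1 : (1 + k * r) * r ^+ 2 * Z <= 2 * (r * (e / 8)).
  rewrite -mulrA; apply: ler_pM.
  - by rewrite addr_ge0 // ltW.
  - by rewrite mulr_ge0 // sqr_ge0.
  - lra.
  - by rewrite expr2 -mulrA ler_pM2l.
have b2 : (1 + (k * r)^-1) * (zeta * r ^+ 2) = zeta * r * r + (k^-1 * zeta) * r.
  by field; rewrite !lt0r_neq0.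
have b3 : zeta * r * r <= e / 4 * r.
  rewrite ler_wpM2r ?(ltW r0) //.
  by apply: (le_trans _ a4); rewrite ler_piMr ?(ltW z0) // ltW.
have b4 : (k^-1 * zeta) * r <= e / 4 * r by rewrite ler_wpM2r ?(ltW r0).
have b5 : k * r * phi0 <= e / 4 * r.
  by rewrite mulrAC ler_wpM2r ?(ltW r0).
rewrite b2; nra.
Qed.

End scalar.

Section flow.
Context {R : realType}.
Local Notation lam := (@lebesgue_measure R).
Variables (be ga c : R).

(** It vanishes exactly when the affine quantity is nonpositive at almost
    every ordered pair. *)
Definition defect (a : R) (u : L2 R) : R :=
  fine (pairs_norm2 (pospart (pair_affine be ga a u c))).

Lemma pairs_norm2_pospart_le (f : R * R ->
  R) : measurable_fun setT (f : measurableTypeR R * measurableTypeR R -> R) ->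
  (pairs_norm2 (pospart f) <= pairs_norm2 f)%E.
Proof.
move=> mf; apply: ge0_le_integral.
- exact: measurable_ordered_pairs.
- by move=> p _; rewrite lee_fin sqr_ge0.
- by apply: measurable_sq; exact: measurable_pospart.
- exact: measurable_sq.
- move=> p _; rewrite lee_fin /pospart -[leRHS]real_normK ?num_real //.
  by rewrite ler_pXn2r ?nnegrE ?le_max ?lexx // ge_max normr_ge0 ler_norm.
Qed.

Lemma defectE a u : (defect a u)%:E = pairs_norm2 (pospart (pair_affine be ga a u c)).
Proof.
rewrite /defect fineK // ge0_fin_numE ?pairs_norm2_ge0 //.
apply: le_lt_trans (pairs_norm2_pospart_le (measurable_pair_affine _ _ _ _ _)) _.
by apply: le_lt_trans (pairs_norm2_affine_le _ _ _ _ _) (ltry _).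
Qed.

Lemma defect_ge0 a u : 0 <= defect a u.
Proof. by rewrite fine_ge0 // pairs_norm2_ge0. Qed.

Lemma defect_le_bound a u : defect a u <= pair_affine_bound be ga a u c.
Proof.
rewrite -lee_fin defectE.
apply: le_trans (pairs_norm2_pospart_le (measurable_pair_affine _ _ _ _ _)) _;
  exact: pairs_norm2_affine_le.
Qed.

(** The new affine quantity is the old one, plus [r] times a velocity which is
    nonpositive where the old one is positive, plus a remainder. *)
Lemma defect_step a1 u1 za v a2 u2 r k : 0 <= r -> 0 < k ->
  {ae Lam2, forall p, ordered_pairs p -> 0 < pair_affine be ga a1 u1 c p ->
    pair_affine be ga za v 0 p <= 0} ->
  defect a2 u2 <= (1 + k) * defect a1 u1 + (1 + k) * r ^+ 2 * pair_affine_bound be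
    ga za v 0 +
    (1 + k^-1) * pair_affine_bound be ga (a2 - a1 - r * za) (u2 - u1 - r *: v) 0.
Proof.
move=> r0 k0 H.
have k1 : 0 <= 1 + k by rewrite addr_ge0 // ltW.
have k2 : 0 <= 1 + k^-1 by rewrite addr_ge0 // invr_ge0 ltW.
have r2 : 0 <= (1 + k) * r ^+ 2 by rewrite mulr_ge0 // sqr_ge0.
set rho := pair_affine be ga (a2 - a1 - r * za) (u2 - u1 - r *: v) 0.
have h : (pairs_norm2 (pospart (pair_affine be ga a2 u2 c)) <= (1 + k)%:E *
  pairs_norm2 (pospart (pair_affine be ga a1 u1 c)) +
    ((1 + k) * r ^+ 2)%:E * pairs_norm2 (pair_affine be ga za v 0) + (1 + k^-1)%:E
      * pairs_norm2 rho)%E.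
  apply: le_pairs_norm2 => //;
    try exact: measurable_pospart (measurable_pair_affine _ _ _ _ _);
    try exact: measurable_pair_affine.
  case: H => N [mN N0 NP]; exists N; split => // p /= np; apply: NP => /= H.
  apply: np => tp; rewrite /pospart.
  have -> : pair_affine be ga a2 u2 c p = pair_affine be ga a1 u1 c p + r *
    pair_affine be ga za v 0 p + rho p.
    by rewrite /rho /pair_affine !L2subE !L2scaleE; ring.
  by apply: pos_step => //; exact: H.
rewrite -lee_fin defectE; apply: (le_trans h).
rewrite !EFinD [X in (_ <= X + _ + _)%E]EFinM defectE [X in (_ <= _ + X + _)%E]EFinM
  [X in (_ <= _ + _ + X)%E]EFinM.
apply: leeD; [apply: leeD => //|]; apply: lee_wpmul2l; rewrite ?lee_fin //;
  exact: pairs_norm2_affine_le.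
Qed.

Lemma defect_lip a1 u1 a2 u2 k : 0 < k ->
  defect a2 u2 <= (1 + k) * defect a1 u1 + (1 + k^-1) * pair_affine_bound be ga (a2
    - a1) (u2 - u1) 0.
Proof.
move=> k0.
have := @defect_step a1 u1 0 0 a2 u2 0 k (lexx 0) k0.
rewrite expr0n /= mulr0 mul0r addr0 mul0r subr0 scale0r subr0; apply.
apply: aeW => p _ _; rewrite /pair_affine mul0r.
by rewrite (_ : (0 : L2 R) p.2 = 0) // (_ : (0 : L2 R) p.1 = 0) // !mulr0 !addr0.
Qed.

Definition defect_const : R := 4 * (1 + be ^+ 2 + ga ^+ 2).

Lemma defect_const_gt0 : 0 < defect_const.
Proof. by rewrite /defect_const mulr_gt0 // -addrA ltr_wpDr // addr_ge0 // sqr_ge0.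
  Qed.

Lemma pair_affine_bound_le a u M : 0 <= M -> `|a| <= M -> L2norm u <= M ->
  pair_affine_bound be ga a u 0 <= defect_const * M ^+ 2.
Proof.
move=> M0 aM uM; rewrite /pair_affine_bound /defect_const expr0n /= addr0 -mulrA
  ler_pM2l //.
have a2 : a ^+ 2 <= M ^+ 2.
  by rewrite -[leLHS]real_normK ?num_real // ler_pXn2r ?nnegrE.
have u2 : L2norm u ^+ 2 <= M ^+ 2 by rewrite ler_pXn2r ?nnegrE ?L2norm_ge0.
rewrite !mulrDl mul1r; apply: lerD; [apply: lerD => //|];
  by apply: ler_wpM2l => //; rewrite sqr_ge0.
Qed.

End flow.

(** * Sign conditions preserved by the flow *)

Section flow_sign.
Context {R : realType}.
Local Notation lam := (@lebesgue_measure R).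
Local Notation RR := (measurableTypeR R).

Lemma integral_on_add_cst (k : RR -> R) (D A : set RR) (m : R) :
  measurable_fun setT k -> (forall x, 0 <= k x) -> measurable D -> measurable A ->
  (\int[lam]_(x in D) (k x)%:E < +oo)%E -> (lam D < +oo)%E -> 0 <= m ->
  integral_on (fun x => k x + m) D A = integral_on k D A + m * fine (lam (A `&` D)).
Proof.
move=> mk k0 mD mA kD lD m0; rewrite /integral_on.
have mAD : measurable (A `&` D) by exact: measurableI.
have mkE : measurable_fun (A `&` D) (EFin \o k)
  by apply/measurable_EFinP/measurable_funTS.
have f1 : (\int[lam]_(x in A `&` D) (k x)%:E)%E \is a fin_num.
  rewrite ge0_fin_numE; last by apply: integral_ge0 => x _; rewrite lee_fin.
  apply: le_lt_trans kD; apply: ge0_subset_integral => //.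
  - by apply/measurable_EFinP/measurable_funTS.
  - by move=> x _; rewrite lee_fin.
have f2 : lam (A `&` D) \is a fin_num.
  rewrite ge0_fin_numE //; apply: le_lt_trans lD.
  by apply: le_measure; rewrite ?inE.
apply: EFin_inj; rewrite fineK.
  rewrite EFinD EFinM !fineK // -integral_cst // -ge0_integralD //.
  by move=> x _; rewrite lee_fin.
under eq_integral do rewrite EFinD.
rewrite ge0_integralD //; last by move=> x _; rewrite lee_fin.
by rewrite integral_cst // fin_numD f1 fin_numM.
Qed.

Variables (be ga c : R) (g : R -> L2 R) (A A' : R -> R) (M : R).
Hypothesis W : forall T, 0 < T -> W11 T g.
Hypothesis C0 : forall e, 0 < e -> exists2 d, 0 < d &
  forall r, 0 < r < d -> L2norm (g r - g 0) < e.
Hypothesis M0 : 0 <= M.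
Hypothesis LA : forall x y, 0 <= x -> x <= y -> `|A y - A x| <= M * (y - x).
Hypothesis DA : forall t, 0 < t -> forall e, 0 < e -> exists2 d, 0 < d &
  forall r, 0 < r < d -> `|A (t + r) - A t - r * A' t| <= e * r.
Hypothesis Der : {ae lam, forall t, 0 < t -> exists v, strong_derivative g t v /\
  {ae Lam2, forall p, ordered_pairs p -> 0 < pair_affine be ga (A t) (g t) c p ->
    pair_affine be ga (A' t) v 0 p <= 0}}.
Hypothesis Init : {ae Lam2, forall p, ordered_pairs p ->
  pair_affine be ga (A 0) (g 0) c p <= 0}.

Let defect_at t := defect be ga c (A t) (g t).

Lemma strong_derivative_right (t : R) (v : L2 R) : strong_derivative g t v ->
  forall e, 0 < e -> exists2 d, 0 < d & forall r, 0 < r < d ->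
    L2norm (g (t + r) - g t - r *: v) <= e * r.
Proof.
move=> H e e0.
have [d /= d0 dP] : \forall r \near (0 : R)^', L2norm (r^-1 *:
  (g (t + r) - g t) - v) < e.
  exact: (cvgr_lt _ H _ e0).
exists d => // r /andP[r0 rd].
have := dP r; rewrite /= sub0r normrN gtr0_norm // => /(_ rd);
  rewrite gt_eqF // => /(_ isT) h.
have -> : g (t + r) - g t - r *: v = r *: (r^-1 *: (g (t + r) - g t) - v).
  by rewrite scalerBr scalerA divff ?gt_eqF // scale1r.
by rewrite L2normZ gtr0_norm // mulrC ler_pM2r // ltW.
Qed.

(** The remainder in [defect_step] is of order smaller than [r] in norm, by
    differentiability of [g] and of [A], and is squared. *)
Lemma defect_right_derivative t v : 0 < t -> strong_derivative g t v ->
  {ae Lam2, forall p, ordered_pairs p -> 0 < pair_affine be ga (A t) (g t) c p ->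
    pair_affine be ga (A' t) v 0 p <= 0} ->
  forall e, 0 < e -> exists2 d, 0 < d &
    forall r, 0 < r < d -> defect_at (t + r) <= defect_at t + e * r.
Proof.
move=> t0 sd Hv; have C := defect_const_gt0 be ga.
apply: (@right_upper R (defect_at t) (pair_affine_bound be ga (A' t) v 0) (fun r =>
  defect_at (t + r))).
- exact: defect_ge0.
- by rewrite /pair_affine_bound;
  do ?[exact: sqr_ge0|apply: addr_ge0|apply: mulr_ge0 => //].
move=> z z0.
pose eta := Num.min 1 (z / defect_const be ga).
have eta0 : 0 < eta by rewrite lt_min ltr01 divr_gt0.
have [d1 d10 H1] := strong_derivative_right sd eta0.
have [d2 d20 H2] := DA t0 eta0.
exists (Num.min d1 d2); first by rewrite lt_min d10.
move=> r /andP[r0]; rewrite lt_min => /andP[rd1 rd2] k k0.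
have h := @defect_step R be ga c (A t) (g t) (A' t) v (A (t + r)) (g (t + r)) r k
  (ltW r0) k0 Hv.
apply: (le_trans h); rewrite lerD2l ler_wpM2l //.
  by rewrite addr_ge0 // invr_ge0 ltW.
apply: le_trans; first apply: (@pair_affine_bound_le R be ga _ _ (eta * r)).
- by rewrite mulr_ge0 // ltW.
- by apply: H2; rewrite r0.
- by apply: H1; rewrite r0.
rewrite exprMn mulrA ler_wpM2r ?sqr_ge0 //.
have e1 : eta <= 1 by rewrite ge_min lexx.
have e2 : defect_const be ga * eta <= z
  by rewrite mulrC -ler_pdivlMr // ge_min lexx orbT.
apply: le_trans e2; rewrite ler_pM2l // expr2 ler_piMr //.
exact: ltW.
Qed.

(** On [[s, T]] the defect is bounded, and the increments of [g] and [A] are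
    dominated by the integral of [k + M]. One more unit is added to [k + M],
    so that this integral is positive on nontrivial intervals and can serve as
    the weight in [defect_lip]. *)
Lemma defect_nonincreasing s T : 0 < s -> s <= T -> defect_at T <= defect_at s.
Proof.
move=> s0 sT; have C := defect_const_gt0 be ga.
have T0 : 0 < T by exact: lt_le_trans sT.
have [k [mk k0 kfin kP]] := W11_bound (W T0).
pose D0 : set RR := `]0, T]%classic.
have mD0 : measurable D0 by exact: measurable_itv.
have lD0 : (lam D0 < +oo)%E.
  by rewrite /D0 lebesgue_measure_itv /=; case: ifP => _;
    rewrite ?ltry // -EFinB ltry.
pose k1 x := k x + (M + 1).
have M1 : 0 <= M + 1 by rewrite addr_ge0.
have mk1 : measurable_fun setT k1 by exact: measurable_funD.
have k10 x : 0 <= k1 x by rewrite addr_ge0.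
have k1fin : (\int[lam]_(x in D0) (k1 x)%:E < +oo)%E.
  under eq_integral do rewrite EFinD.
  rewrite ge0_integralD //; try by [apply/measurable_EFinP/measurable_funTS|
    move=> x _; rewrite lee_fin].
  rewrite integral_cst // lte_add_pinfty //.
  by apply: lte_mul_pinfty; rewrite ?lee_fin.
have Kadd x y : 0 <= x -> x <= y -> y <= T ->
    integral_on k1 D0 `]x, y]%classic = integral_on k D0 `]x,
      y]%classic + (M + 1) * (y - x).
  move=> x0 xy yT; rewrite integral_on_add_cst //; congr (_ + _ * _).
  rewrite setIidl; last first.
    move=> z; rewrite /D0 /= !in_itv /= => /andP[a b].
    by rewrite (le_lt_trans x0 a) (le_trans b).
  rewrite lebesgue_measure_itv /= lte_fin; case: ltP => // yx.
  by apply/eqP; rewrite eq_sym subr_eq0 eq_le xy andbT.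
have K0 B : 0 <= integral_on k D0 B by exact: integral_on_ge0.
pose KT := integral_on k1 D0 D0.
have Kle x y : 0 <= x -> x <= y -> y <= T -> integral_on k1 D0 `]x, y]%classic <= KT.
  move=> x0 xy yT; apply: integral_on_mono => // z;
    rewrite /D0 /= !in_itv /= => /andP[a b].
  by rewrite (le_lt_trans x0 a) (le_trans b).
pose B := L2norm (g T) + KT.
have KT0 : 0 <= KT by exact: integral_on_ge0.
have gB t : 0 < t -> t <= T -> L2norm (g t) <= B.
  move=> t0 tT.
  have -> : g t = g T - (g T - g t) by rewrite opprB addrC subrK.
  apply: (le_trans (L2normB _ _)); rewrite lerD2l.
  apply: (le_trans (kP t T t0 tT (lexx T))).
  have := Kle t T (ltW t0) tT (lexx T); rewrite Kadd ?(ltW t0) //.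
  have : 0 <= (M + 1) * (T - t) by rewrite mulr_ge0 // subr_ge0.
  lra.
have B0 : 0 <= B by rewrite addr_ge0 // L2norm_ge0.
pose AB := `|A 0| + M * T.
have AB0 : 0 <= AB by rewrite addr_ge0 // mulr_ge0 // ltW.
have aB t : 0 < t -> t <= T -> `|A t| <= AB.
  move=> t0 tT; have h1 := LA (lexx 0) (ltW t0).
  have -> : A t = A 0 + (A t - A 0) by rewrite addrC subrK.
  apply: (le_trans (ler_normD _ _)); rewrite lerD2l; apply: (le_trans h1).
  by rewrite subr0 ler_wpM2l.
pose Phi := 4 * (AB ^+ 2 + be ^+ 2 * B ^+ 2 + ga ^+ 2 * B ^+ 2 + c ^+ 2).
have phB t : 0 < t -> t <= T -> defect_at t <= Phi.
  move=> t0 tT; apply: (le_trans (defect_le_bound _ _ _ _ _)).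
  rewrite /pair_affine_bound /Phi ler_pM2l //.
  have a2 : A t ^+ 2 <= AB ^+ 2.
    by rewrite -[leLHS]real_normK ?num_real // ler_pXn2r ?nnegrE // aB.
  have u2 : L2norm (g t) ^+ 2 <= B ^+ 2
    by rewrite ler_pXn2r ?nnegrE ?L2norm_ge0 // gB.
  rewrite lerD2r; apply: lerD; [apply: lerD => //|];
    by apply: ler_wpM2l => //; rewrite sqr_ge0.
have Phi0 : 0 <= Phi.
  by rewrite /Phi; do ?[exact: sqr_ge0|apply: addr_ge0|apply: mulr_ge0 => //].
pose C' := Phi + defect_const be ga * KT + defect_const be ga.
have C'0 : 0 < C' by rewrite ltr_wpDl // addr_ge0 // mulr_ge0 // ltW.
have key x y : s <= x -> x <= y -> y <= T ->
  defect_at y / C' - defect_at x / C' <= integral_on k1 D0 `]x, y]%classic.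
  move=> sx; rewrite le_eqVlt => /predU1P[<- _|xy yT];
    first by rewrite subrr integral_on_ge0.
  have x0 : 0 < x by exact: lt_le_trans sx.
  have xy' := ltW xy.
  have hK := Kadd x y (ltW x0) xy' yT.
  have hle := Kle x y (ltW x0) xy' yT.
  have hg := kP x y x0 xy' yT.
  have hK0 := K0 `]x, y]%classic.
  have hA := LA (ltW x0) xy'.
  set del := integral_on k1 D0 `]x, y]%classic in hK hle *.
  have yx : 0 < y - x by rewrite subr_gt0.
  have Myx : 0 <= M * (y - x) by rewrite mulr_ge0 // ltW.
  have hK' : del = integral_on k D0 `]x, y]%classic + M * (y - x) + (y - x).
    by rewrite hK mulrDl mul1r addrA.
  have del0 : 0 < del by lra.
  have h := defect_lip be ga c (A x) (g x) (A y) (g y) del0.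
  have hb := @pair_affine_bound_le R be ga (A y - A x) (g y - g x) del (ltW del0).
  have {}hb : pair_affine_bound be ga (A y - A x) (g y - g x) 0 <= defect_const be
    ga * del ^+ 2.
    by apply: hb; lra.
  have hp := phB x x0 (le_trans xy' yT).
  rewrite -mulrBl ler_pdivrMr //.
  have h2 : (1 + del^-1) * pair_affine_bound be ga (A y - A x) (g y - g x) 0 <=
     (1 + del^-1) * (defect_const be ga * del ^+ 2).
    by rewrite ler_wpM2l // addr_ge0 // invr_ge0 ltW.
  have h3 : (1 + del^-1) * (defect_const be ga * del ^+ 2) = del * (defect_const be
    ga * del + defect_const be ga).
    by field; exact: lt0r_neq0.
  have h4 : defect_const be ga * del <= defect_const be ga * KT by rewrite ler_pM2l.
  have h5 : del * (defect_const be ga * del + defect_const be ga) <= del *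
    (defect_const be ga * KT + defect_const be ga).
    by rewrite ler_pM2l // lerD2r.
  have h6 : del * defect_at x <= del * Phi by rewrite ler_pM2l.
  have h7 : defect_at y <= (1 + del) * defect_at x + (1 + del^-1) *
    pair_affine_bound be ga (A y - A x) (g y - g x) 0 by [].
  rewrite /C' !mulrDr; move: h7 h2 h5; rewrite h3 !mulrDr mulrDl mul1r; lra.
have der : {ae lam, forall x, s < x < T -> forall e, 0 < e -> exists2 d, 0 < d &
     forall y, x < y < x + d -> defect_at y / C' <= defect_at x / C' + e * (y - x)}.
  case: Der => N [mN N0 NP]; exists N; split => // t /= nt; apply: NP => /= H.
  apply: nt => /andP[st _] e e0.
  have t0 : 0 < t by exact: lt_trans st.
  have [v [sd hv]] := H t0.
  have [d d0 dP] := defect_right_derivative t0 sd hv (mulr_gt0 e0 C'0).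
  exists d => // y /andP[ty yd].
  have := dP (y - t); rewrite subr_gt0 ty ltrBlDl yd => /(_ isT).
  rewrite addrC subrK => h.
  rewrite ler_pdivrMr // mulrDl divfK ?gt_eqF //; lra.
have := @ac_nonincreasing R k1 D0 mk1 k10 mD0 k1fin (fun t =>
  defect_at t / C') s T sT key der.
by rewrite ler_pM2r // invr_gt0.
Qed.

(** The defect is nonincreasing on positive times and tends at time 0 to its
    initial value, which is zero. *)
Lemma flow_sign T : 0 <= T -> {ae Lam2, forall p, ordered_pairs p ->
  pair_affine be ga (A T) (g T) c p <= 0}.
Proof.
rewrite le_eqVlt => /predU1P[<-|T0]; first exact: Init.
have C := defect_const_gt0 be ga.
have ph0 : defect_at 0 = 0.
  rewrite /defect_at /defect (_ : pairs_norm2 _ = 0%E) //.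
  apply/eqP; rewrite eq_le pairs_norm2_ge0 andbT.
  have : (pairs_norm2 (pospart (pair_affine be ga (A 0%R) (g 0%R) c)) <=
     0%:E * pairs_norm2 (fun=> 0%R) + 0%:E * pairs_norm2 (fun=> 0%R) + 0%:E *
       pairs_norm2 (fun=> 0%R))%E.
    apply: le_pairs_norm2 => //;
      first exact: measurable_pospart (measurable_pair_affine _ _ _ _ _).
    case: Init => N [mN N0 NP]; exists N; split => // p /= np; apply: NP => /= H.
    by apply: np => tp; rewrite /pospart max_l ?H // expr0n /= !mul0r !addr0.
  by rewrite !mul0e !adde0.
have phT : defect_at T <= 0.
  apply/ler_addgt0Pr => e e0; rewrite add0r.
  pose eta := Num.min 1 (e / (2 * defect_const be ga)).
  have C2 : 0 < 2 * defect_const be ga by rewrite mulr_gt0.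
  have eta0 : 0 < eta by rewrite lt_min ltr01 divr_gt0.
  have [d d0 dP] := C0 eta0.
  pose s := Num.min (Num.min T (d / 2)) (eta / (M + 1)).
  have M1 : 0 < M + 1 by rewrite ltr_wpDl.
  have s0 : 0 < s by rewrite !lt_min T0 !divr_gt0.
  have sT : s <= T by rewrite !ge_min lexx.
  have sd : s <= d / 2 by rewrite !ge_min lexx orbT.
  have se : s * (M + 1) <= eta by rewrite -ler_pdivlMr // ge_min lexx orbT.
  apply: (le_trans (defect_nonincreasing s0 sT)).
  have h := @defect_lip R be ga c (A 0) (g 0) (A s) (g s) 1 ltr01.
  have hb := @pair_affine_bound_le R be ga (A s - A 0) (g s - g 0) eta (ltW eta0).
  have {}hb : pair_affine_bound be ga (A s - A 0) (g s - g 0) 0 <= defect_const be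
    ga * eta ^+ 2.
    apply: hb.
      apply: (le_trans (LA (lexx 0) (ltW s0))); rewrite subr0.
      by apply: le_trans se; rewrite mulrC ler_pM2l // lerDl.
    apply/ltW/dP; rewrite s0 /=; lra.
  have e1 : eta <= 1 by rewrite ge_min lexx.
  have e2 : eta * (2 * defect_const be ga) <= e
    by rewrite -ler_pdivlMr // ge_min lexx orbT.
  have e3 : eta ^+ 2 <= eta by rewrite expr2 ler_piMr // ltW.
  have e4 : defect_const be ga * eta ^+ 2 <= defect_const be ga * eta
    by rewrite ler_pM2l.
  apply: (le_trans h); rewrite -/(defect_at 0) ph0 mulr0 add0r invr1.
  lra.
have J0 : pairs_norm2 (pospart (pair_affine be ga (A T) (g T) c)) = 0%E.
  apply/eqP; rewrite eq_le pairs_norm2_ge0 andbT -defectE lee_fin; exact: phT.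
have := pairs_norm2_eq0 (measurable_pospart (measurable_pair_affine _ _ _ _ _)) J0.
case=> N [mN N0 NP]; exists N; split => // p /= np; apply: NP => /= H;
  apply: np => tp.
by rewrite -(H tp) /pospart le_max lexx orbT.
Qed.

End flow_sign.

(** * The completed graph of a distribution function *)

Section Lam_Rint.
Context {R : realType}.
Local Notation RR := (measurableTypeR R).
Local Notation La := (@Lambda01 R).

Lemma Rintegral_ae_le (f g : RR -> R) : La.-integrable setT (EFin \o f) ->
  La.-integrable setT (EFin \o g) -> {ae @Lam R, forall s, f s <= g s} ->
  \int[La]_s f s <= \int[La]_s g s.
Proof.
move=> fi gi fg.
have mf : measurable_fun setT f by apply/measurable_EFinP; exact: measurable_int fi.
have mg : measurable_fun setT g by apply/measurable_EFinP; exact: measurable_int gi.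
rewrite -subr_ge0 -RintegralB //.
have -> : \int[La]_s (g s - f s) = \int[La]_s (Num.max 0 (g s - f s)).
  rewrite /Rintegral; congr fine; apply: ae_eq_integral => //.
  - by apply/measurable_EFinP; exact: measurable_funB.
  - by apply/measurable_EFinP; apply: measurable_maxr => //; exact: measurable_funB.
  - by apply: (Lam_aeS fg) => s _ h _; rewrite max_r // subr_ge0.
by apply: Rintegral_ge0 => s _; rewrite le_max lexx.
Qed.

Lemma Rintegral_ae_eq (f g : RR -> R) : measurable_fun setT f ->
  measurable_fun setT g ->
  {ae @Lam R, forall s, f s = g s} -> \int[La]_s f s = \int[La]_s g s.
Proof.
move=> mf mg fg; rewrite /Rintegral; congr fine; apply: ae_eq_integral => //.
- exact/measurable_EFinP.
- exact/measurable_EFinP.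
- by apply: (Lam_aeS fg) => s _ h _; rewrite h.
Qed.

Lemma Rintegral_ge0_eq0 (f : RR -> R) : La.-integrable setT (EFin \o f) ->
  (forall s, 0 <= f s) -> \int[La]_s f s <= 0 -> {ae @Lam R, forall s, f s = 0}.
Proof.
move=> fi f0 h.
have mf : measurable_fun setT (EFin \o f) by exact: measurable_int fi.
have e : (\int[La]_s `|(f s)%:E| = 0)%E.
  have -> : (\int[La]_s `|(f s)%:E| = \int[La]_s (f s)%:E)%E.
    by apply: eq_integral => s _; rewrite gee0_abs // lee_fin.
  rewrite -[LHS]fineK; last by apply: integrable_fin_num fi.
  congr EFin; apply/eqP; rewrite eq_le h /=.
  by rewrite fine_ge0 // integral_ge0 // => s _; rewrite lee_fin.
have /(ae_eq_integral_abs La measurableT mf) h3 := e.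
by apply: (Lam_aeS h3) => s _ /(_ I) [].
Qed.

(** The identity on ]0, 1[, made bounded so as to belong to L2. *)
Definition clip (s : R) : R := Num.max 0 (Num.min s 1).

Lemma clipE s : 0 < s < 1 -> clip s = s.
Proof. by case/andP => s0 s1; rewrite /clip min_l ?ltW // max_r // ltW. Qed.

Lemma measurable_clip : measurable_fun setT (clip : RR -> R).
Proof. by apply: measurable_maxr => //; exact: measurable_minr. Qed.

Lemma clip_bounds s : 0 <= clip s <= 1.
Proof. by rewrite /clip le_max lexx /= ge_max ler01 ge_min lexx orbT. Qed.

Lemma Rintegral_step (t0 a b : R) : 0 <= t0 <= 1 ->
  La.-integrable setT (EFin \o (fun t => if t <= t0 then a else b)) /\
  \int[La]_t (if t <= t0 then a else b) = a * t0 + b * (1 - t0).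
Proof.
move=> t01.
have mi : measurable (`]-oo, t0]%classic : set RR) by exact: measurable_itv.
have E t : (if t <= t0 then a else b) = (a - b) * \1_(`]-oo, t0]%classic) t + b.
  rewrite indicE; case: ifPn => h.
    by rewrite mem_set ?mulr1 ?subrK //= in_itv.
  by rewrite memNset ?mulr0 ?add0r //= in_itv /=; apply/negP.
have i1 : La.-integrable setT (EFin \o (\1_(`]-oo, t0]%classic) : RR -> R)).
  exact: (integrable_indic (@Lam R : {finite_measure set RR -> \bar R}) mi).
have i2 : La.-integrable setT (EFin \o (fun t : RR =>
  (a - b) * \1_(`]-oo, t0]%classic) t)).
  by have := integrableZl measurableT (a - b) i1; apply: eq_integrable.
have ib : La.-integrable setT (EFin \o (fun=> b : R)).
  exact: (finite_measure_integrable_cst (@Lam R : {finite_measure set RR -> \bar R})).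
have i3 : La.-integrable setT (EFin \o (fun t : RR =>
  (a - b) * \1_(`]-oo, t0]%classic) t + b)).
  by have := integrableD measurableT i2 ib; apply: eq_integrable.
split.
  by move: i3; apply: eq_integrable => // t _ /=; rewrite E.
rewrite (@eq_Rintegral _ _ _ La setT (fun t =>
  (a - b) * \1_(`]-oo, t0]%classic) t + b)); last by move=> t _; rewrite E.
rewrite RintegralD // RintegralZl // Rintegral_cst //.
have -> : \int[La]_x \1_(`]-oo, t0]%classic) x = t0.
  rewrite /Rintegral integral_indic // setIT.
  by rewrite [X in fine X](Lam_itvNy t01).
have -> : fine (La setT) = 1 by rewrite [X in fine X](Lam_setT R).
ring.
Qed.

End Lam_Rint.

Section qgraph.
Context {R : realType}.
Local Notation RR := (measurableTypeR R).
Local Notation La := (@Lambda01 R).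

(** For a quantile function [Q], this says that [rho] lies between the left
    limit and the value at [x] of the distribution function. It is phrased
    through [Q], so that bounds on the slopes of [Q] apply directly. *)
Definition qgraph (Q : R -> R) (x rho : R) := [/\ 0 <= rho, rho <= 1,
  (forall t, 0 < t < 1 -> t < rho -> Q t <= x) &
  (forall t, 0 < t < 1 -> rho < t -> x <= Q t)].

(** A level strictly between [r'] and [r] would have a quantile above [x'] and
    below [x]. *)
Lemma qgraph_mono Q x x' r r' : qgraph Q x r -> qgraph Q x' r' -> x < x' -> r <= r'.
Proof.
move=> [r0 r1 h1 h2] [r0' r1' h1' h2'] xx; rewrite leNgt; apply/negP => rr.
pose t := (r' + r) / 2.
have t01 : 0 < t < 1 by rewrite /t; lra.
have := h1 t t01; rewrite (_ : t < r) /t; last lra.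
have := h2' t t01; rewrite (_ : r' < t) /t; last lra.
by move=> /(_ isT) a /(_ isT) b; move: (lt_le_trans xx (le_trans a b)); rewrite ltxx.
Qed.

(** The quantiles of levels in ]r, r'[ lie in [[x, x']]. *)
Lemma qgraph_slope_ge Q (l : R) x x' r r' : 0 < l -> slope_ge setT l Q ->
  qgraph Q x r -> qgraph Q x' r' -> r < r' -> l * (r' - r) <= x' - x.
Proof.
move=> l0 Ql [r0 r1 h1 h2] [r0' r1' h1' h2'] rr.
apply/ler_addgt0Pr => e e0.
pose d := Num.min ((r' - r) / 4) (e / (2 * l)).
have d0 : 0 < d by rewrite lt_min !divr_gt0 ?subr_gt0 // mulr_gt0.
have d1 : d <= (r' - r) / 4 by rewrite ge_min lexx.
have d2 : d * (2 * l) <= e by rewrite -ler_pdivlMr ?mulr_gt0 // ge_min lexx orbT.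
have a1 : x <= Q (r + d) by apply: h2; lra.
have a2 : Q (r' - d) <= x' by apply: h1'; lra.
have a3 : l * (r' - d - (r + d)) <= Q (r' - d) - Q (r + d) by apply: Ql => //; lra.
nra.
Qed.

(** Levels just outside of [[r, r']] have quantiles outside of ]x, x'[. If [r
    = 0] or [r' = 1] there are none, and a level whose quantile is close to
    [a] or to [b] takes their place. *)
Lemma qgraph_slope_le Q (l a b : R) x x' r r' : 0 <= l -> slope_ge setT 0 Q ->
  slope_le setT l Q ->
  (forall e, 0 < e -> exists2 t, 0 < t < 1 & Q t < a + e) ->
  (forall e, 0 < e -> exists2 t, 0 < t < 1 & b - e < Q t) ->
  qgraph Q x r -> qgraph Q x' r' -> a <= x -> x < x' -> x' <= b ->
  x' - x <= l * (r' - r).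
Proof.
move=> l0 Q0 Ql Qa Qb g1 g2 ax xx xb.
have rr := qgraph_mono g1 g2 xx.
case: g1 g2 => [r0 r1 h1 h2] [r0' r1' h1' h2'].
apply/ler_addgt0Pr => e e0.
(* Displacing two levels and two values by [eta] costs at most [2 * (l + 1) *
   eta]. *)
pose eta := e / (2 * (l + 1)).
have l1 : 0 < l + 1 by rewrite ltr_wpDl.
have eta0 : 0 < eta by rewrite divr_gt0 // mulr_gt0.
have eta1 : eta * (2 * (l + 1)) = e by rewrite /eta divfK // lt0r_neq0 // mulr_gt0.
have [t [t01 tr Qt]] : exists t, [/\ 0 < t < 1, r - eta < t & Q t < x + eta].
  have [rp|rn] := ltP 0 r.
    exists (Num.max (r / 2) (r - eta / 2)); split.
    - by rewrite lt_max divr_gt0 //= gt_max; lra.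
    - by rewrite lt_max; apply/orP; right; lra.
    - apply: (@le_lt_trans _ _ x); last by rewrite ltrDl.
      apply: h1; first by rewrite lt_max divr_gt0 //= gt_max; lra.
      by rewrite gt_max; lra.
  have [t t01 Qt] := Qa _ eta0; exists t; split => //; last lra.
  by case/andP: t01 => ? ?; lra.
have [t' [t01' tr' Qt']] : exists t, [/\ 0 < t < 1, t < r' + eta & x' - eta < Q t].
  have [rp|rn] := ltP r' 1.
    exists (Num.min ((r' + 1) / 2) (r' + eta / 2)); split.
    - by rewrite gt_min lt_min; lra.
    - by rewrite gt_min; apply/orP; right; lra.
    - apply: (@lt_le_trans _ _ x'); first by rewrite ltrBlDr ltrDl.
      apply: h2'; first by rewrite gt_min lt_min; lra.
      by rewrite lt_min; lra.
  have [t' t01' Qt'] := Qb _ eta0; exists t'; split => //; last lra.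
  by case/andP: t01' => ? ?; lra.
have le_eta : eta <= e / 2.
  have : eta * l >= 0 by rewrite mulr_ge0 // ltW.
  nra.
have [tt|tt] := ltP t t'.
  have a3 : Q t' - Q t <= l * (t' - t) by apply: Ql => //; lra.
  have a4 : l * (t' - t) <= l * (r' - r + 2 * eta) by rewrite ler_wpM2l //; lra.
  nra.
have qq : Q t' <= Q t.
  move: tt; rewrite le_eqVlt => /predU1P[->//|tt].
  have := Q0 t' t; case/andP: t01' t01 => -> _ /andP[_ ->].
  by rewrite tt mul0r subr_ge0; apply.
have : 0 <= l * (r' - r) by rewrite mulr_ge0 // subr_ge0.
lra.
Qed.

End qgraph.

(** * The potential of a measure *)

Section subdifferential.
Context {R : realType} (nu : probability (measurableTypeR R) R).
Hypothesis nu2 : P2 nu.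
Local Notation RR := (measurableTypeR R).
Local Notation La := (@Lambda01 R).
Local Notation Q := (quantile nu).

(** The mean distance from [x] to a point distributed according to [nu]. *)
Definition potential (x : R) : R := \int[La]_t `|x - Q t|.

Lemma quantile_L2 : exists u : L2 R, u = Q :> (R -> R).
Proof.
by apply: ex_L2; [exact: quantile_measurable|rewrite quantile_sq].
Qed.

Lemma integrable_dist_quantile x : La.-integrable setT (EFin \o (fun t =>
  `|x - Q t|)).
Proof.
have [q qE] := quantile_L2.
have [cx cE] : exists u : L2 R, u = cst x :> (R -> R).
  by apply: (@ex_L2_bounded _ _ `|x|).
have := integrable_norm (integrable_L2 (cx - q)).
by apply: eq_integrable => // t _; rewrite /comp L2subE cE qE.
Qed.

Lemma potential_step x y t0 a b : 0 <= t0 <= 1 ->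
  (forall t, 0 < t < 1 -> t < t0 -> `|y - Q t| - `|x - Q t| <= a) ->
  (forall t, 0 < t < 1 -> t0 < t -> `|y - Q t| - `|x - Q t| <= b) ->
  potential y - potential x <= a * t0 + b * (1 - t0).
Proof.
move=> t01 Ha Hb; have [hi <-] := Rintegral_step a b t01.
rewrite /potential -RintegralB //; try exact: integrable_dist_quantile.
apply: Rintegral_ae_le => //.
  by have := integrableB measurableT (integrable_dist_quantile y)
    (integrable_dist_quantile x); apply: eq_integrable.
apply: (Lam_aeS (Lam_countable (countable1 t0))) => t tt /= tt0.
have [h|h|h] := ltgtP t t0; [exact: Ha|exact: Hb|exact: (False_ind _ (tt0 h))].
Qed.

Lemma potential_lip x y : potential y - potential x <= `|y - x|.
Proof.
have t1 : 0 <= (1 : R) <= 1 by rewrite ler01 lexx.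
have h (t : R) : `|y - Q t| - `|x - Q t| <= `|y - x|.
  by apply: (le_trans (lerB_dist _ _)); rewrite opprB addrA subrK.
have := potential_step (x := x) (y := y) t1 (fun t _ _ => h t) (fun t _ _ => h t).
by rewrite subrr mulr0 addr0 mulr1.
Qed.

Lemma potential_continuous : continuous potential.
Proof.
move=> x; apply/cvgrPdist_lt => e e0; exists e => //= y; apply: le_lt_trans.
by rewrite ler_norml potential_lip andbT lerNl opprB distrC potential_lip.
Qed.

Lemma potential_convex x y r : 0 <= r -> r <= 1 ->
  potential (x + r * (y - x)) <= potential x + r * (potential y - potential x).
Proof.
move=> r0 r1.
have i1 := integrable_dist_quantile x; have i2 := integrable_dist_quantile y.
have -> : potential x + r * (potential y - potential x) = \int[La]_t ((1 - r) * `|x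
  - Q t| + r * `|y - Q t|).
  rewrite RintegralD //; last first.
  - by have := integrableZl measurableT r i2; apply: eq_integrable.
  - by have := integrableZl measurableT (1 - r) i1; apply: eq_integrable.
  by rewrite !RintegralZl // -/(potential x) -/(potential y); ring.
apply: le_Rintegral => //.
- exact: integrable_dist_quantile.
- have h1 := integrableZl measurableT (1 - r) i1;
  have h2 := integrableZl measurableT r i2.
  by have := integrableD measurableT h1 h2; apply: eq_integrable.
move=> t _.
rewrite (_ : x + r * (y - x) - Q t = (1 - r) * (x - Q t) + r * (y - Q t));
  last by ring.
apply: (le_trans (ler_normD _ _)); rewrite !normrM (ger0_norm r0) ger0_norm //.
by rewrite subr_ge0.
Qed.

(** Moving from [x] to [Q t] changes the distance to the quantiles on each
    side of [t] in a known way; comparing the mean change with [sigma] locates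
    [t] with respect to [(sigma + 1) / 2]. Conversely the quantiles of the
    levels below [rho] are at most [x] and those above are at least [x]. *)
Lemma potential_subgradientP x sigma :
  (forall y, potential x + sigma * (y - x) <= potential y) <-> qgraph Q x ((sigma +
    1) / 2).
Proof.
have Qnd s t : 0 < s < 1 -> 0 < t < 1 -> s <= t -> Q s <= Q t by exact: quantile_nd.
split=> [H|[r0 r1 h1 h2] y].
  have s1 : sigma <= 1.
    have := H (x + 1); have := potential_lip x (x + 1).
    by rewrite addrAC subrr add0r normr1 mulr1; lra.
  have s2 : -1 <= sigma.
    have := H (x - 1); have := potential_lip x (x - 1).
    by rewrite addrAC subrr add0r normrN normr1 mulrN1; lra.
  split; [lra|lra| |] => t t01 tr; rewrite leNgt; apply/negP => Qx.
    have t01' : 0 <= t <= 1 by case/andP: t01 => *; rewrite !ltW.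
    have h := @potential_step x (Q t) t (Q t - x) (- (Q t - x)) t01'.
    have {}h : potential (Q t) - potential x <= (Q t - x) * t + - (Q t - x) * (1 - t).
      apply: h => s s01 st.
        apply: (le_trans (lerB_dist _ _)); rewrite opprB addrA subrK.
        by rewrite gtr0_norm // subr_gt0.
      have := Qnd _ _ t01 s01 (ltW st) => Qs.
      rewrite !ler0_norm ?subr_le0 //; last by rewrite (le_trans (ltW Qx)).
      by rewrite !opprB; lra.
    have := H (Q t); have : 0 < Q t - x by rewrite subr_gt0.
    nra.
  have t01' : 0 <= t <= 1 by case/andP: t01 => *; rewrite !ltW.
  have h := @potential_step x (Q t) t (- (x - Q t)) (x - Q t) t01'.
  have {}h : potential (Q t) - potential x <= - (x - Q t) * t + (x - Q t) * (1 - t).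
    apply: h => s s01 st.
      have := Qnd _ _ s01 t01 (ltW st) => Qs.
      rewrite !ger0_norm ?subr_ge0 //; last by rewrite (le_trans Qs) // ltW.
      lra.
    apply: (le_trans (lerB_dist _ _)); rewrite opprB addrA subrK.
    by rewrite ltr0_norm ?opprB // subr_lt0.
  have := H (Q t); have : 0 < x - Q t by rewrite subr_gt0.
  nra.
set r := (sigma + 1) / 2 in r0 r1 h1 h2.
have r01 : 0 <= r <= 1 by rewrite r0.
have [yx|xy] := ltP y x.
  have h : potential x - potential y <= (x - y) * r + - (x - y) * (1 - r).
    apply: potential_step => // s s01 sr.
      apply: (le_trans (lerB_dist _ _)); rewrite opprB addrA subrK.
      by rewrite gtr0_norm // subr_gt0.
    have := h2 _ s01 sr => Qs.
    by rewrite !ler0_norm ?subr_le0 // ?opprB; [lra|apply: (le_trans (ltW yx))].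
  have : sigma = 2 * r - 1 by rewrite /r; field.
  move=> ->; nra.
have h : potential x - potential y <= - (y - x) * r + (y - x) * (1 - r).
  apply: potential_step => // s s01 sr.
    have := h1 _ s01 sr => Qs.
    by rewrite !ger0_norm ?subr_ge0 //; [lra|apply: le_trans xy].
  apply: (le_trans (lerB_dist _ _)); rewrite opprB addrA subrK.
  by rewrite ler0_norm ?subr_le0 // opprB.
have : sigma = 2 * r - 1 by rewrite /r; field.
move=> ->; nra.
Qed.

End subdifferential.

(** * The subdifferential of the functional *)

Section Fnu_subdifferential.
Context {R : realType} (nu : probability (measurableTypeR R) R).
Hypothesis nu2 : P2 nu.
Local Notation RR := (measurableTypeR R).
Local Notation La := (@Lambda01 R).
Local Notation Q := (quantile nu).
Local Notation potential := (potential nu).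

(** Equal to [1 - 2 * s] on ]0, 1[, and bounded. *)
Definition weight (s : R) : R := 1 - 2 * clip s.

Lemma weightE s : 0 < s < 1 -> weight s = 1 - 2 * s.
Proof. by move=> h; rewrite /weight clipE. Qed.

Lemma measurable_weight : measurable_fun setT (weight : RR -> R).
Proof. by apply: measurable_funB => //; apply: measurable_funM => //;
  exact: measurable_clip. Qed.

Lemma ex_L2_weight : exists u : L2 R, u = weight :> (R -> R).
Proof.
apply: (@ex_L2_bounded _ _ 1); first exact: measurable_weight.
by move=> s; have := clip_bounds s; rewrite ler_norml /weight; lra.
Qed.

Lemma measurable_potential : measurable_fun setT (potential : RR -> R).
Proof. by apply: continuous_measurable_fun; exact: potential_continuous. Qed.

Lemma integrable_potential_comp (u : L2 R) : La.-integrable setT (EFin \o (fun s =>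
  potential (u s))).
Proof.
have [c cE] : exists u : L2 R, u = cst (potential 0) :> (R -> R).
  by apply: (@ex_L2_bounded _ _ `|potential 0|).
have i1 := integrable_norm (integrable_L2 u);
  have i2 := integrable_norm (integrable_L2 c).
apply: (le_integrable measurableT _ _ (integrableD measurableT i1 i2)).
  by apply/measurable_EFinP; apply: (measurableT_comp measurable_potential);
    exact: measurable_L2.
move=> s _; rewrite /= lee_fin cE /=.
have h1 := potential_lip nu2 0 (u s); have h2 := potential_lip nu2 (u s) 0.
rewrite subr0 in h1; rewrite sub0r normrN in h2.
rewrite [leRHS]ger0_norm ?addr_ge0 // ler_norml.
have := ler_norm (potential 0); have := ler_norm (- potential 0); rewrite normrN.
lra.
Qed.

Definition density (u : R -> R) (s : R) : R := weight s * u s + potential (u s).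

Lemma measurable_density (u : L2 R) : measurable_fun setT (density u : RR -> R).
Proof.
apply: measurable_funD.
  by apply: measurable_funM; [exact: measurable_weight|exact: measurable_L2].
by apply: (measurableT_comp measurable_potential); exact: measurable_L2.
Qed.

Lemma integrable_density (u : L2 R) : La.-integrable setT (EFin \o (density u)).
Proof.
have [e eE] := ex_L2_weight.
have := integrableD measurableT (integrable_L2M e u) (integrable_potential_comp u).
by apply: eq_integrable => // s _ /=; rewrite eE.
Qed.

Lemma Fnu_density (u : L2 R) : Fnu nu u = \int[La]_s density u s.
Proof.
rewrite /Fnu; apply: Rintegral_ae_eq.
- apply: measurable_funD; last by apply: (measurableT_comp measurable_potential);
  exact: measurable_L2.
  apply: measurable_funM; last exact: measurable_L2.
  by apply: measurable_funB => //; exact: measurable_funM.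
- exact: measurable_density.
- by apply: (Lam_aeS (@Lam_ae01 R)) => s s01 _; rewrite /density weightE.
Qed.

Definition pointwise_subgradient (u v : L2 R) : Prop :=
  {ae @Lam R, forall s, forall y,
    density u s + v s * (y - u s) <= weight s * y + potential y}.

(** Let [B] be the set where the inequality fails, and move [u] on [B] by the
    fraction [r] of the way to [y]. By convexity the functional changes by at
    most [r] times the change of its density on [B], so the strict failure on
    [B] would contradict the subgradient inequality unless [B] is null. *)
Lemma subdiff_at (u v : L2 R) (y : R) : subdiff (Fnu nu) u v ->
  {ae @Lam R, forall s, density u s + v s * (y - u s) <= weight s * y + potential y}.
Proof.
move=> H.
pose f s := density u s + v s * (y - u s) - (weight s * y + potential y).
have mu := measurable_L2 u; have mv := measurable_L2 v.
have mf : measurable_fun setT (f : RR -> R).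
  apply: measurable_funB.
    apply: measurable_funD; first exact: measurable_density.
    by apply: measurable_funM => //; exact: measurable_funB.
  by apply: measurable_funD => //; apply: measurable_funM => //;
    exact: measurable_weight.
pose B : set RR := [set s | 0 < f s].
have mB : measurable B.
  rewrite (_ : B = f @^-1` `]0, +oo[%classic).
    by rewrite -[X in measurable X]setTI; apply: mf.
  by apply/seteqP; split => s; rewrite /B /= in_itv /= andbT.
have mI : measurable_fun setT (\1_B : RR -> R) by exact: measurable_indic.
have I01 s : 0 <= (\1_B s : R) <= 1 by rewrite indicE; case: (_ \in _);
  rewrite ?lexx ?ler01.
have [b bE] : exists b : L2 R, b = (fun s => \1_B s * (y - u s)) :> (R -> R).
  have [c cE] : exists c : L2 R, c = cst y :> (R ->
    R) by apply: (@ex_L2_bounded _ _ `|y|).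
  apply: ex_L2.
    by apply: measurable_funM => //; exact: measurable_funB.
  apply: le_lt_trans (L2_sq_lty (c - u)); apply: ge0_le_integral => //.
  - by move=> s _; rewrite lee_fin sqr_ge0.
  - apply/measurable_EFinP; apply: measurable_funX; apply: measurable_funM => //.
    exact: measurable_funB.
  - by apply/measurable_EFinP; apply: measurable_funX; exact: measurable_L2.
  - move=> s _; rewrite lee_fin L2subE cE exprMn ler_piMl ?sqr_ge0 //.
have [c cE] : exists c : L2 R, c = cst y :> (R ->
  R) by apply: (@ex_L2_bounded _ _ `|y|).
pose P s := \1_B s * f s.
have P0 s : 0 <= P s.
  rewrite /P indicE; case: (boolP (s \in B)) => [/set_mem h|_]; last by rewrite mul0r.
  by rewrite mul1r ltW.
pose V s := v s * b s.
pose D s := \1_B s * (weight s * y + potential y - density u s).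
have PE s : P s = V s - D s.
  by rewrite /P /V /D bE /f; ring.
have Vi : La.-integrable setT (EFin \o V) by exact: integrable_L2M.
have Di : La.-integrable setT (EFin \o D).
  have h1 := integrable_density c;
    have h2 := integrableB measurableT h1 (integrable_density u).
  apply: (le_integrable measurableT _ _ h2).
    apply/measurable_EFinP; apply: measurable_funM => //; apply: measurable_funB;
      last exact: measurable_density.
    by apply: measurable_funD => //; apply: measurable_funM => //;
      exact: measurable_weight.
  move=> s _; rewrite /= lee_fin /D /density cE /= normrM.
  by case/andP: (I01 s) => h3 h4; rewrite (ger0_norm h3) ler_piMl.
have Pi : La.-integrable setT (EFin \o P).
  by have := integrableB measurableT Vi Di; apply: eq_integrable => // s _ /=;
    rewrite PE.
suff IP : \int[La]_s P s <= 0.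
  apply: (Lam_aeS (Rintegral_ge0_eq0 Pi P0 IP)) => s s01 Ps.
  rewrite leNgt; apply/negP => h.
  have fs : 0 < f s by rewrite subr_gt0.
  move: Ps; rewrite /P indicE mem_set // mul1r => e; move: fs; rewrite e ltxx //.
have -> : \int[La]_s P s = \int[La]_s V s - \int[La]_s D s.
  by rewrite -RintegralB //; apply: eq_Rintegral => s _; rewrite PE.
have nb1 : 0 < L2norm b + 1 by rewrite ltr_wpDl // L2norm_ge0.
apply/ler_addgt0Pr => e' e'0; rewrite add0r.
have [d d0 dP] := H _ (divr_gt0 e'0 nb1).
pose r := Num.min 1 (d / (2 * (L2norm b + 1))).
have r0 : 0 < r by rewrite lt_min ltr01 divr_gt0 // mulr_gt0.
have r1 : r <= 1 by rewrite ge_min lexx.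
have rd : r * L2norm b < d.
  have h1 : r * (2 * (L2norm b + 1)) <= d
    by rewrite -ler_pdivlMr ?mulr_gt0 // ge_min lexx orbT.
  have := L2norm_ge0 b; nra.
have wE : u + r *: b - u = r *: b by rewrite addrAC subrr add0r.
have := dP (u + r *: b); rewrite wE L2normZ (gtr0_norm r0) => /(_ rd).
have -> : inner v (r *: b) = r * \int[La]_s V s.
  rewrite /inner -RintegralZl //; apply: eq_Rintegral => s _.
  by rewrite L2scaleE /V; ring.
have Fle : Fnu nu (u + r *: b) <= Fnu nu u + r * \int[La]_s D s.
  rewrite !Fnu_density -RintegralZl // -RintegralD //; first last.
  - by have := integrableZl measurableT r Di; apply: eq_integrable.
  - exact: integrable_density.
  apply: le_Rintegral => //; first exact: integrable_density.
    have h1 := integrableD measurableT (integrable_density u) (integrableZl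
      measurableT r Di).
    by move: h1; apply: eq_integrable.
  move=> s _; rewrite /density L2addE L2scaleE bE /D indicE.
  case: (s \in B); last by rewrite !mul0r !mulr0 !addr0.
  rewrite !mul1r.
  have := potential_convex nu2 (u s) y (ltW r0) r1; rewrite /density; lra.
have h1 : e' / (L2norm b + 1) * (r * L2norm b) <= r * e'.
  rewrite mulrCA ler_pM2l // mulrAC ler_pdivrMr // ler_pM2l // lerDl //.
move=> h2.
have h3 : r * (\int[La]_s V s - \int[La]_s D s) <= r * e' by rewrite mulrBr; lra.
by move: h3; rewrite ler_pM2l.
Qed.

(** Both sides are continuous in [y], so rational [y] suffice. *)
Lemma subdiff_pointwise (u v : L2 R) : subdiff (Fnu nu) u v ->
  pointwise_subgradient u v.
Proof.
move=> H.
pose P n s := if (unpickle n : option rat) is Some q then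
  density u s + v s * (ratr q - u s) <= weight s * ratr q + potential (ratr q) else
    true.
have [N [mN N0 NP]] : {ae @Lam R, forall s, forall n, P n s}.
  apply: ae_foralln => n; rewrite /P; case: unpickle => [q|]; last exact: aeW.
  exact: subdiff_at.
exists N; split => // s /= ns; apply: NP => /= Hs; apply: ns => y.
have HQ (q : rat) : density u s + v s * (ratr q - u s) <= weight s * ratr q +
  potential (ratr q).
  by have := Hs (pickle q); rewrite /P pickleK.
apply/ler_addgt0Pr => e e0.
pose K := `|v s| + `|weight s| + 1.
have K0 : 0 < K by rewrite ltr_wpDl // addr_ge0.
have /rat_in_itvoo[q] : y < y + e / K by rewrite ltrDl divr_gt0.
rewrite in_itv /= => /andP[q1 q2].
have := HQ q; set z : R := ratr q in q1 q2 *.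
have h0 : 0 < z - y by rewrite subr_gt0.
have h1 : (z - y) * K < e by rewrite -ltr_pdivlMr //; lra.
have h2 := potential_lip nu2 y z; rewrite (gtr0_norm h0) in h2.
have h3 : - (v s * (z - y)) <= (z - y) * `|v s|.
  by rewrite -mulNr mulrC ler_pM2l // -normrN ler_norm.
have h4 : weight s * (z - y) <= (z - y) * `|weight s|.
  by rewrite mulrC ler_pM2l // ler_norm.
have h5 : (z - y) * K = (z - y) * `|v s| + (z - y) * `|weight s| + (z - y)
  by rewrite /K; ring.
lra.
Qed.

Lemma pointwise_subdiff (u v : L2 R) : pointwise_subgradient u v ->
  subdiff (Fnu nu) u v.
Proof.
move=> H e e0; exists 1 => // w _.
apply: (@le_trans _ _ (Fnu nu u + inner v (w - u))).
  by rewrite gerBl mulr_ge0 ?(ltW e0) // L2norm_ge0.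
have vi := integrable_L2M v (w - u).
rewrite !Fnu_density /inner -RintegralD //; last exact: integrable_density.
apply: Rintegral_ae_le.
- by have := integrableD measurableT (integrable_density u) vi; apply: eq_integrable.
- exact: integrable_density.
- by apply: (Lam_aeS H) => s _ /(_ (w s)); rewrite L2subE.
Qed.

Lemma pointwise_qgraph (u v : L2 R) : pointwise_subgradient u v <->
  {ae @Lam R, forall s, qgraph Q (u s) (v s / 2 + s)}.
Proof.
have e (s : R) : 0 < s < 1 -> (v s - weight s + 1) / 2 = v s / 2 + s.
  by move=> s01; rewrite weightE //; field.
split=> H; apply: (Lam_aeS H) => s s01 h.
  rewrite -e //; apply/potential_subgradientP => // y.
  by have := h y; rewrite /density; lra.
move=> y; have /(potential_subgradientP nu2) h2 :
  qgraph Q (u s) ((v s - weight s + 1) / 2) by rewrite e.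
by have := h2 y; rewrite /density; lra.
Qed.

(** With it the inclusions satisfied by the flow and by the resolvent become
    scalar ones. *)
Lemma subdiff_qgraph (u v : L2 R) : subdiff (Fnu nu) u v <->
  {ae @Lam R, forall s, qgraph Q (u s) (v s / 2 + s)}.
Proof.
split=> [/subdiff_pointwise/pointwise_qgraph //|/pointwise_qgraph];
  exact: pointwise_subdiff.
Qed.

End Fnu_subdifferential.

(** * Slopes and bounds along the resolvent *)

Section support_facts.
Context {R : realType}.
Implicit Types mu nu : probability (measurableTypeR R) R.

Lemma quantile_near_supp nu x : supp nu x -> forall e, 0 < e ->
  (exists2 t, 0 < t < 1 & quantile nu t < x + e) /\
  (exists2 t, 0 < t < 1 & x - e < quantile nu t).
Proof.
move=> sx e e0.
have pos_point (U : set R) : open U -> U x ->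
  exists2 t, 0 < t < 1 & U (quantile nu t).
  move=> oU Ux; have := sx U oU Ux.
  rewrite -(Lam_quantile nu) ?Lam_lebesgue; last exact: open_measurable.
  move=> h; apply: contrapT => H; move: h.
  rewrite (_ : _ `&` _ = set0) ?measure0 ?ltxx //.
  apply/seteqP; split => // t [Ut /=]; rewrite in_itv /= => t01.
  by apply: H; exists t.
split.
  have oU : open (`]-oo, x + e[%classic : set R) by exact: interval_open.
  have [|t t01] := pos_point _ oU; first by rewrite /= in_itv /= ltrDl.
  by rewrite /= in_itv /=; exists t.
have oU : open (`]x - e, +oo[%classic : set R) by exact: interval_open.
have [|t t01] := pos_point _ oU; first by rewrite /= in_itv /= andbT ltrBlDr ltrDl.
by rewrite /= in_itv /= andbT; exists t.
Qed.

Lemma supp_neq0 nu : supp nu !=set0.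
Proof.
apply: contrapT => H.
have := supp_null nu; rewrite (_ : ~` supp nu = setT); last first.
  by apply/seteqP; split => // x _ sx; apply: H; exists x.
move=> /negligibleP => /(_ measurableT) h.
have := @probability_setT _ _ _ nu; rewrite h => /eqP.
by rewrite eqe eq_sym oner_eq0.
Qed.

Lemma Dminus_quantile L nu : Dminus L (quantile nu) -> slope_ge setT L (quantile nu).
Proof.
move=> /DminusE[mu [_ e sl]].
have e' : forall s, 0 < s < 1 -> quantile nu s = quantile mu s.
  by apply: (@quantile_ae_unique R nu mu (quantile nu)) => //; exact: aeW.
exact/(@eq_slope_ge R L _ _ e').
Qed.

Lemma Dplus_quantile L nu : Dplus L (quantile nu) -> slope_le setT L (quantile nu).
Proof.
move=> /DplusE[mu [_ e sl]].
have e' : forall s, 0 < s < 1 -> quantile nu s = quantile mu s.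
  by apply: (@quantile_ae_unique R nu mu (quantile nu)) => //; exact: aeW.
exact/(@eq_slope_le R L _ _ e').
Qed.

Lemma Dab_bounds a b (u : R -> R) : Dab a b u -> {ae @Lam R, forall s, a <= u s <= b}.
Proof.
move=> [mu [_ e sm]]; apply: (Lam_aeS e) => s s01 /(_ I) ->.
exact: supp_quantile.
Qed.

Lemma monotone_Dminus (u : L2 R) (E : set R) L : 0 <= L ->
  {ae @Lam R, forall s, E s} -> slope_ge E L u -> Dminus L u.
Proof.
move=> L0 Eae H.
have [mu [p2 e h _ _]] := monotone_class Eae (slope_ge_le L0 H).
by apply/DminusE; exists mu; split => //; exact: h.
Qed.

Lemma monotone_Dplus (u : L2 R) (E : set R) L a b : 0 <= L ->
  {ae @Lam R, forall s, E s} -> slope_ge E 0 u -> slope_le E L u ->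
  {ae @Lam R, forall s, a <= u s <= b} -> (Dab a b `&` Dplus L) u.
Proof.
move=> L0 Eae H0 H Hab.
have [mu [p2 e _ h hs]] := monotone_class Eae H0.
split; first by exists mu; split => //; exact: hs.
by apply/DplusE; exists mu; split => //; exact: h.
Qed.

End support_facts.

Section qgraph_extra.
Context {R : realType}.

Lemma qgraph_above (Q : R -> R) x rho : (forall t, 0 < t < 1 -> Q t < x) ->
  qgraph Q x rho -> rho = 1.
Proof.
move=> H [r0 r1 _ h2]; apply/eqP; rewrite eq_le r1 leNgt; apply/negP => r.
pose t := (rho + 1) / 2.
have t01 : 0 < t < 1 by rewrite /t; lra.
have := h2 t t01; rewrite (_ : rho < t) /t; last lra.
by move=> /(_ isT); rewrite leNgt H.
Qed.

Lemma qgraph_below (Q : R -> R) x rho : (forall t, 0 < t < 1 -> x < Q t) ->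
  qgraph Q x rho -> rho = 0.
Proof.
move=> H [r0 r1 h1 _]; apply/eqP; rewrite eq_le r0 andbT leNgt; apply/negP => r.
pose t := rho / 2.
have t01 : 0 < t < 1 by rewrite /t; lra.
have := h1 t t01; rewrite (_ : t < rho) /t; last lra.
by move=> /(_ isT); rewrite leNgt H.
Qed.

End qgraph_extra.

Section resolvent.
Context {R : realType} (nu : probability (measurableTypeR R) R) (eps : R).
Hypothesis nu2 : P2 nu.
Hypothesis eps0 : 0 < eps.
Local Notation RR := (measurableTypeR R).
Local Notation Q := (quantile nu).

Definition sublevel (y : R) : set R :=
  [set r | r = 0 \/ 0 < r < 1 /\ Q r + 2 * eps * r <= y].
(** The generalized inverse of the strictly increasing function [Q r + 2 * eps
    * r]: with [rho] its value at [y], the point [(y - 2 * eps * rho, rho)]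
    lies on the completed graph. *)
Definition level (y : R) : R := sup (sublevel y).

Lemma has_sup_sublevel y : has_sup (sublevel y).
Proof.
split; first by exists 0; left.
by exists 1 => r [->|[/andP[_ /ltW]]].
Qed.

Lemma level_bounds y : 0 <= level y <= 1.
Proof.
apply/andP; split; first by apply: (sup_upper_bound (has_sup_sublevel y)); left.
apply: ge_sup; first by case: (has_sup_sublevel y).
by move=> r [->|[/andP[_ /ltW]]].
Qed.

Lemma level_nondecreasing : {homo level : x y / x <= y}.
Proof.
move=> x y xy; apply: ge_sup; first by case: (has_sup_sublevel x).
move=> r [->|[r01 h]]; first by case/andP: (level_bounds y).
by apply: (sup_upper_bound (has_sup_sublevel y)); right; split => //;
  exact: le_trans xy.
Qed.

Lemma level_qgraph y : qgraph Q (y - 2 * eps * level y) (level y).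
Proof.
have /andP[r0 r1] := level_bounds y.
have e2 : 0 < 2 * eps by rewrite mulr_gt0.
split => // t t01 tr.
- apply/ler_addgt0Pr => e e0.
  pose d := Num.min (level y - t) (e / (2 * eps)).
  have d0 : 0 < d by rewrite lt_min subr_gt0 tr divr_gt0.
  have d1 : d <= level y - t by rewrite ge_min lexx.
  have d2 : d * (2 * eps) <= e by rewrite -ler_pdivlMr // ge_min lexx orbT.
  have [t' [t0|[t01' Qt']] dt'] := sup_adherent d0 (has_sup_sublevel y).
    by move: dt'; rewrite t0 -/(level y); case/andP: t01 => ? _; lra.
  rewrite -/(level y) in dt'.
  have tt : t <= t' by lra.
  have Qtt : Q t <= Q t' by exact: quantile_nd.
  have : 2 * eps * (level y - t') <= 2 * eps * d by rewrite ler_pM2l //; lra.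
  rewrite mulrBr; lra.
- apply/ler_addgt0Pr => e e0.
  pose d := Num.min (t - level y) (e / (2 * eps)).
  have d0 : 0 < d by rewrite lt_min subr_gt0 tr divr_gt0.
  have d1 : d <= t - level y by rewrite ge_min lexx.
  have d2 : d * (2 * eps) <= e by rewrite -ler_pdivlMr // ge_min lexx orbT.
  pose t' := level y + d / 2.
  have /andP[t0 t1] := t01.
  have t01' : 0 < t' < 1 by rewrite /t'; lra.
  have Qt' : y < Q t' + 2 * eps * t'.
    rewrite ltNge; apply/negP => h.
    have : t' <= level y by apply: (sup_upper_bound (has_sup_sublevel y)); right.
    by rewrite /t'; lra.
  have Qtt : Q t' <= Q t by apply: quantile_nd => //; rewrite /t'; lra.
  have : 2 * eps * (t' - level y) <= 2 * eps * d by rewrite ler_pM2l // /t'; lra.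
  rewrite mulrBr; lra.
Qed.

(** Take [w s = y - 2 * eps * level y] at [y = u s + 2 * eps * s]. It differs
    from [u] by a bounded function, measurable because [level] is monotone. *)
Lemma resolvent_neq0 (u : L2 R) : resolvent (Fnu nu) eps u !=set0.
Proof.
have mrho : measurable_fun setT (level : RR -> R).
  by apply: nondecreasing_measurable => //; exact: level_nondecreasing.
pose yf s := u s + 2 * eps * clip s.
have my : measurable_fun setT (yf : RR -> R).
  by apply: measurable_funD; [exact: measurable_L2|apply: measurable_funM => //;
    exact: measurable_clip].
have [v vE] : exists v : L2 R, v = (fun s => 2 * (level (yf s) - clip s)) :> (R -> R).
  apply: (@ex_L2_bounded _ _ 2).
    apply: measurable_funM => //; apply: measurable_funB; last exact: measurable_clip.
    exact: (measurableT_comp mrho).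
  move=> s; have := level_bounds (yf s); have := clip_bounds s.
  by rewrite ler_norml; lra.
exists (u - eps *: v); exists v; last first.
  by apply: aeW => s _; rewrite L2addE L2subE subrK.
apply/subdiff_qgraph => //.
apply: (Lam_aeS (@Lam_ae01 R)) => s s01 _.
rewrite L2subE L2scaleE vE.
have := level_qgraph (yf s); rewrite /yf clipE //.
set y := u s + _; rewrite (_ : 2 * _ / 2 + s = level y); last by field.
by rewrite (_ : u s - _ = y - 2 * eps * level y) // /y; ring.
Qed.

Lemma resolvent_ae (u w : L2 R) : resolvent (Fnu nu) eps u w ->
  exists r : R -> R, {ae @Lam R, forall s, qgraph Q (w s) (r s) /\
    u s + 2 * eps * s = w s + 2 * eps * r s}.
Proof.
move=> [v /(subdiff_qgraph nu2) H1 H2]; exists (fun s => v s / 2 + s).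
apply: (Lam_aeS (Lam_aeI H1 H2)) => s s01 [h1 h2]; split => //.
by rewrite h2 // L2addE L2scaleE; field.
Qed.

(** Subtract the equations at [s] and [t], with [W], [U], [P] the differences
    of [w], [u] and of the levels: [U + 2 * eps * (t - s) = W + 2 * eps * P].
    Here [L * P <= W] when [P] is positive, so [(1 + 2 * eps / L) * W >= (L +
    2 * eps) * (t - s)]. *)
Lemma resolvent_Dminus L : 0 < L -> slope_ge setT L Q ->
  maps_into_itself (resolvent (Fnu nu) eps) (Dminus L).
Proof.
move=> L0 QL u /DminusE[mu [mu2 umu sl]]; split; first exact: resolvent_neq0.
move=> w /resolvent_ae[r hr].
pose E := [set s | (qgraph Q (w s) (r s) /\ u s + 2 * eps * s = w s + 2 * eps * r
  s) /\
  u s = quantile mu s].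
apply: (@monotone_Dminus _ _ E) => //; first exact: ltW.
  by apply: (Lam_aeS (Lam_aeI hr umu)) => s _ [h1 h2]; split => //; exact: h2.
move=> s t s0 st t1 [[g1 e1] u1] [[g2 e2] u2].
have h := sl s t s0 st t1 I I; rewrite -u1 -u2 in h.
have ts : 0 < t - s by rewrite subr_gt0.
have [rr|rr] := leP (r t) (r s).
  have : 2 * eps * (r s - r t) >= 0 by rewrite mulr_ge0 ?mulr_ge0 ?subr_ge0 // ltW.
  have : 2 * eps * (t - s) >= 0 by rewrite mulr_ge0 ?mulr_ge0 // ltW.
  rewrite !mulrBr; lra.
have h2 := qgraph_slope_ge L0 QL g1 g2 rr.
have h3 : (L + 2 * eps) * (L * (t - s)) <= (L + 2 * eps) * (w t - w s).
  have : L * (u t - u s + 2 * eps * (t - s)) = L * (w t - w s) + 2 * eps * (L * (r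
    t - r s)).
    rewrite (_ : u t - u s + 2 * eps * (t - s) = (u t + 2 * eps * t) - (u s + 2 *
      eps * s)); last by ring.
    by rewrite e1 e2; ring.
  have : 2 * eps * (L * (r t - r s)) <= 2 * eps * (w t - w s)
    by rewrite ler_pM2l // mulr_gt0.
  have : L * (L * (t - s)) <= L * (u t - u s) by rewrite ler_pM2l.
  lra.
by move: h3; rewrite ler_pM2l // addr_gt0 // mulr_gt0.
Qed.

(** As for lower slopes, with [W <= L * P] when [W] is positive. This holds
    between [a] and [b] only, and [w] stays there because outside the level is
    0 or 1. *)
Lemma resolvent_Dplus L a b : 0 < L -> slope_le setT L Q ->
  supp nu = `[a, b]%classic ->
  maps_into_itself (resolvent (Fnu nu) eps) (Dab a b `&` Dplus L).
Proof.
move=> L0 QL snu u [uab /DplusE[mu [mu2 umu sl]]]; split; first exact: resolvent_neq0.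
have [x0 sx0] := supp_neq0 nu.
have ab : a <= b by move: sx0; rewrite snu /= in_itv /= => /andP[]; exact: le_trans.
have sa : supp nu a by rewrite snu /= in_itv /= lexx.
have sb : supp nu b by rewrite snu /= in_itv /= lexx andbT.
have Qa e (e0 : 0 < e) := (quantile_near_supp sa e0).1.
have Qb e (e0 : 0 < e) := (quantile_near_supp sb e0).2.
have Qab : forall s, 0 < s < 1 -> a <= Q s <= b by apply: supp_quantile; rewrite snu.
have Q0 : slope_ge setT 0 Q by exact: quantile_slope0.
have e2 : 0 < 2 * eps by rewrite mulr_gt0.
move=> w /resolvent_ae[r hr].
have wab : {ae @Lam R, forall s, a <= w s <= b}.
  apply: (Lam_aeS (Lam_aeI hr (Dab_bounds uab))) =>
    s /andP[s0 s1] [[g1 e1] /andP[ua ub]].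
  apply/andP; split; rewrite leNgt; apply/negP => h.
    have r1 : r s = 0.
      apply: qgraph_below g1 => t t01; apply: (lt_le_trans h).
      by case/andP: (Qab t t01).
    move: e1; rewrite r1 mulr0 addr0 => e1.
    have : 0 <= 2 * eps * s by rewrite mulr_ge0 // ltW.
    lra.
  have r1 : r s = 1.
    apply: qgraph_above g1 => t t01; apply: le_lt_trans h.
    by case/andP: (Qab t t01).
  move: e1; rewrite r1 mulr1 => e1.
  have : 2 * eps * s <= 2 * eps by rewrite ler_piMr // ltW.
  lra.
pose E := [set s | [/\ qgraph Q (w s) (r s), u s + 2 * eps * s = w s + 2 * eps * r s,
  u s = quantile mu s & a <= w s <= b]].
have Eae : {ae @Lam R, forall s, E s}.
  apply: (Lam_aeS (Lam_aeI (Lam_aeI hr umu) wab)) => s _ [[[h1 h1'] h2] h3].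
  by split => //; exact: h2.
have Emono : slope_ge E 0 w.
  move=> s t s0 st t1 [g1 e1 u1 w1] [g2 e3 u2 w2]; rewrite mul0r subr_ge0 leNgt.
  apply/negP => wts.
  have rr := qgraph_mono g2 g1 wts.
  have h := quantile_slope0 mu s0 st t1 I I; rewrite -u1 -u2 mul0r in h.
  have : 0 <= 2 * eps * (r s - r t) by rewrite mulr_ge0 ?subr_ge0 // ltW.
  have : 0 < 2 * eps * (t - s) by rewrite mulr_gt0 // subr_gt0.
  rewrite !mulrBr; lra.
apply: (@monotone_Dplus _ _ E) => //; first exact: ltW.
move=> s t s0 st t1 [g1 e1 u1 /andP[w1 w1']] [g2 e3 u2 /andP[w2 w2']].
have ts : 0 < t - s by rewrite subr_gt0.
have [wts|wst] := leP (w t) (w s).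
  by apply: (@le_trans _ _ 0); [rewrite subr_le0|rewrite mulr_ge0 // ltW].
have h := sl s t s0 st t1 I I; rewrite -u1 -u2 in h.
have h2 := qgraph_slope_le (ltW L0) Q0 QL Qa Qb g1 g2 w1 wst w2'.
have h3 : (L + 2 * eps) * (w t - w s) <= (L + 2 * eps) * (L * (t - s)).
  have : L * (u t - u s + 2 * eps * (t - s)) = L * (w t - w s) + 2 * eps * (L * (r
    t - r s)).
    rewrite (_ : u t - u s + 2 * eps * (t - s) = (u t + 2 * eps * t) - (u s + 2 *
      eps * s)); last by ring.
    by rewrite e1 e3; ring.
  have : 2 * eps * (w t - w s) <= 2 * eps * (L * (r t - r s)) by rewrite ler_pM2l.
  have : L * (u t - u s) <= L * (L * (t - s)) by rewrite ler_pM2l.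
  lra.
by move: h3; rewrite ler_pM2l // addr_gt0.
Qed.

End resolvent.

(** * Slopes and bounds along the flow *)

Section interpolation.
Context {R : realType}.

(** The solution of [A' = kap * (l - A)] with [A 0 = l0]. *)
Definition relax (kap l l0 t : R) : R := l + (l0 - l) * expR (- (kap * t)).

Variables (kap l l0 : R).
Hypothesis kap0 : 0 <= kap.
Local Notation A := (relax kap l l0).

Lemma relax0 : A 0 = l0.
Proof. by rewrite /relax mulr0 oppr0 expR0 mulr1 addrC subrK. Qed.

(** Both bounds come from [1 + y <= expR y], at [- x] and at [x]. *)
Lemma expR_1sub (x : R) : 0 <= x -> 0 <= expR (- x) - 1 + x <= x ^+ 2.
Proof.
move=> x0.
have h1 := expR_ge1Dx (- x).
have h2 := expR_ge1Dx x.
have h3 : expR (- x) * expR x = 1 by rewrite mulrC expRxMexpNx_1.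
have h4 := expR_gt0 (- x).
have h5 : expR (- x) * (1 + x) <= 1 by rewrite -[leRHS]h3 ler_pM2l.
apply/andP; split; first lra.
have h6 : 0 < 1 + x by rewrite ltr_pwDl.
have h7 : (expR (- x) - 1 + x) * (1 + x) <= x ^+ 2 * (1 + x).
  have : 0 <= x ^+ 2 * x by rewrite mulr_ge0 // sqr_ge0.
  nra.
by move: h7; rewrite ler_pM2r.
Qed.

Lemma relax_shift t r : A (t + r) - A t =
  (l0 - l) * expR (- (kap * t)) * (expR (- (kap * r)) - 1).
Proof.
rewrite /relax mulrDr opprD expRD; ring.
Qed.

Lemma relax_le1 t : 0 <= t -> 0 < expR (- (kap * t)) <= 1.
Proof. by move=> t0; rewrite expR_gt0 expR_le1 oppr_le0 mulr_ge0. Qed.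

Lemma relax_lipschitz x y : 0 <= x -> x <= y ->
  `|A y - A x| <= (`|l0 - l| * kap) * (y - x).
Proof.
move=> x0 xy; have -> : y = x + (y - x) by rewrite addrC subrK.
rewrite relax_shift (addrAC x) subrr add0r !normrM -mulrA -mulrA ler_wpM2l //.
have /andP[e0 e1] := relax_le1 x0.
have yx : 0 <= y - x by rewrite subr_ge0.
have ky : 0 <= kap * (y - x) by rewrite mulr_ge0.
have /andP[h1 _] := expR_1sub ky.
have /andP[h3 h4] := relax_le1 yx.
rewrite (gtr0_norm e0) -[leRHS]mul1r; apply: ler_pM => //.
by rewrite ler0_norm; lra.
Qed.

Lemma relax_derivative t : 0 < t -> forall e, 0 < e -> exists2 d, 0 < d &
  forall r, 0 < r < d -> `|A (t + r) - A t - r * (kap * (l - A t))| <= e * r.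
Proof.
move=> t0 e e0; pose K := `|l0 - l| * kap ^+ 2 + 1.
have K0 : 0 < K by rewrite ltr_wpDl // mulr_ge0 // sqr_ge0.
exists (e / K); first by rewrite divr_gt0.
move=> r /andP[r0 rK].
have rK' : r * K < e by rewrite -ltr_pdivlMr.
rewrite relax_shift.
have -> : (l0 - l) * expR (- (kap * t)) * (expR (- (kap * r)) - 1) - r * (kap * (l
  - A t)) =
   (l0 - l) * (expR (- (kap * t)) * (expR (- (kap * r)) - 1 + kap * r)).
  by rewrite /relax; ring.
have kr : 0 <= kap * r by rewrite mulr_ge0 // ltW.
have /andP[h1 h2] := expR_1sub kr.
have /andP[e1 e2] := relax_le1 (ltW t0).
rewrite !normrM (gtr0_norm e1) (ger0_norm h1).
apply: (@le_trans _ _ (`|l0 - l| * (1 * (kap * r) ^+ 2))).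
  by rewrite ler_wpM2l // ler_pM // ltW.
rewrite mul1r exprMn mulrA (expr2 r) mulrA ler_wpM2r ?(ltW r0) //.
rewrite mulrC; apply: (le_trans _ (ltW rK')); rewrite ler_pM2l //.
by rewrite lerDl.
Qed.

Lemma relax_between m M t : 0 <= t -> m <= l -> m <= l0 -> l <= M -> l0 <= M ->
  m <= A t <= M.
Proof.
move=> t0 ml ml0 lM l0M; have /andP[e1 e2] := relax_le1 t0.
rewrite /relax; set E := expR _ in e1 e2 *.
have h1 : 0 <= (1 - E) * (l - m) by rewrite mulr_ge0 // subr_ge0.
have h2 : 0 <= E * (l0 - m) by rewrite mulr_ge0 ?(ltW e1) // subr_ge0.
have h3 : 0 <= (1 - E) * (M - l) by rewrite mulr_ge0 // subr_ge0.
have h4 : 0 <= E * (M - l0) by rewrite mulr_ge0 ?(ltW e1) // subr_ge0.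
nra.
Qed.

End interpolation.

Section flow_applications.
Context {R : realType} (nu mu0 : probability (measurableTypeR R) R) (g : R -> L2 R).
Hypothesis nu2 : P2 nu.
Hypothesis sol : strong_solution (Fnu nu) (quantile mu0) g.
Local Notation lam := (@lebesgue_measure R).
Local Notation Q := (quantile nu).

Lemma solution_velocity : {ae lam, forall t, 0 < t ->
  exists v, strong_derivative g t v /\
  {ae @Lam R, forall s, exists2 r, qgraph Q (g t s) r & v s = 2 * (s - r)}}.
Proof.
case: sol => _ _ _ [N [mN N0 NP]]; exists N; split => // t /= nt; apply: NP => /= H.
apply: nt => t0; have [v sd sub] := H t0; exists v; split => //.
have /(subdiff_qgraph nu2) h := sub.
apply: (Lam_aeS h) => s s01 hs; exists ((- v) s / 2 + s) => //.
by rewrite L2oppE; field.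
Qed.

Lemma solution_initial : {ae @Lam R, forall s, g 0 s = quantile mu0 s}.
Proof. by case: sol => _ _ h _; apply: (Lam_aeS h) => s _; exact. Qed.

Lemma solution_continuous0 e : 0 < e -> exists2 d, 0 < d &
  forall r, 0 < r < d -> L2norm (g r - g 0) < e.
Proof.
move=> e0; case: sol => _ /(_ 0 (lexx 0)) h _ _.
have : \forall r \near within [set r | 0 <= r] (nbhs (0 : R)), L2norm (g r - g 0) < e.
  exact: (cvgr_lt _ h _ e0).
move=> [d /= d0 dP]; exists d => // r /andP[r0 rd].
by apply: dP => /=; [rewrite sub0r normrN gtr0_norm|exact: ltW].
Qed.

(** An instance of [flow_sign] in which velocities are expressed by points of
    the completed graph; [P] carries what is already known on [g t], such as
    bounds. *)
Lemma solution_sign (be ga c kap l l0 : R) (P : R -> L2 R -> R -> Prop) : 0 <= kap ->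
  (forall t, 0 < t -> {ae @Lam R, forall s, P t (g t) s}) ->
  (forall t s s' r r', 0 < t -> 0 < s -> s < s' -> s' < 1 -> P t (g t) s ->
    P t (g t) s' ->
     qgraph Q (g t s) r -> qgraph Q (g t s') r' ->
     0 < relax kap l l0 t * (s' - s) + be * g t s' + ga * g t s + c ->
     kap * (l - relax kap l l0 t) * (s' - s) + be * (2 * (s' - r')) + ga * (2 * (s
       - r)) <= 0) ->
  (forall s s', 0 < s -> s < s' -> s' < 1 ->
     l0 * (s' - s) + be * quantile mu0 s' + ga * quantile mu0 s + c <= 0) ->
  forall t, 0 <= t -> {ae Lam2, forall p, ordered_pairs p ->
     relax kap l l0 t * (p.2 - p.1) + be * g t p.2 + ga * g t p.1 + c <= 0}.
Proof.
move=> kap0 HP Hder Hinit t t0.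
have key := @flow_sign R be ga c g (relax kap l l0) (fun t =>
  kap * (l - relax kap l l0 t))
  (`|l0 - l| * kap) _ solution_continuous0 _ (relax_lipschitz l l0 kap0)
  (relax_derivative l l0 kap0) _ _ t t0.
apply: key.
- by case: sol.
- by rewrite mulr_ge0.
- have [N [mN N0 NP]] := solution_velocity.
  exists N; split => // x /= nx; apply: NP => /= H; apply: nx => x0.
  have [v [sd hv]] := H x0; exists v; split => //.
  have [M [mM M0 MP]] := ae_prod (Lam_aeI hv (HP x x0)).
  exists M; split => // p /= np; apply: MP => /= Hp; apply: np => -[p0 p12 p1] pos.
  case: Hp => -[[r hr vr] Pr] [[r' hr' vr'] Pr'].
  rewrite /pair_affine vr vr' addr0.
  exact: (Hder x p.1 p.2 r r').
have [M [mM M0 MP]] := ae_prod solution_initial.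
exists M; split => // p /= np; apply: MP => /= -[h1 h2]; apply: np => -[p0 p12 p1].
by rewrite /pair_affine relax0 h1 h2; exact: Hinit.
Qed.

Lemma ordered_pairs_ae_fst (P : R -> Prop) : {ae Lam2, forall p, ordered_pairs p ->
  P p.1} ->
  {ae @Lam R, forall s, P s}.
Proof.
move=> /prod_ae1 H; apply: (Lam_aeS H) => s /andP[s0 s1] hs.
have [s' /andP[ss s1'] h] := Lam_dense hs (ltW s0) s1 (lexx 1).
by apply: h; split.
Qed.

(** Where the gap of [g t] is less than [A * (s' - s)], the levels differ by
    at most [A / l * (s' - s)], and the gap grows at least at the rate [2 * (1
    - A / l) * (s' - s)] of the bound. *)
Lemma flow_lower (l l0 : R) : 0 < l -> 0 <= l0 -> slope_ge setT l Q ->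
  slope_ge setT l0 (quantile mu0) -> forall t, 0 <= t ->
  exists mu, [/\ P2 mu, g t = quantile mu %[ae @Lam R] &
    slope_ge setT (relax (2 / l) l l0 t) (quantile mu)].
Proof.
move=> l_gt0 l0_ge0 Ql Q0 t t0.
have kap0 : 0 <= 2 / l by rewrite divr_ge0 // ltW.
have h : {ae Lam2, forall p, ordered_pairs p ->
     relax (2 / l) l l0 t * (p.2 - p.1) + (-1) * g t p.2 + 1 * g t p.1 + 0 <= 0}.
  apply: (@solution_sign (-1) 1 0 (2 / l) l l0 (fun _ _ _ => True)) => //.
  - by move=> x _; exact: aeW.
  - move=> x s s' r r' x0 s0 ss s1 _ _ h h'.
    have /andP[A0 _] : 0 <= relax (2 / l) l l0 x <= Num.max l l0.
      by apply: relax_between => //;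
        rewrite ?(ltW l_gt0) ?(ltW x0) // le_max lexx ?orbT.
    set A := relax _ _ _ _ in A0 *; rewrite mulN1r mul1r addr0 => pos.
    suff : 2 / l * A * (s' - s) - 2 * (r' - r) >= 0.
      have -> : 2 / l * (l - A) * (s' - s) = 2 * (s' - s) - 2 / l * A * (s' - s).
        by field; exact: lt0r_neq0.
      lra.
    have ss' : 0 < s' - s by rewrite subr_gt0.
    have e : l * (2 / l * A * (s' - s) - 2 * (r' - r)) = 2 * (A * (s' - s) - l *
      (r' - r)).
      by field; exact: lt0r_neq0.
    suff : 0 <= l * (2 / l * A * (s' - s) - 2 * (r' - r)) by rewrite pmulr_rge0.
    rewrite e mulr_ge0 // subr_ge0.
    have [rr|rr] := leP r' r.
      apply: (@le_trans _ _ 0); last by rewrite mulr_ge0 // ltW.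
      by rewrite pmulr_rle0 // subr_le0.
    have := qgraph_slope_ge l_gt0 Ql h h' rr; lra.
  - move=> s s' s0 ss s1; have := Q0 s s' s0 ss s1 I I; lra.
have /andP[A0 _] : 0 <= relax (2 / l) l l0 t <= Num.max l l0.
  by apply: relax_between => //; rewrite ?(ltW l_gt0) // le_max lexx ?orbT.
have [E [Eae HE]] : exists E : set R, {ae @Lam R, forall s, E s} /\
    forall s s', 0 < s -> s < s' -> s' < 1 -> E s -> E s' ->
     relax (2 / l) l l0 t * (s' - s) <= g t s' - g t s.
  apply: ordered_pairs_ae; first by move=> x y z _ _; lra.
  case: h => N [mN N0 NP]; exists N; split => // p /= np; apply: NP => /= H.
  by apply: np => /H; lra.
have [mu [h1 h2 h3 _ _]] := monotone_class Eae (slope_ge_le A0 HE).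
by exists mu; split => //; exact: h3.
Qed.

Section bounded.
Variables (a b : R).
Hypothesis snu : supp nu = `[a, b]%classic.
Hypothesis mu0ab : {ae @Lam R, forall s, a <= quantile mu0 s <= b}.

Let Qab s : 0 < s < 1 -> a <= Q s <= b.
Proof. by apply: supp_quantile; rewrite snu. Qed.

Lemma quantile_mu0_bounds s : 0 < s < 1 -> a <= quantile mu0 s <= b.
Proof.
move=> s01; have /andP[s0 s1] := s01.
have [r /andP[r0 rs] /andP[ra rb]] := Lam_dense mu0ab (lexx 0) s0 (ltW s1).
have [r' /andP[r0' rs'] /andP[ra' rb']] := Lam_dense mu0ab (ltW s0) s1 (lexx 1).
apply/andP; split.
  by apply: (le_trans ra); apply: quantile_nd; lra.
by apply: le_trans rb'; apply: quantile_nd; lra.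
Qed.

(** Above [b] the level is 1 and the velocity [2 * (s - 1)] is negative; below
    [a] the level is 0 and the velocity [2 * s] is positive. *)
Lemma flow_bounds t : 0 <= t -> {ae @Lam R, forall s, a <= g t s <= b}.
Proof.
move=> t0.
have up : {ae @Lam R, forall s, g t s <= b}.
  apply: ordered_pairs_ae_fst.
  have := @solution_sign 0 1 (- b) 0 0 0 (fun _ _ _ => True) (lexx 0) _ _ _ t t0.
  have z x : relax 0 0 0 x = 0 :> R by rewrite /relax subrr mul0r addr0.
  case=> [x _|x s s' r r' x0 s0 ss s1 _ _ h h'|s s' s0 ss s1|N [mN N0 NP]].
  - exact: aeW.
  - rewrite z !mul0r !add0r !mul1r => pos.
    have r1 : r = 1.
      apply: qgraph_above h => u u01; have /andP[_ ub] := Qab u01; lra.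
    rewrite r1; lra.
  - have /andP[_ hb] : a <= quantile mu0 s <= b.
      by apply: quantile_mu0_bounds; rewrite s0 (lt_trans ss).
    lra.
  exists N; split => // p /= np; apply: NP => /= H; apply: np => /H.
  by rewrite z; lra.
have lo : {ae @Lam R, forall s, a <= g t s}.
  apply: ordered_pairs_ae_fst.
  have := @solution_sign 0 (-1) a 0 0 0 (fun _ _ _ => True) (lexx 0) _ _ _ t t0.
  have z x : relax 0 0 0 x = 0 :> R by rewrite /relax subrr mul0r addr0.
  case=> [x _|x s s' r r' x0 s0 ss s1 _ _ h h'|s s' s0 ss s1|N [mN N0 NP]].
  - exact: aeW.
  - rewrite z !mul0r !add0r !mulN1r => pos.
    have r1 : r = 0.
      apply: qgraph_below h => u u01; have /andP[ub _] := Qab u01; lra.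
    rewrite r1; lra.
  - have /andP[hb _] : a <= quantile mu0 s <= b.
      by apply: quantile_mu0_bounds; rewrite s0 (lt_trans ss).
    lra.
  exists N; split => // p /= np; apply: NP => /= H; apply: np => /H.
  by rewrite z; lra.
by apply: (Lam_aeS (Lam_aeI up lo)) => s _ [h1 h2]; rewrite h1 h2.
Qed.

(** Where the order of the values is reversed, so is that of the levels, and
    the gap increases. *)
Lemma flow_monotone t : 0 <= t -> exists E : set R,
  {ae @Lam R, forall s, E s} /\ slope_ge E 0 (g t).
Proof.
move=> t0.
have h := @solution_sign (-1) 1 0 0 0 0 (fun _ _ _ => True) (lexx 0) _ _ _ t t0.
have z x : relax 0 0 0 x = 0 :> R by rewrite /relax subrr mul0r addr0.
have [E [Eae HE]] : exists E : set R, {ae @Lam R, forall s, E s} /\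
    forall s s', 0 < s -> s < s' -> s' < 1 -> E s -> E s' -> g t s <= g t s'.
  apply: ordered_pairs_ae; first by move=> x y w _ _; exact: le_trans.
  case: h => [x _|x s s' r r' x0 s0 ss s1 _ _ h h'|s s' s0 ss s1|N [mN N0 NP]].
  - exact: aeW.
  - rewrite z !mul0r !add0r mulN1r !mul1r addr0 => pos.
    have rr : r' <= r by apply: qgraph_mono h' h _; lra.
    lra.
  - have := quantile_slope0 mu0 s0 ss s1 I I; lra.
  exists N; split => // p /= np; apply: NP => /= H; apply: np => /H.
  by rewrite z; lra.
exists E; split => // s s' s0 ss s1 Es Es'; rewrite mul0r subr_ge0.
exact: HE.
Qed.

(** Where the gap of [g t] exceeds [A * (s' - s)], the levels differ by at
    least [A / l * (s' - s)] between [a] and [b], and the gap grows at most at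
    the rate of the bound. *)
Lemma flow_upper (l l0 : R) : 0 < l -> 0 <= l0 -> slope_le setT l Q ->
  slope_le setT l0 (quantile mu0) -> forall t, 0 <= t -> exists E : set R,
  [/\ {ae @Lam R, forall s, E s}, slope_ge E 0 (g t) &
      slope_le E (relax (2 / l) l l0 t) (g t)].
Proof.
move=> l_gt0 l0_ge0 Ql Q0 t t0.
have kap0 : 0 <= 2 / l by rewrite divr_ge0 // ltW.
have [x0 sx0] := supp_neq0 nu.
have ab : a <= b by move: sx0; rewrite snu /= in_itv /= => /andP[]; exact: le_trans.
have sa : supp nu a by rewrite snu /= in_itv /= lexx.
have sb : supp nu b by rewrite snu /= in_itv /= lexx andbT.
have Qa e (e0 : 0 < e) := (quantile_near_supp sa e0).1.
have Qb e (e0 : 0 < e) := (quantile_near_supp sb e0).2.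
have nrelax x : relax (2 / l) (- l) (- l0) x = - relax (2 / l) l l0 x.
  by rewrite /relax; ring.
have h : {ae Lam2, forall p, ordered_pairs p ->
     relax (2 / l) (- l) (- l0) t * (p.2 - p.1) + 1 * g t p.2 + (-1) * g t p.1 + 0
       <= 0}.
  apply: (@solution_sign 1 (-1) 0 (2 / l) (- l) (- l0) (fun _ u s =>
    a <= u s <= b)) => //.
  - by move=> x x1; apply: flow_bounds; exact: ltW.
  - move=> x s s' r r' x1 s0 ss s1 /andP[gsa _] /andP[_ gsb] h h'.
    have /andP[A0 _] : 0 <= relax (2 / l) l l0 x <= Num.max l l0.
      by apply: relax_between => //;
        rewrite ?(ltW l_gt0) ?(ltW x1) // le_max lexx ?orbT.
    rewrite nrelax; set A := relax _ _ _ _ in A0 *; rewrite mulN1r mul1r addr0 => pos.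
    have ss' : 0 < s' - s by rewrite subr_gt0.
    have As : 0 <= A * (s' - s) by rewrite mulr_ge0 // ltW.
    suff : 2 / l * A * (s' - s) - 2 * (r' - r) <= 0.
      have -> : 2 / l * (- l - - A) * (s' - s) = 2 / l * A * (s' - s) - 2 * (s' - s).
        by field; exact: lt0r_neq0.
      lra.
    have e : l * (2 / l * A * (s' - s) - 2 * (r' - r)) = 2 * (A * (s' - s) - l *
      (r' - r)).
      by field; exact: lt0r_neq0.
    suff : l * (2 / l * A * (s' - s) - 2 * (r' - r)) <= 0 by rewrite pmulr_rle0.
    rewrite e pmulr_rle0 // subr_le0.
    have gg : g x s < g x s' by lra.
    have := qgraph_slope_le (ltW l_gt0) (quantile_slope0 nu) Ql Qa Qb h h' gsa gg gsb.
    lra.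
  - move=> s s' s0 ss s1; have := Q0 s s' s0 ss s1 I I; lra.
have [E1 [E1ae HE1]] := flow_monotone t0.
have [E2 [E2ae HE2]] : exists E : set R, {ae @Lam R, forall s, E s} /\
    forall s s', 0 < s -> s < s' -> s' < 1 -> E s -> E s' ->
     g t s' - g t s <= relax (2 / l) l l0 t * (s' - s).
  apply: ordered_pairs_ae; first by move=> x y z _ _; lra.
  case: h => N [mN N0 NP]; exists N; split => // p /= np; apply: NP => /= H.
  by apply: np => /H; rewrite nrelax; lra.
exists (E1 `&` E2); split; first exact: Lam_aeI.
- by move=> s s' s0 ss s1 [e1 _] [e2 _]; exact: HE1.
- by move=> s s' s0 ss s1 [_ e1] [_ e2]; exact: HE2.
Qed.

End bounded.
End flow_applications.

(** * Distribution functions and supports of quantile classes *)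

Section lipschitz_cdf.
Context {R : realType}.
Implicit Types mu : probability (measurableTypeR R) R.

(** The constant is positive because a distribution function increases from 0
    to 1. The mass between any point to the left of [quantile mu s] and
    [quantile mu t] is at least [t - s]. *)
Lemma lipschitz_cdf_slope mu (K : R) : K.-lipschitz (cdfR mu) ->
  0 < K /\ slope_ge setT K^-1 (quantile mu).
Proof.
move=> lip.
have lip' x y : x <= y -> cdfR mu y - cdfR mu x <= K * (y - x).
  move=> xy; have := lip (y, x) (conj I I) => /= h.
  apply: (le_trans (ler_norm _)); apply: (le_trans h).
  by rewrite ger0_norm // subr_ge0.
have half : 0 < (1/2 : R) /\ 1/2 < (1 : R) by lra.
have [x1 h1] := cdfR_lim1 mu half.2.
have [x0 h0] := cdfR_lim0 mu half.1.
have x01 : x0 < x1.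
  by rewrite ltNge; apply/negP => /(cdfR_nd mu) h;
    move: (le_lt_trans (le_trans h1 h) h0); rewrite ltxx.
have K0 : 0 < K.
  have h := lip' _ _ (ltW x01).
  have : 0 < K * (x1 - x0) by lra.
  by rewrite pmulr_lgt0 // subr_gt0.
split => // s t s0 st t1 _ _.
have s01 : 0 < s < 1 by lra.
have t01 : 0 < t < 1 by lra.
rewrite mulrC ler_pdivrMr // mulrC.
apply/ler_addgt0Pr => e e0.
have Ft : t <= cdfR mu (quantile mu t) by rewrite -quantile_galois.
have Fs : cdfR mu (quantile mu s - e / K) < s.
  by rewrite ltNge -quantile_galois // -ltNge ltrBlDr ltrDl divr_gt0.
have qq : quantile mu s <= quantile mu t by apply: quantile_nd => //; exact: ltW.
have eK : 0 < e / K by rewrite divr_gt0.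
have := lip' (quantile mu s - e / K) (quantile mu t).
have -> : K * (quantile mu t - (quantile mu s - e / K)) =
  K * (quantile mu t - quantile mu s) + e by field; exact: lt0r_neq0.
by lra.
Qed.

(** The levels strictly between the two values of the distribution function
    have quantiles between [x] and [y]. *)
Lemma slope_cdf_incr mu (l x y : R) : 0 < l -> slope_ge setT l (quantile mu) ->
  x <= y ->
  cdfR mu y - cdfR mu x <= l^-1 * (y - x).
Proof.
move=> l0 H xy.
have x0 := cdfR_ge0 mu x; have y1 := cdfR_le1 mu y.
have FF := cdfR_nd mu xy.
apply/ler_addgt0Pr => e e0.
have lV : 0 <= l^-1 * (y - x) by rewrite mulr_ge0 ?subr_ge0 // invr_ge0 ltW.
have [le|lt] := leP (cdfR mu y - cdfR mu x) e; first lra.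
pose s := cdfR mu x + e / 4; pose t := cdfR mu y - e / 4.
have s01 : 0 < s < 1 by rewrite /s; lra.
have t01 : 0 < t < 1 by rewrite /t; lra.
have qs : x < quantile mu s.
  by rewrite ltNge quantile_galois // -ltNge /s ltrDl divr_gt0.
have qt : quantile mu t <= y by rewrite quantile_galois // /t gerBl divr_ge0 // ltW.
have st : s < t by rewrite /s /t; lra.
have := H s t; case/andP: s01 t01 => s0 _ /andP[_ t1] => /(_ s0 st t1 I I) h.
have : t - s <= l^-1 * (y - x).
  by rewrite mulrC ler_pdivlMr // mulrC; lra.
rewrite /s /t; lra.
Qed.

Lemma slope_lipschitz_cdf mu (l : R) : 0 < l -> slope_ge setT l (quantile mu) ->
  (l^-1).-lipschitz (cdfR mu).
Proof.
move=> l0 H [x y] _ /=.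
wlog xy : x y / y <= x => [Hw|].
  have [yx|xy] := leP y x; first exact: Hw.
  by rewrite distrC [`|x - y|]distrC; apply: Hw; exact: ltW.
rewrite (ger0_norm (x := x - y)) ?subr_ge0 // ger0_norm ?subr_ge0 ?cdfR_nd //.
exact: slope_cdf_incr.
Qed.

Lemma lipschitz_absolutely_continuous (f : R -> R) (K : R) : 0 < K ->
  K.-lipschitz f -> absolutely_continuous f.
Proof.
move=> K0 lip e e0; exists (e / K); first by rewrite divr_gt0.
move=> n a b ab _ sum.
apply: (@le_lt_trans _ _ (\sum_(i < n) K * (b i - a i))).
  apply: ler_sum => i _; have := lip (b i, a i) (conj I I) => /= h.
  by rewrite (ger0_norm (x := b i - a i)) ?subr_ge0 // in h.
by rewrite -mulr_sumr mulrC -ltr_pdivlMr.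
Qed.

Lemma Lam_preimage_ae (u : R -> R) mu : u = quantile mu %[ae @Lam R] ->
  measurable_fun setT u -> forall U : set R, measurable U -> Lam (u @^-1` U) = mu U.
Proof.
move=> e mu_ U mU; rewrite -Lam_quantile //.
have m1 : measurable (u @^-1` U : set (measurableTypeR R)).
  by rewrite -[X in measurable X]setTI; exact: mu_.
have m2 : measurable (quantile mu @^-1` U : set (measurableTypeR R)).
  by rewrite -[X in measurable X]setTI; exact: quantile_measurable.
by apply/eqP; rewrite eq_le; apply/andP; split; apply: ae_le_Lam => //;
  apply: (Lam_aeS e) => s _ /(_ I) /= ->.
Qed.

Lemma cdf_pushforward (u : R -> R) mu : u = quantile mu %[ae @Lam R] ->
  measurable_fun setT u ->
  cdfR (pushforward (@Lambda01 R) (u : measurableTypeR R ->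
    measurableTypeR R)) = cdfR mu.
Proof.
move=> e mu_; apply/funext => x; rewrite /cdfR /pushforward; congr fine.
exact: Lam_preimage_ae.
Qed.

Lemma supp_pushforward (u : R -> R) mu : u = quantile mu %[ae @Lam R] ->
  measurable_fun setT u ->
  supp (pushforward (@Lambda01 R) (u : measurableTypeR R ->
    measurableTypeR R)) = supp mu.
Proof.
move=> e mu_; apply/seteqP; split => x sx U oU Ux;
  have E := Lam_preimage_ae e mu_ (open_measurable oU).
  by rewrite -E; exact: sx.
by change (0 < Lam (u @^-1` U))%E; rewrite E; exact: sx.
Qed.

(** Let [c] be the value at [z] of the distribution function. The quantiles of
    the levels just after [c] exceed [z] by as little as the Lipschitz bound
    allows, so they enter every neighbourhood of [z]. *)
Lemma supp_between mu (L x y z : R) : 0 <= L -> slope_le setT L (quantile mu) ->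
  supp mu x -> supp mu y -> x < z -> z < y -> supp mu z.
Proof.
move=> L0 H sx sy xz zy.
have xz' : 0 < z - x by rewrite subr_gt0.
have zy' : 0 < y - z by rewrite subr_gt0.
have [[s s01 qs] _] := quantile_near_supp sx xz'.
have [_ [t t01 qt]] := quantile_near_supp sy zy'.
have {}qs : quantile mu s <= z by lra.
have {}qt : z < quantile mu t by lra.
move=> U oU Uz; rewrite -(Lam_quantile mu); last exact: open_measurable.
rewrite lt_neqAle measure_ge0 andbT eq_sym; apply/negP => /eqP U0.
have nU : {ae @Lam R, forall r, ~ U (quantile mu r)}.
  exists (quantile mu @^-1` U); split => //.
    rewrite -[X in measurable X]setTI; apply: quantile_measurable => //.
    exact: open_measurable.
  by move=> r /= /contrapT.
have [e /= e0 eU] : exists2 e, 0 < e & forall w, `|z - w| < e -> U w.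
  by have [e e0 eU] := open_nbhs_nbhs (conj oU Uz); exists e.
pose c := cdfR mu z.
have sc : s <= c by rewrite -quantile_galois.
have ct : c < t by rewrite ltNge -quantile_galois // -ltNge.
have c01 : 0 < c < 1 by lra.
have L1 : 0 < L + 1 by rewrite ltr_wpDl.
pose d := Num.min (1 - c) (e / (L + 1)).
have d0 : 0 < d by rewrite lt_min divr_gt0 // andbT; lra.
have d2 : d <= 1 - c by rewrite ge_min lexx.
have d3 : d * (L + 1) <= e by rewrite -ler_pdivlMr // ge_min lexx orbT.
have [r /andP[cr rd]] := @Lam_dense R _ c (c + d) nU
  ltac:(lra) ltac:(lra) ltac:(lra).
apply; apply: eU.
have r01 : 0 < r < 1 by lra.
have zr : z < quantile mu r by rewrite ltNge quantile_galois // -ltNge.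
have cz : quantile mu c <= z by rewrite quantile_galois.
have h : quantile mu r - quantile mu c <= L * (r - c) by apply: H => //; lra.
rewrite ltr0_norm ?subr_lt0 // opprB.
have : L * (r - c) <= L * d by rewrite ler_wpM2l //; lra.
lra.
Qed.

Lemma supp_convex mu (L : R) : 0 <= L -> slope_le setT L (quantile mu) ->
  convex_set (supp mu : set (convex_lmodType R^o)).
Proof.
move=> L0 H x y k /set_mem sx /set_mem sy; apply/mem_set.
pose z : R := k%:num * x + (1 - k%:num) * y.
change (supp mu z).
have k0 : 0 <= k%:num :> R by [].
have k1 : k%:num <= 1 :> R by [].
have [xy|yx|xy] := ltgtP (x : R) y; last first.
- by rewrite (_ : z = x) // /z xy; ring.
- have [->|zx] := eqVneq z x; first by [].
  have [->|zy] := eqVneq z y; first by [].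
  apply: (supp_between L0 H sy sx); rewrite lt_neqAle ?zx 1?eq_sym ?zy /=.
    have : 0 <= k%:num * (x - y) by rewrite mulr_ge0 // subr_ge0 ltW.
    by rewrite /z; lra.
  have : 0 <= (1 - k%:num) * (x - y) by rewrite mulr_ge0 // subr_ge0 ?ltW.
  by rewrite /z; lra.
have [->|zx] := eqVneq z x; first by [].
have [->|zy] := eqVneq z y; first by [].
apply: (supp_between L0 H sx sy); rewrite lt_neqAle ?zy 1?eq_sym ?zx /=.
  have : 0 <= (1 - k%:num) * (y - x) by rewrite mulr_ge0 // subr_ge0 ?ltW.
  by rewrite /z; lra.
have : 0 <= k%:num * (y - x) by rewrite mulr_ge0 // subr_ge0 ltW.
by rewrite /z; lra.
Qed.

End lipschitz_cdf.

(** * Best slopes of solutions *)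

Section lower_slope.
Context {R : realType} (nu mu0 : probability (measurableTypeR R) R) (g : R -> L2 R).
Hypothesis nu2 : P2 nu.
Hypothesis sol : strong_solution (Fnu nu) (quantile mu0) g.

Lemma Llow_quantile (mu : probability (measurableTypeR R) R) (L : R) : 0 <= L ->
  slope_ge setT L (quantile mu) ->
  L <= Llow (quantile mu) /\ slope_ge setT (Llow (quantile mu)) (quantile mu).
Proof.
move=> L0 H; have e : quantile mu = quantile mu %[ae @Lam R] by exact: aeW.
by have [_ h1 h2] := LlowP e; split => //; exact: h2.
Qed.

(** The bound, a mean of the two best slopes, is at least [L]. *)
Lemma lower_slope_solution (L : R) : 0 < L -> slope_ge setT L (quantile nu) ->
  slope_ge setT L (quantile mu0) -> forall t, 0 <= t ->
  let bound := relax (2 / Llow (quantile nu)) (Llow (quantile nu)) (Llow (quantile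
    mu0)) t in
  L <= bound /\ exists mu, [/\ P2 mu, g t = quantile mu %[ae @Lam R],
    slope_ge setT bound (quantile mu) & bound <= Llow (g t)].
Proof.
move=> L0 HQ H0 t t0 bound.
have [Ll sl] := Llow_quantile (ltW L0) HQ.
have [Ll0 sl0] := Llow_quantile (ltW L0) H0.
have l_gt0 := lt_le_trans L0 Ll.
have kap0 : 0 <= 2 / Llow (quantile nu) by rewrite divr_ge0 // ltW.
have /andP[Lb _] : L <= bound <= Num.max (Llow (quantile nu)) (Llow (quantile mu0)).
  by apply: relax_between => //; rewrite le_max lexx ?orbT.
split => //.
have [mu [p2 e s]] := flow_lower nu2 sol l_gt0 (ltW (lt_le_trans L0 Ll0)) sl sl0 t0.
exists mu; split => //.
have [_ _ h] := LlowP e; apply: h => //.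
exact: le_trans (ltW L0) Lb.
Qed.

End lower_slope.

Section upper_slope.
Context {R : realType} (nu mu0 : probability (measurableTypeR R) R) (g : R -> L2 R).
Hypothesis nu2 : P2 nu.
Hypothesis sol : strong_solution (Fnu nu) (quantile mu0) g.
Variables (a b L : R).
Hypothesis L0 : 0 < L.
Hypothesis snu : supp nu = `[a, b]%classic.

Lemma Lip_quantile (mu : probability (measurableTypeR R) R) :
  slope_le setT L (quantile mu) ->
  exists l, [/\ Lip (quantile mu) = l%:E,
    0 <= l <= L & slope_le setT l (quantile mu)].
Proof.
move=> H; have e : quantile mu = quantile mu %[ae @Lam R] by exact: aeW.
have [/andP[h1 h2] h3] := LipP e (ltW L0) H.
have fL : Lip (quantile mu) \is a fin_num
  by rewrite ge0_fin_numE // (le_lt_trans h2) ?ltry.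
exists (fine (Lip (quantile mu))); split => //; first by rewrite fineK.
by rewrite -!lee_fin fineK // h1.
Qed.

(** A constant quantile function has a single point as support. *)
Lemma constant_target : slope_le setT 0 (quantile nu) -> b <= a.
Proof.
move=> H; have [x0 sx0] := supp_neq0 nu.
have ab : a <= b by move: sx0; rewrite snu /= in_itv /= => /andP[]; exact: le_trans.
have sa : supp nu a by rewrite snu /= in_itv /= lexx.
have sb : supp nu b by rewrite snu /= in_itv /= lexx andbT.
apply/ler_addgt0Pr => e e0.
have e2 : 0 < e / 2 by rewrite divr_gt0.
have [s s01 qs] := (quantile_near_supp sa e2).1.
have [t t01 qt] := (quantile_near_supp sb e2).2.
have [/andP[s0 s1] /andP[t0 t1]] := (s01, t01).
have qq : quantile nu t <= quantile nu s.
  have [ts|st] := leP t s; first exact: quantile_nd.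
  by have := H s t s0 st t1 I I; rewrite mul0r subr_le0.
lra.
Qed.

(** For [l = 0] the support of [nu] is a point, and the solution is constant
    because it stays in the support; otherwise the bound is that of
    [flow_upper]. *)
Lemma upper_slope_solution (l l0 : R) : 0 <= l <= L -> 0 <= l0 <= L ->
  slope_le setT l (quantile nu) -> slope_le setT l0 (quantile mu0) ->
  {ae @Lam R, forall s, a <= quantile mu0 s <= b} -> forall t, 0 <= t ->
  let bound := l0 * decay t l + l * (1 - decay t l) in
  0 <= bound <= L /\ exists mu, [/\ P2 mu, g t = quantile mu %[ae @Lam R],
    supp mu `<=` `[a, b],
      slope_le setT bound (quantile mu) & (Lip (g t) <= bound%:E)%E].
Proof.
move=> /andP[l_ge0 lL] /andP[l0_ge0 l0L] Hl Hl0 Hab t t0 bound.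
have gab := flow_bounds nu2 sol snu Hab t0.
have [B [E [Eae E0 Eb]]] : 0 <= bound <= L /\ exists E : set R,
    [/\ {ae @Lam R, forall s, E s}, slope_ge E 0 (g t) & slope_le E bound (g t)].
  have [lz|lnz] := eqVneq l 0.
    have -> : bound = 0 by rewrite /bound /decay lz eqxx; ring.
    split; first by rewrite lexx ltW.
    have ba : b <= a by apply: constant_target; rewrite -lz.
    exists [set s | a <= g t s <= b];
      split => // s s' s0 ss s1 /andP[h1 h2] /andP[h3 h4];
      by rewrite mul0r; lra.
  have l_gt0 : 0 < l by rewrite lt_neqAle eq_sym lnz.
  have kap0 : 0 <= 2 / l by rewrite divr_ge0.
  have be : bound = relax (2 / l) l l0 t.
    rewrite /bound /decay (negbTE lnz) /relax mulrAC; ring.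
  rewrite be; split; first exact: relax_between.
  exact: (flow_upper nu2 sol snu Hab l_gt0 l0_ge0 Hl Hl0 t0).
split => //; have /andP[B0 B1] := B.
have [mu [p2 e _ h hs]] := monotone_class Eae E0.
exists mu; split => //; [exact: hs|exact: h|].
by have [/andP[_ h1] _] := LipP e B0 (h _ B0 Eb).
Qed.

End upper_slope.

Theorem corollary6p9 (R : realType)
    (nu : probability (measurableTypeR R) R) (L : R) :
  P2 nu -> 0 < L ->
  (Dminus L (quantile nu) ->
    [/\ forall (mu0 : probability (measurableTypeR R) R) (g : R -> L2 R),
          P2 mu0 -> strong_solution (Fnu nu) (quantile mu0) g ->
          Dminus L (quantile mu0) ->
          (forall t : R, 0 <= t -> Dminus L (g t)) /\
          (forall t : R, 0 < t ->
            let bound :=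
              Llow (quantile mu0) * expR (- (2 * t / Llow (quantile nu))) +
              Llow (quantile nu) *
                (1 - expR (- (2 * t / Llow (quantile nu)))) in
            bound <= Llow (g t) /\ 0 < bound),
        forall eps : R, 0 < eps ->
          maps_into_itself (resolvent (Fnu nu) eps) (Dminus L) &
        forall (mu0 : probability (measurableTypeR R) R) (g : R -> L2 R)
               (L0 : R),
          P2 mu0 -> strong_solution (Fnu nu) (quantile mu0) g ->
          L0.-lipschitz (cdfR mu0) ->
          forall t : R, 0 <= t ->
            (Num.max L0 L^-1).-lipschitz (cdfR (pushforward Lambda01 (g t))) /\
            absolutely_continuous (cdfR (pushforward Lambda01 (g t)))]) /\
  (forall a b : R, supp nu = `[a, b]%classic -> Dplus L (quantile nu) ->
    [/\ forall (mu0 : probability (measurableTypeR R) R) (g : R -> L2 R),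
          P2 mu0 -> strong_solution (Fnu nu) (quantile mu0) g ->
          (Dab a b `&` Dplus L) (quantile mu0) ->
          (forall t : R, 0 <= t -> (Dab a b `&` Dplus L) (g t)) /\
          (forall t : R, 0 < t ->
            let lnu := fine (Lip (quantile nu)) in
            let bound :=
              (Lip (quantile mu0) * (decay t lnu)%:E +
               Lip (quantile nu) * (1 - decay t lnu)%:E)%E in
            (Lip (g t) <= bound)%E /\ (bound < +oo)%E),
        forall eps : R, 0 < eps ->
          maps_into_itself (resolvent (Fnu nu) eps) (Dab a b `&` Dplus L) &
        forall (mu0 : probability (measurableTypeR R) R) (g : R -> L2 R),
          P2 mu0 -> strong_solution (Fnu nu) (quantile mu0) g ->
          convex_set (supp mu0 : set (convex_lmodType R^o)) ->
          supp mu0 `<=` `[a, b] -> Dplus L (quantile mu0) ->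
          forall t : R, 0 <= t ->
            convex_set (supp (pushforward Lambda01 (g t)) :
                          set (convex_lmodType R^o))]).
Proof.
move=> nu2 L0; split=> [HQ|a b snu HQ].
  have slQ := Dminus_quantile HQ;
    split=> [mu0 g mu02 sol H0|eps eps0|mu0 g K mu02 sol lip t t0].
  - have sl0 := Dminus_quantile H0.
    have main := lower_slope_solution nu2 sol L0 slQ sl0.
    split=> [t t0|t t0 bound].
      have [Lb [mu [p2 e s _]]] := main t t0.
      by apply/DminusE; exists mu; split => //; exact: slope_ge_le s.
    have -> : bound = relax (2 / Llow (quantile nu)) (Llow (quantile nu)) (Llow
      (quantile mu0)) t.
      by rewrite /bound /relax (mulrAC 2 t); ring.
    have [Lb [mu [_ _ _ h]]] := main t (ltW t0).
    by split => //; exact: lt_le_trans Lb.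
  - exact: resolvent_Dminus.
  - have [K0 slK] := lipschitz_cdf_slope lip.
    pose M := Num.max K L^-1.
    have M0 : 0 < M by rewrite lt_max K0.
    have MV0 : 0 < M^-1 by rewrite invr_gt0.
    have h1 : M^-1 <= L.
      by rewrite -[leRHS]invrK lef_pV2 ?posrE ?invr_gt0 // le_max lexx orbT.
    have h2 : M^-1 <= K^-1 by rewrite lef_pV2 ?posrE // le_max lexx.
    have [Lb [mu [p2 e s _]]] := lower_slope_solution nu2 sol MV0
      (slope_ge_le h1 slQ) (slope_ge_le h2 slK) t0.
    have := slope_lipschitz_cdf MV0 (slope_ge_le Lb s); rewrite invrK.
    rewrite -(cdf_pushforward e (measurable_L2 (g t))) => lipM.
    by split; [exact: lipM|exact: lipschitz_absolutely_continuous lipM].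
have slQ := Dplus_quantile HQ.
have [l [lE lb sl]] := Lip_quantile L0 slQ.
have main (mu0 : probability (measurableTypeR R) R) (g : R -> L2 R) :
    strong_solution (Fnu nu) (quantile mu0) g ->
      (Dab a b `&` Dplus L) (quantile mu0) ->
    exists l0, Lip (quantile mu0) = l0%:E /\ forall t, 0 <= t ->
    let bound := l0 * decay t l + l * (1 - decay t l) in
    0 <= bound <= L /\ exists mu, [/\ P2 mu, g t = quantile mu %[ae @Lam R],
      supp mu `<=` `[a, b],
        slope_le setT bound (quantile mu) & (Lip (g t) <= bound%:E)%E].
  move=> sol [Hab /Dplus_quantile sl0].
  have [l0 [l0E l0b sl0']] := Lip_quantile L0 sl0.
  exists l0; split => // t t0.
  exact: (upper_slope_solution nu2 sol L0 snu lb l0b sl sl0' (Dab_bounds Hab) t0).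
split=> [mu0 g mu02 sol H0|eps eps0|mu0 g mu02 sol _ sab H0 t t0].
- have [l0 [l0E H]] := main mu0 g sol H0; split=> [t t0|t t0 lnu bound].
    have [/andP[_ B] [mu [p2 e sm s _]]] := H t t0.
    split; first by exists mu.
    by apply/DplusE; exists mu; split => //; exact: slope_le_le s.
  have [_ [mu [_ _ _ _ h]]] := H t (ltW t0).
  have -> : bound = (l0 * decay t l + l * (1 - decay t l))%:E.
    by rewrite /bound /lnu l0E lE /= -!EFinM -EFinD.
  by split => //; exact: ltry.
- exact: resolvent_Dplus.
have Hab : Dab a b (quantile mu0) by exists mu0; split => //; exact: aeW.
have [l0 [_ H]] := main mu0 g sol (conj Hab H0).
have [/andP[B0 _] [mu [p2 e sm s _]]] := H t t0.
rewrite (supp_pushforward e (measurable_L2 (g t))).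
exact: supp_convex B0 s.
Qed.
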